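(* Consider the magnetic geodesic flow on the 2-torus with Riemannian metric $ds^2=\Lambda(x,y)(dx^2+dy^2)$ and a non-zero magnetic field $\Omega$ (i.e. $\Omega\not\equiv 0$). Suppose that this flow admits an additional polynomial in momenta first integral $F$ of degree 3 with (real-)analytic periodic coefficients on 2 different energy levels $\{H=E_1\}$, $\{H=E_2\}$, $E_1\neq E_2$. Then the magnetic field and the metric are functions of one variable, there exists a linear in momenta first integral $F_1$ of this flow on all energy levels, and $F$ can be expressed as a function of $F_1$ and the Hamiltonian $H$.
   Context: The 2-torus is $\mathbb{T}^2=\mathbb{R}^2/\Gamma$ ($\Gamma$ a lattice) with global conformal coordinates $(x,y)=(x^1,x^2)$ in which the metric is $ds^2=\Lambda(x,y)(dx^2+dy^2)$, $\Lambda>0$; $p_1,p_2$ are the conjugate momenta; $\Omega(x,y)$ is the magnetic field. ''Periodic'' means $\Gamma$-periodic; $\Lambda,\Omega$ are smooth, real-valued and periodic. The Hamiltonian is $H=\frac{p_1^2+p_2^2}{2\Lambda}$ and the magnetic Poisson bracket is $$\{F,H\}_{mg}=\sum_{i=1}^2\left(\frac{\partial F}{\partial x^i}\frac{\partial H}{\partial p_i}-\frac{\partial F}{\partial p_i}\frac{\partial H}{\partial x^i}\right)+\Omega(x^1,x^2)\left(\frac{\partial F}{\partial p_1}\frac{\partial H}{\partial p_2}-\frac{\partial F}{\partial p_2}\frac{\partial H}{\partial p_1}\right).$$ The magnetic geodesic flow is the flow of $\dot x^j=\{x^j,H\}_{mg}$, $\dot p_j=\{p_j,H\}_{mg}$,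 $j=1,2$. A function $F(x,y,p_1,p_2)$ is a first integral on the energy level $\{H=E\}$ ($E>0$) if $\{F,H\}_{mg}=0$ at every point with $H=E$; it is a first integral on all energy levels if $\{F,H\}_{mg}\equiv 0$. A polynomial in momenta of degree $N$ is $F=\sum_{s=0}^N\sum_{k=0}^s a_{s,k}(x,y)p_1^{s-k}p_2^k$ with real-valued periodic coefficients, not all $a_{N,k}$ identically zero; linear in momenta means degree 1. ''Additional'' means independent of $H$: $F$ is not constant on the energy levels under consideration. ''The magnetic field and metric are functions of one variable'' means that there is a nonzero $(\alpha,\beta)\in\mathbb{R}^2$ such that both $\Omega$ and $\Lambda$ depend only on $\alpha x+\beta y$ (equivalently, after a rotation of the coordinates $(x,y)$, both depend only on $y$). *)

(* Defs.v *)
From Stdlib Require Import Reals ZArith.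
From Coquelicot Require Import Coquelicot.

Open Scope R_scope.

Definition point_fun := R -> R -> R.

(* Phase-space functions are taken on the universal cover R^2 x R^2, as
   F x y p1 p2; descending to T^2 is expressed by periodicity in (x, y). *)
Definition phase_fun := R -> R -> R -> R -> R.

Record lattice := Lattice {
  gen1_x : R;
  gen1_y : R;
  gen2_x : R;
  gen2_y : R;
  gen_indep : gen1_x * gen2_y - gen1_y * gen2_x <> 0
}.

Definition in_lattice (G : lattice) (a b : R) : Prop :=
  exists m n : Z,
    a = IZR m * gen1_x G + IZR n * gen2_x G /\
    b = IZR m * gen1_y G + IZR n * gen2_y G.

Definition periodic (G : lattice) (f : point_fun) : Prop :=
  forall a b, in_lattice G a b -> forall x y, f (x + a) (y + b) = f x y.

Definition smooth (f : point_fun) : Prop :=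
  forall (n : nat) (x y : R), ex_diff_n f n x y.

(* Near every point, f is the sum of an absolutely convergent double power
   series, whose terms c i j * h^i * k^j are grouped by total degree n = i + j. *)
Definition real_analytic (f : point_fun) : Prop :=
  forall x0 y0 : R, exists (c : nat -> nat -> R) (r : R), 0 < r /\
    forall h k : R, Rabs h < r -> Rabs k < r ->
      ex_series (fun n : nat =>
        sum_n (fun i : nat => Rabs (c i (n - i)%nat * h ^ i * k ^ (n - i))) n) /\
      is_series (fun n : nat =>
        sum_n (fun i : nat => c i (n - i)%nat * h ^ i * k ^ (n - i)) n)
        (f (x0 + h) (y0 + k)).

Definition hamiltonian (Lam : point_fun) : phase_fun :=
  fun x y p1 p2 => (p1 ^ 2 + p2 ^ 2) / (2 * Lam x y).

Definition d_x (F : phase_fun) : phase_fun :=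
  fun x y p1 p2 => Derive (fun t => F t y p1 p2) x.
Definition d_y (F : phase_fun) : phase_fun :=
  fun x y p1 p2 => Derive (fun t => F x t p1 p2) y.
Definition d_p1 (F : phase_fun) : phase_fun :=
  fun x y p1 p2 => Derive (fun t => F x y t p2) p1.
Definition d_p2 (F : phase_fun) : phase_fun :=
  fun x y p1 p2 => Derive (fun t => F x y p1 t) p2.

(* [Derive] is total; the bracket is applied only to functions that are
   differentiable in each variable. *)
Definition mg_bracket (Om : point_fun) (F H : phase_fun) : phase_fun :=
  fun x y p1 p2 =>
    (d_x F x y p1 p2 * d_p1 H x y p1 p2 - d_p1 F x y p1 p2 * d_x H x y p1 p2)
  + (d_y F x y p1 p2 * d_p2 H x y p1 p2 - d_p2 F x y p1 p2 * d_y H x y p1 p2)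
  + Om x y *
    (d_p1 F x y p1 p2 * d_p2 H x y p1 p2 - d_p2 F x y p1 p2 * d_p1 H x y p1 p2).

Definition first_integral_on_level (Lam Om : point_fun) (E : R) (F : phase_fun)
  : Prop :=
  forall x y p1 p2, hamiltonian Lam x y p1 p2 = E ->
    mg_bracket Om F (hamiltonian Lam) x y p1 p2 = 0.

Definition first_integral (Lam Om : point_fun) (F : phase_fun) : Prop :=
  forall x y p1 p2, mg_bracket Om F (hamiltonian Lam) x y p1 p2 = 0.

Definition constant_on_level (Lam : point_fun) (E : R) (F : phase_fun) : Prop :=
  exists c : R, forall x y p1 p2,
    hamiltonian Lam x y p1 p2 = E -> F x y p1 p2 = c.

(* F has degree exactly N in the momenta (the top form is not identically zero),
   with G-periodic coefficients in the regularity class reg. *)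
Definition polynomial_in_momenta (G : lattice) (reg : point_fun -> Prop) (N : nat)
  (F : phase_fun) : Prop :=
  exists a : nat -> nat -> point_fun,
    (forall s k : nat, (k <= s)%nat -> (s <= N)%nat ->
       periodic G (a s k) /\ reg (a s k)) /\
    (exists (k : nat) (x y : R), (k <= N)%nat /\ a N k x y <> 0) /\
    forall x y p1 p2 : R,
      F x y p1 p2 =
      sum_n (fun s : nat =>
        sum_n (fun k : nat => a s k x y * p1 ^ (s - k) * p2 ^ k) s) N.

Definition depends_only_on (alpha beta : R) (f : point_fun) : Prop :=
  exists g : R -> R, forall x y, f x y = g (alpha * x + beta * y).

(* Main.v *)
Require Import Defs.
From Stdlib Require Import Reals Lra Lia FunctionalExtensionality Classical.
From Coquelicot Require Import Coquelicot.

(** Separating the parity in the momenta on two energy circles shows that [F] is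
    an integral on all levels.  On the null covectors [(t, i t)] it becomes a
    polynomial [a t^3 + c t^2 + e t + f] with [f] real and, with
    [D = d/dx + i d/dy], [D a = 0], [D c = -3 i Om a], [D e = -2 i Om c],
    [D f = -i Om e].  Its invariants under translation of [t] are holomorphic
    on the torus, hence constant, and differentiating them gives
    [(e . grad) e = 0] for the real vector field [e].  So [e] is constant along
    the lines [z + t e(z)]; lines with distinct directions would meet, so all
    the vectors [e(z)] are parallel to one vector [V].  Analyticity allows the
    division by the factor of proportionality and shows that everything is
    invariant along [V].  The polynomial is then [Q (V t + g)] with [Q] a real
    cubic polynomial and [F1 = V . p + g] a linear integral, and [F - Q F1],
    which vanishes on null covectors, is [H] times a linear integral, itself
    affine in [F1].  When [e = 0] identically, also [a = c = 0], [f] is constant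
    and [F - f] is [H] times a linear integral. *)

Open Scope R_scope.

(** * Smooth functions of two variables *)

(** In the bracket multiplied by [Lam], the conformal factor occurs only together with
    [p1^2 + p2^2]. Null covectors annihilate that factor, so the system found there lives on the
    flat torus. Its equations say together that [D P = - i Om dP/dt] for the null polynomial [P]:
    [D] acts as an infinitesimal translation of [t], which is why translation invariants are
    holomorphic. The reality of [f] supplies what these invariants cannot: it turns [D f] into the
    full gradient of [f], which is orthogonal to the vector [e]. Two energy values suffice in degree
    3 because the bracket has homogeneous parts of degrees 1 to 4 only, hence two of each parity,
    and a relation [r^2 A + B = 0] at two radii separates two parts. The main obstacle is that [e]
    and [Om] may vanish at some points. Such factors are removed from identities by global
    arguments: analyticity in the case of [e], the constancy of a square in the case of [Om]. *)

Definition pdx (f : point_fun) : point_fun := fun x y => Derive (fun t => f t y) x.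
Definition pdy (f : point_fun) : point_fun := fun x y => Derive (fun t => f x t) y.

Lemma point_fun_ext (f g : point_fun) : (forall x y, f x y = g x y) -> f = g.
Proof.
  intros H; extensionality x; extensionality y; apply H.
Qed.

Lemma smooth_continuity (f : point_fun) x y : smooth f -> continuity_2d_pt f x y.
Proof. intros H; exact (proj1 (H 0%nat x y)). Qed.

Lemma smooth_pdx (f : point_fun) : smooth f -> smooth (pdx f).
Proof. intros H n x y; exact (ex_diff_n_deriv_aux1 f n x y (H (S n) x y)). Qed.

Lemma smooth_pdy (f : point_fun) : smooth f -> smooth (pdy f).
Proof. intros H n x y; exact (ex_diff_n_deriv_aux2 f n x y (H (S n) x y)). Qed.

Lemma smooth_is_derive_x (f : point_fun) x y :
  smooth f -> is_derive (fun t => f t y) x (pdx f x y).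
Proof. intros H; apply Derive_correct; exact (proj1 (proj2 (H 1%nat x y))). Qed.

Lemma smooth_is_derive_y (f : point_fun) x y :
  smooth f -> is_derive (fun t => f x t) y (pdy f x y).
Proof. intros H; apply Derive_correct; exact (proj1 (proj2 (proj2 (H 1%nat x y)))). Qed.

Lemma pdx_unique (f : point_fun) x y l : is_derive (fun t => f t y) x l -> pdx f x y = l.
Proof. exact (is_derive_unique (fun t => f t y) x l). Qed.

Lemma pdy_unique (f : point_fun) x y l : is_derive (fun t => f x t) y l -> pdy f x y = l.
Proof. exact (is_derive_unique (fun t => f x t) y l). Qed.

(** Giving the partial derivatives as explicit functions is what makes inductions on the order
    possible: [pdx f] and [fx] are equal as functions, so one replaces the other under
    [ex_diff_n]. *)
Lemma ex_diff_n_S_intro (f fx fy : point_fun) n :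
  (forall x y, continuity_2d_pt f x y) ->
  (forall x y, is_derive (fun t => f t y) x (fx x y)) ->
  (forall x y, is_derive (fun t => f x t) y (fy x y)) ->
  (forall x y, ex_diff_n fx n x y) -> (forall x y, ex_diff_n fy n x y) ->
  forall x y, ex_diff_n f (S n) x y.
Proof.
  intros Hc Hx Hy Hfx Hfy x y.
  assert (Ex : pdx f = fx) by (apply point_fun_ext; intros; now apply pdx_unique).
  assert (Ey : pdy f = fy) by (apply point_fun_ext; intros; now apply pdy_unique).
  split; [apply Hc|].
  split; [eexists; apply Hx|]. split; [eexists; apply Hy|].
  change (ex_diff_n (pdx f) n x y /\ ex_diff_n (pdy f) n x y).
  rewrite Ex, Ey; auto.
Qed.

Lemma smooth_const (c : R) : smooth (fun _ _ => c).
Proof.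
  intros n; revert c; induction n as [|n IH]; intros c x y.
  - split; [apply continuity_2d_pt_const | exact I].
  - apply (ex_diff_n_S_intro _ (fun _ _ => 0) (fun _ _ => 0)); intros.
    + apply continuity_2d_pt_const.
    + apply (is_derive_const (V := R_NormedModule)).
    + apply (is_derive_const (V := R_NormedModule)).
    + apply IH.
    + apply IH.
Qed.

Lemma ex_diff_n_deriv_x (f : point_fun) n x y :
  ex_diff_n f (S n) x y -> is_derive (fun t => f t y) x (pdx f x y).
Proof. intros H; apply Derive_correct; exact (proj1 (proj2 H)). Qed.

Lemma ex_diff_n_deriv_y (f : point_fun) n x y :
  ex_diff_n f (S n) x y -> is_derive (fun t => f x t) y (pdy f x y).
Proof. intros H; apply Derive_correct; exact (proj1 (proj2 (proj2 H))). Qed.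

Lemma ex_diff_n_plus n : forall f g : point_fun,
  (forall x y, ex_diff_n f n x y) -> (forall x y, ex_diff_n g n x y) ->
  forall x y, ex_diff_n (fun u v => f u v + g u v) n x y.
Proof.
  induction n as [|n IH]; intros f g Hf Hg.
  - intros x y; split; [|exact I].
    apply continuity_2d_pt_plus; [apply Hf | apply Hg].
  - apply (ex_diff_n_S_intro _ (fun x y => pdx f x y + pdx g x y) (fun x y => pdy f x y + pdy g x y)).
    + intros; apply continuity_2d_pt_plus; [apply Hf | apply Hg].
    + intros; apply (is_derive_plus (V := R_NormedModule)); eapply ex_diff_n_deriv_x; eauto.
    + intros; apply (is_derive_plus (V := R_NormedModule)); eapply ex_diff_n_deriv_y; eauto.
    + apply IH; intros; apply ex_diff_n_deriv_aux1; auto.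
    + apply IH; intros; apply ex_diff_n_deriv_aux2; auto.
Qed.

Lemma ex_diff_n_mult n : forall f g : point_fun,
  (forall x y, ex_diff_n f n x y) -> (forall x y, ex_diff_n g n x y) ->
  forall x y, ex_diff_n (fun u v => f u v * g u v) n x y.
Proof.
  induction n as [|n IH]; intros f g Hf Hg.
  - intros x y; split; [|exact I].
    apply continuity_2d_pt_mult; [apply Hf | apply Hg].
  - assert (Hf' : forall x y, ex_diff_n f n x y)
      by (intros; apply (ex_diff_n_m (S n)); [lia | auto]).
    assert (Hg' : forall x y, ex_diff_n g n x y)
      by (intros; apply (ex_diff_n_m (S n)); [lia | auto]).
    apply (ex_diff_n_S_intro _ (fun x y => pdx f x y * g x y + f x y * pdx g x y)
                          (fun x y => pdy f x y * g x y + f x y * pdy g x y)).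
    + intros; apply continuity_2d_pt_mult; [apply Hf | apply Hg].
    + intros; apply (is_derive_mult (K := R_AbsRing) (fun t => f t y) (fun t => g t y));
        try (eapply ex_diff_n_deriv_x; eauto); exact Rmult_comm.
    + intros; apply (is_derive_mult (K := R_AbsRing) (fun t => f x t) (fun t => g x t));
        try (eapply ex_diff_n_deriv_y; eauto); exact Rmult_comm.
    + apply ex_diff_n_plus; apply IH; auto; intros; apply ex_diff_n_deriv_aux1; auto.
    + apply ex_diff_n_plus; apply IH; auto; intros; apply ex_diff_n_deriv_aux2; auto.
Qed.

Lemma smooth_plus (f g : point_fun) :
  smooth f -> smooth g -> smooth (fun x y => f x y + g x y).
Proof. intros Hf Hg n; apply ex_diff_n_plus; auto. Qed.

Lemma smooth_mult (f g : point_fun) :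
  smooth f -> smooth g -> smooth (fun x y => f x y * g x y).
Proof. intros Hf Hg n; apply ex_diff_n_mult; auto. Qed.

Lemma smooth_scal (k : R) (f : point_fun) :
  smooth f -> smooth (fun x y => k * f x y).
Proof. intros Hf; apply smooth_mult; [apply smooth_const | exact Hf]. Qed.

Lemma smooth_opp (f : point_fun) : smooth f -> smooth (fun x y => - f x y).
Proof.
  intros Hf; replace (fun x y => - f x y) with (fun x y => (-1) * f x y).
  - now apply smooth_scal.
  - apply point_fun_ext; intros; ring.
Qed.

Lemma smooth_minus (f g : point_fun) :
  smooth f -> smooth g -> smooth (fun x y => f x y - g x y).
Proof. intros Hf Hg; apply smooth_plus; [exact Hf | now apply smooth_opp]. Qed.

Ltac smooth_tac :=
  repeat first
    [ assumption | apply smooth_const | apply smooth_minus | apply smooth_plus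
    | apply smooth_opp | apply smooth_mult | apply smooth_pdx | apply smooth_pdy ].

Lemma pdx_const (c : R) : pdx (fun _ _ => c) = fun _ _ => 0.
Proof. apply point_fun_ext; intros x y; unfold pdx, pdy; apply Derive_const. Qed.

Lemma pdy_const (c : R) : pdy (fun _ _ => c) = fun _ _ => 0.
Proof. apply point_fun_ext; intros x y; unfold pdx, pdy; apply Derive_const. Qed.

Lemma pdx_plus (f g : point_fun) : smooth f -> smooth g ->
  pdx (fun x y => f x y + g x y) = fun x y => pdx f x y + pdx g x y.
Proof.
  intros Hf Hg; apply point_fun_ext; intros x y; unfold pdx, pdy; apply Derive_plus;
    eexists; now apply smooth_is_derive_x.
Qed.

Lemma pdy_plus (f g : point_fun) : smooth f -> smooth g ->
  pdy (fun x y => f x y + g x y) = fun x y => pdy f x y + pdy g x y.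
Proof.
  intros Hf Hg; apply point_fun_ext; intros x y; unfold pdx, pdy; apply Derive_plus;
    eexists; now apply smooth_is_derive_y.
Qed.

Lemma pdx_opp (f : point_fun) : pdx (fun x y => - f x y) = fun x y => - pdx f x y.
Proof. apply point_fun_ext; intros x y; unfold pdx, pdy; apply Derive_opp. Qed.

Lemma pdx_minus (f g : point_fun) : smooth f -> smooth g ->
  pdx (fun x y => f x y - g x y) = fun x y => pdx f x y - pdx g x y.
Proof.
  intros Hf Hg; apply point_fun_ext; intros x y; unfold pdx, pdy; apply Derive_minus;
    eexists; now apply smooth_is_derive_x.
Qed.

Lemma pdy_minus (f g : point_fun) : smooth f -> smooth g ->
  pdy (fun x y => f x y - g x y) = fun x y => pdy f x y - pdy g x y.
Proof.
  intros Hf Hg; apply point_fun_ext; intros x y; unfold pdx, pdy; apply Derive_minus;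
    eexists; now apply smooth_is_derive_y.
Qed.

Lemma pdx_mult (f g : point_fun) : smooth f -> smooth g ->
  pdx (fun x y => f x y * g x y) = fun x y => pdx f x y * g x y + f x y * pdx g x y.
Proof.
  intros Hf Hg; apply point_fun_ext; intros x y;
    unfold pdx, pdy; apply (Derive_mult (fun t => f t y) (fun t => g t y));
    eexists; now apply smooth_is_derive_x.
Qed.

Lemma pdy_mult (f g : point_fun) : smooth f -> smooth g ->
  pdy (fun x y => f x y * g x y) = fun x y => pdy f x y * g x y + f x y * pdy g x y.
Proof.
  intros Hf Hg; apply point_fun_ext; intros x y;
    unfold pdx, pdy; apply (Derive_mult (fun t => f x t) (fun t => g x t));
    eexists; now apply smooth_is_derive_y.
Qed.

Lemma pdx_pdy_comm (f : point_fun) x y : smooth f -> pdx (pdy f) x y = pdy (pdx f) x y.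
Proof.
  intros Hf; apply Schwarz.
  - exists (mkposreal 1 Rlt_0_1); intros u v _ _; repeat split.
    + eexists; now apply smooth_is_derive_x.
    + eexists; now apply smooth_is_derive_y.
    + eexists; apply (smooth_is_derive_x (pdy f)); now apply smooth_pdy.
    + eexists; apply (smooth_is_derive_y (pdx f)); now apply smooth_pdx.
  - apply (smooth_continuity (pdx (pdy f))); smooth_tac.
  - apply (smooth_continuity (pdy (pdx f))); smooth_tac.
Qed.

Lemma smooth_is_derive_line (f : point_fun) x y u v t : smooth f ->
  is_derive (fun t => f (x + t * u) (y + t * v)) t
    (pdx f (x + t * u) (y + t * v) * u + pdy f (x + t * u) (y + t * v) * v).
Proof.
  intros Hf.
  apply is_derive_Reals.
  apply (derivable_pt_lim_comp_2d f (fun t => x + t * u) (fun t => y + t * v)).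
  - apply filterdiff_differentiable_pt_lim.
    (* Differentiability at a point follows from one partial derivative that exists nearby and is
       continuous there, together with the mere existence of the other one. *)
    apply (is_derive_filterdiff f _ _ (pdx f)).
    + apply filter_forall; intros [a b]; now apply smooth_is_derive_x.
    + now apply smooth_is_derive_y.
    + apply (proj1 (continuity_2d_pt_filterlim (pdx f) _ _)).
      apply smooth_continuity; now apply smooth_pdx.
  - apply is_derive_Reals; auto_derive; [exact I | ring].
  - apply is_derive_Reals; auto_derive; [exact I | ring].
Qed.

(** * Periodic Cauchy-Riemann systems and the Burgers equation *)

Lemma smooth_line_continuous (f : point_fun) x y u v t : smooth f ->
  continuous (fun t => f (x + t * u) (y + t * v)) t.
Proof.
  intros Hf; apply (ex_derive_continuous (V := R_NormedModule)).
  eexists; now apply smooth_is_derive_line.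
Qed.

Lemma derivative_zero_const (f : R -> R) (a b : R) :
  (forall t, is_derive f t 0) -> f a = f b.
Proof.
  intros H.
  destruct (MVT_gen f a b (fun _ => 0)) as [c [_ Hc]].
  - intros; apply H.
  - intros t _; apply continuity_pt_filterlim.
    apply (ex_derive_continuous (V := R_NormedModule)); eexists; apply H.
  - lra.
Qed.

Lemma nondecreasing_of_derive (f f' : R -> R) (a b : R) :
  (forall t, a <= t <= b -> is_derive f t (f' t)) ->
  (forall t, a <= t <= b -> 0 <= f' t) -> a <= b -> f a <= f b.
Proof.
  intros Hd Hp Hab.
  destruct (MVT_gen f a b f') as [c [Hc E]].
  - intros t Ht; rewrite Rmin_left, Rmax_right in Ht by lra; apply Hd; lra.
  - intros t Ht; rewrite Rmin_left, Rmax_right in Ht by lra.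
    apply continuity_pt_filterlim.
    apply (ex_derive_continuous (V := R_NormedModule)); eexists; apply Hd; lra.
  - rewrite Rmin_left, Rmax_right in Hc by lra.
    assert (0 <= f' c * (b - a)) by (apply Rmult_le_pos; [apply Hp|]; lra). lra.
Qed.

(** Monotonicity squeezes the function to a constant between the two ends. The interval is symmetric
    so that 0 is interior and the two-sided derivative is determined there. *)
Lemma nondecreasing_ends_eq (f f' : R -> R) :
  (forall t, is_derive f t (f' t)) -> (forall t, 0 <= f' t) ->
  f (-1) = f 1 -> f' 0 = 0.
Proof.
  intros Hd Hp E.
  assert (M : forall a b, a <= b -> f a <= f b)
    by (intros; now apply (nondecreasing_of_derive f f')).
  rewrite <- (is_derive_unique _ _ _ (Hd 0)).
  transitivity (Derive (fun _ => f 1) 0); [|apply Derive_const].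
  apply Derive_ext_loc; exists (mkposreal 1 Rlt_0_1); intros t Ht.
  unfold ball in Ht; simpl in Ht; unfold AbsRing_ball, abs, minus, plus, opp in Ht; simpl in Ht.
  apply Rabs_def2 in Ht.
  assert (f t <= f 1) by (apply M; lra). assert (f (-1) <= f t) by (apply M; lra). lra.
Qed.

(** * Divergences and Cauchy-Riemann systems on the torus *)

Section Lattice.

Variable G : lattice.

Lemma in_lattice_gen1 (m : Z) : in_lattice G (IZR m * gen1_x G) (IZR m * gen1_y G).
Proof. exists m, 0%Z; simpl; split; ring. Qed.

Lemma in_lattice_gen2 (m : Z) : in_lattice G (IZR m * gen2_x G) (IZR m * gen2_y G).
Proof. exists 0%Z, m; simpl; split; ring. Qed.

Let D1 (f : point_fun) : point_fun := fun x y => pdx f x y * gen1_x G + pdy f x y * gen1_y G.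
Let D2 (f : point_fun) : point_fun := fun x y => pdx f x y * gen2_x G + pdy f x y * gen2_y G.

Lemma smooth_D1 (f : point_fun) : smooth f -> smooth (D1 f).
Proof. intros; unfold D1; smooth_tac. Qed.

Lemma smooth_D2 (f : point_fun) : smooth f -> smooth (D2 f).
Proof. intros; unfold D2; smooth_tac. Qed.

(* The integral of [h] along the first generator has as derivative along the
   second one the integral of [D2 h], to which [D1 k] does not contribute. *)
Lemma nonneg_divergence_zero (h k : point_fun) :
  smooth h -> smooth k -> periodic G h -> periodic G k ->
  (forall x y, 0 <= D2 h x y - D1 k x y) ->
  forall x y, D2 h x y - D1 k x y = 0.
Proof.
  intros Hh Hk Ph Pk Hq x0 y0.
  (* Affine coordinates along the two generators, centred at the point under study, which is
     [s = t = 0]. *)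
  set (px s t := x0 + t * gen2_x G + s * gen1_x G).
  set (py s t := y0 + t * gen2_y G + s * gen1_y G).
  set (q := fun x y => D2 h x y - D1 k x y).
  assert (Sq : smooth q)
    by (unfold q; apply smooth_minus; [now apply smooth_D2 | now apply smooth_D1]).
  assert (Cont : forall f, smooth f -> forall s t, continuous (fun s => f (px s t) (py s t)) s)
    by (intros f Hf s t; unfold px, py; now apply smooth_line_continuous).
  assert (Int : forall f, smooth f -> forall a b t,
            ex_RInt (fun s => f (px s t) (py s t)) a b)
    by (intros f Hf a b t; apply (ex_RInt_continuous (V := R_CompleteNormedModule));
        intros; now apply Cont).
  assert (Der2 : forall f, smooth f -> forall s t,
            is_derive (fun t => f (px s t) (py s t)) t (D2 f (px s t) (py s t))).
  { intros f Hf s t.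
    pose proof (smooth_is_derive_line f (x0 + s * gen1_x G) (y0 + s * gen1_y G)
      (gen2_x G) (gen2_y G) t Hf) as H.
    replace (px s t) with (x0 + s * gen1_x G + t * gen2_x G) by (unfold px; ring).
    replace (py s t) with (y0 + s * gen1_y G + t * gen2_y G) by (unfold py; ring).
    eapply is_derive_ext; [|apply H]. intros u; unfold px, py; f_equal; ring. }
  assert (Der1 : forall f, smooth f -> forall s t,
            is_derive (fun s => f (px s t) (py s t)) s (D1 f (px s t) (py s t)))
    by (intros f Hf s t; unfold px, py, D1; now apply smooth_is_derive_line).
  set (K t := RInt (fun s => h (px s t) (py s t)) (-1) 1).
  assert (DK : forall t, is_derive K t (RInt (fun s => q (px s t) (py s t)) (-1) 1)).
  { intros t.
    assert (E : RInt (fun s => q (px s t) (py s t)) (-1) 1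
              = RInt (fun s => D2 h (px s t) (py s t)) (-1) 1).
    { assert (E1 : RInt (fun s => D1 k (px s t) (py s t)) (-1) 1 = 0).
      { apply is_RInt_unique.
        replace 0 with (minus (k (px 1 t) (py 1 t)) (k (px (-1) t) (py (-1) t))).
        - apply (is_RInt_derive (V := R_CompleteNormedModule)
                   (fun s => k (px s t) (py s t))); intros s _.
          + now apply Der1.
          + apply Cont; now apply smooth_D1.
        - unfold minus, plus, opp; simpl.
          (* The interval from -1 to 1 covers two periods, whence the multiple 2 of the
             generator. *)
          rewrite <- (Pk _ _ (in_lattice_gen1 2) (px (-1) t) (py (-1) t)).
          replace (px (-1) t + IZR 2 * gen1_x G) with (px 1 t) by (unfold px; ring).
          replace (py (-1) t + IZR 2 * gen1_y G) with (py 1 t) by (unfold py; ring).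
          ring. }
      unfold q.
      rewrite (RInt_minus (V := R_CompleteNormedModule)
                 (fun s => D2 h (px s t) (py s t)) (fun s => D1 k (px s t) (py s t))).
      - rewrite E1; unfold minus, plus, opp; simpl; ring.
      - apply Int; now apply smooth_D2.
      - apply Int; now apply smooth_D1. }
    rewrite E.
    assert (E2 : forall t s, Derive (fun z => h (px s z) (py s z)) t = D2 h (px s t) (py s t))
      by (intros; apply is_derive_unique; now apply Der2).
    rewrite <- (RInt_ext (fun s => Derive (fun z => h (px s z) (py s z)) t))
      by (intros; apply E2).
    apply (is_derive_RInt_param (fun t s => h (px s t) (py s t))).
    - apply filter_forall; intros; eexists; now apply Der2.
    - intros s _.
      apply continuity_2d_pt_ext with (fun u v => D2 h (px v u) (py v u));
        [intros; now rewrite E2|].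
      assert (SD : smooth (D2 h)) by now apply smooth_D2.
      apply continuity_2d_pt_filterlim.
      assert (C0 := proj1 (continuity_2d_pt_filterlim _ _ _)
                      (smooth_continuity (D2 h) (px s t) (py s t) SD)).
      apply (continuous_comp_2 (fun z : R * R => px (snd z) (fst z))
               (fun z : R * R => py (snd z) (fst z)) (D2 h) (t, s)); [| | exact C0].
      + apply (continuity_2d_pt_filterlim (fun u v => px v u) t s).
        unfold px; repeat first
          [apply continuity_2d_pt_plus | apply continuity_2d_pt_mult |
           apply continuity_2d_pt_id1 | apply continuity_2d_pt_id2 |
           apply continuity_2d_pt_const].
      + apply (continuity_2d_pt_filterlim (fun u v => py v u) t s).
        unfold py; repeat first
          [apply continuity_2d_pt_plus | apply continuity_2d_pt_mult |
           apply continuity_2d_pt_id1 | apply continuity_2d_pt_id2 |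
           apply continuity_2d_pt_const].
    - apply filter_forall; intros; now apply Int. }
  (* [K] is nondecreasing because [q] is nonnegative, and periodicity of [h] along the second
     generator makes its values at -1 and 1 agree. *)
  assert (Zero : RInt (fun s => q (px s 0) (py s 0)) (-1) 1 = 0).
  { apply (nondecreasing_ends_eq K (fun t => RInt (fun s => q (px s t) (py s t)) (-1) 1)).
    - exact DK.
    - intros t; apply RInt_ge_0; [lra | now apply Int | intros; apply Hq].
    - unfold K; apply RInt_ext; intros s _.
      rewrite <- (Ph _ _ (in_lattice_gen2 2) (px s (-1)) (py s (-1))).
      unfold px, py; f_equal; ring. }
  (* The same argument in the variable [s]: the primitive of [q] is nondecreasing with equal ends,
     so its derivative [q] vanishes at the centre. *)
  assert (Q0 : q (px 0 0) (py 0 0) = 0).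
  { apply (nondecreasing_ends_eq (RInt (fun s => q (px s 0) (py s 0)) (-1))
             (fun s => q (px s 0) (py s 0))).
    - intros s; apply (is_derive_RInt (V := R_NormedModule)
        (fun s => q (px s 0) (py s 0)) (RInt (fun s => q (px s 0) (py s 0)) (-1)) (-1)).
      + apply filter_forall; intros; apply (RInt_correct (V := R_CompleteNormedModule)); now apply Int.
      + now apply Cont.
    - intros; apply Hq.
    - rewrite Zero; apply (RInt_point (V := R_CompleteNormedModule)). }
  replace (px 0 0) with x0 in Q0 by (unfold px; ring).
  replace (py 0 0) with y0 in Q0 by (unfold py; ring).
  exact Q0.
Qed.

Lemma periodic_pdx (f : point_fun) : smooth f -> periodic G f -> periodic G (pdx f).
Proof.
  intros Sf Hf a b Hab x y; symmetry; apply pdx_unique.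
  apply (is_derive_ext (fun t => f (t + a) (y + b))); [intros; now apply Hf|].
  rewrite <- (Rmult_1_l (pdx f (x + a) (y + b))).
  apply (is_derive_comp (V := R_NormedModule) (fun t => f t (y + b)) (fun t => t + a)).
  - now apply smooth_is_derive_x.
  - auto_derive; [exact I | ring].
Qed.

Lemma periodic_pdy (f : point_fun) : smooth f -> periodic G f -> periodic G (pdy f).
Proof.
  intros Sf Hf a b Hab x y; symmetry; apply pdy_unique.
  apply (is_derive_ext (fun t => f (x + a) (t + b))); [intros; now apply Hf|].
  rewrite <- (Rmult_1_l (pdy f (x + a) (y + b))).
  apply (is_derive_comp (V := R_NormedModule) (fun t => f (x + a) t) (fun t => t + b)).
  - now apply smooth_is_derive_y.
  - auto_derive; [exact I | ring].
Qed.

(** The 2-form [d f1 ^ d f2 = d (f1 d f2)] is exact, and by the Cauchy-Riemann equations its density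
    is the squared gradient of [f1]. A nonnegative divergence of periodic functions vanishes. The
    determinant [d] converts between the lattice basis and the coordinates; its square keeps the
    sign independent of the orientation of the basis. *)
Lemma periodic_cauchy_riemann_pdx (f1 f2 : point_fun) :
  smooth f1 -> smooth f2 -> periodic G f1 -> periodic G f2 ->
  (forall x y, pdx f1 x y = pdy f2 x y) -> (forall x y, pdy f1 x y = - pdx f2 x y) ->
  forall x y, pdx f1 x y = 0 /\ pdy f1 x y = 0.
Proof.
  intros S1 S2 P1 P2 E1 E2 x y.
  set (d := gen1_x G * gen2_y G - gen1_y G * gen2_x G).
  assert (Hd : d <> 0) by apply gen_indep.
  assert (Sx2 : smooth (pdx f2)) by smooth_tac. assert (Sy2 : smooth (pdy f2)) by smooth_tac.
  assert (Sk : forall c, smooth (fun _ _ => c)) by apply smooth_const.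
  assert (J : forall x y,
    D2 (fun x y => - d * (f1 x y * D1 f2 x y)) x y - D1 (fun x y => - d * (f1 x y * D2 f2 x y)) x y
    = d * d * (pdx f1 x y * pdx f1 x y + pdy f1 x y * pdy f1 x y)).
  { clear x y; intros x y; unfold D1, D2.
    repeat first [rewrite pdx_mult by smooth_tac | rewrite pdy_mult by smooth_tac
      | rewrite pdx_plus by smooth_tac | rewrite pdy_plus by smooth_tac
      | rewrite pdx_const | rewrite pdy_const].
    cbv beta. rewrite (pdx_pdy_comm f2) by assumption.
    replace (pdx f2 x y) with (- pdy f1 x y) by (rewrite E2; ring).
    replace (pdy f2 x y) with (pdx f1 x y) by apply E1.
    unfold d; ring. }
  assert (Z : d * d * (pdx f1 x y * pdx f1 x y + pdy f1 x y * pdy f1 x y) = 0).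
  { rewrite <- J.
    apply (nonneg_divergence_zero (fun x y => - d * (f1 x y * D1 f2 x y))
             (fun x y => - d * (f1 x y * D2 f2 x y))).
    - unfold D1; smooth_tac.
    - unfold D2; smooth_tac.
    - intros a b Hab u v; unfold D1.
      now rewrite P1, (periodic_pdx f2), (periodic_pdy f2).
    - intros a b Hab u v; unfold D2.
      now rewrite P1, (periodic_pdx f2), (periodic_pdy f2).
    - intros u v; specialize (J u v); unfold D1, D2 in J |- *; rewrite J; nra. }
  apply Rmult_integral in Z; destruct Z as [Z|Z].
  - exfalso; apply Hd; nra.
  - split; nra.
Qed.

End Lattice.

(** * Vanishing derivatives and the characteristics of the Burgers equation *)

Lemma gradient_zero_const (f : point_fun) : smooth f ->
  (forall x y, pdx f x y = 0) -> (forall x y, pdy f x y = 0) ->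
  forall x y x' y', f x y = f x' y'.
Proof.
  intros Sf Hx Hy x y x' y'; transitivity (f x' y).
  - apply (derivative_zero_const (fun t => f t y)); intros t.
    rewrite <- (Hx t y); now apply smooth_is_derive_x.
  - apply (derivative_zero_const (fun t => f x' t)); intros t.
    rewrite <- (Hy x' t); now apply smooth_is_derive_y.
Qed.

Lemma directional_zero_const (f : point_fun) (u v : R) : smooth f ->
  (forall x y, u * pdx f x y + v * pdy f x y = 0) ->
  forall x y t, f (x + t * u) (y + t * v) = f x y.
Proof.
  intros Sf H x y t.
  transitivity (f (x + 0 * u) (y + 0 * v)); [|f_equal; ring].
  apply (derivative_zero_const (fun t => f (x + t * u) (y + t * v))); intros s.
  replace 0 with (pdx f (x + s * u) (y + s * v) * u + pdy f (x + s * u) (y + s * v) * v).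
  - now apply smooth_is_derive_line.
  - rewrite <- (H (x + s * u) (y + s * v)); ring.
Qed.

(** The function [phi t * exp (- K t)] does not increase, so it cannot become positive after
    starting at zero. *)
Lemma gronwall_zero (phi phi' : R -> R) (K : R) :
  (forall t, 0 <= t <= 1 -> is_derive phi t (phi' t)) ->
  (forall t, 0 <= t <= 1 -> phi' t <= K * phi t) ->
  phi 0 = 0 -> 0 <= phi 1 -> phi 1 = 0.
Proof.
  intros Hd Hk H0 H1.
  assert (M : - (phi 0 * exp (- (K * 0))) <= - (phi 1 * exp (- (K * 1)))).
  { apply (nondecreasing_of_derive (fun t => - (phi t * exp (- (K * t))))
             (fun t => - (phi' t * exp (- (K * t)) + phi t * (- K * exp (- (K * t))))));
      [| |lra].
    - intros t Ht; apply (is_derive_opp (V := R_NormedModule)).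
      apply (is_derive_mult (K := R_AbsRing) phi (fun t => exp (- (K * t))));
        [now apply Hd | auto_derive; [exact I | ring] | exact Rmult_comm].
    - intros t Ht; specialize (Hk t Ht).
      pose proof (exp_pos (- (K * t))); nra. }
  rewrite H0 in M; pose proof (exp_pos (- (K * 1))); nra.
Qed.

Lemma smooth_bounded_on_segment (f : point_fun) x y u v : smooth f ->
  exists M, forall t, 0 <= t <= 1 -> Rabs (f (x + t * u) (y + t * v)) <= M.
Proof.
  intros Sf.
  destruct (bounded_continuity (K := R_AbsRing) (V := R_NormedModule)
    (fun t => f (x + t * u) (y + t * v)) 0 1) as [M HM].
  - intros t _; now apply smooth_line_continuous.
  - exists M; intros t Ht; left; exact (HM t Ht).
Qed.

Lemma is_derive_dist_sqr (g1 g2 : R -> R) (v1 v2 t d1 d2 : R) :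
  is_derive g1 t d1 -> is_derive g2 t d2 ->
  is_derive (fun t => (g1 t - v1) ^ 2 + (g2 t - v2) ^ 2) t
    (2 * (g1 t - v1) * d1 + 2 * (g2 t - v2) * d2).
Proof.
  intros D1 D2; auto_derive.
  - split; [eexists; exact D1 | split; [eexists; exact D2 | exact I]].
  - assert (E1 : Derive (fun x : R => g1 x) t = d1) by (apply is_derive_unique; exact D1).
    assert (E2 : Derive (fun x : R => g2 x) t = d2) by (apply is_derive_unique; exact D2).
    rewrite E1, E2; ring.
Qed.

Lemma sum_sqr_zero (a b : R) : a ^ 2 + b ^ 2 = 0 -> a = 0 /\ b = 0.
Proof. intros H; split; nra. Qed.

(* The difference [e (z + s v) - e z] with [v = tau * e z] satisfies a linear
   differential inequality in [s], because [(e . grad) e = 0]. *)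
Lemma burgers_constant_on_lines (e1 e2 : point_fun) : smooth e1 -> smooth e2 ->
  (forall x y, e1 x y * pdx e1 x y + e2 x y * pdy e1 x y = 0) ->
  (forall x y, e1 x y * pdx e2 x y + e2 x y * pdy e2 x y = 0) ->
  forall x y tau,
    e1 (x + tau * e1 x y) (y + tau * e2 x y) = e1 x y /\
    e2 (x + tau * e1 x y) (y + tau * e2 x y) = e2 x y.
Proof.
  intros S1 S2 B1 B2 x y tau.
  set (v1 := e1 x y); set (v2 := e2 x y).
  set (px t := x + t * (tau * v1)); set (py t := y + t * (tau * v2)).
  destruct (smooth_bounded_on_segment (pdx e1) x y (tau * v1) (tau * v2)) as [M1 H1];
    [smooth_tac|].
  destruct (smooth_bounded_on_segment (pdy e1) x y (tau * v1) (tau * v2)) as [M2 H2];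
    [smooth_tac|].
  destruct (smooth_bounded_on_segment (pdx e2) x y (tau * v1) (tau * v2)) as [M3 H3];
    [smooth_tac|].
  destruct (smooth_bounded_on_segment (pdy e2) x y (tau * v1) (tau * v2)) as [M4 H4];
    [smooth_tac|].
  set (phi t := (e1 (px t) (py t) - v1) ^ 2 + (e2 (px t) (py t) - v2) ^ 2).
  set (d1 t := pdx e1 (px t) (py t) * (tau * v1) + pdy e1 (px t) (py t) * (tau * v2)).
  set (d2 t := pdx e2 (px t) (py t) * (tau * v1) + pdy e2 (px t) (py t) * (tau * v2)).
  assert (Z : phi 1 = 0).
  { apply (gronwall_zero phi
      (fun t => 2 * (e1 (px t) (py t) - v1) * d1 t + 2 * (e2 (px t) (py t) - v2) * d2 t)
      (2 * Rabs tau * (M1 + M2 + M3 + M4))).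
    - intros t _.
      pose proof (smooth_is_derive_line e1 x y (tau * v1) (tau * v2) t S1) as D1.
      pose proof (smooth_is_derive_line e2 x y (tau * v1) (tau * v2) t S2) as D2.
      fold (px t) (py t) in D1, D2. fold (d1 t) in D1. fold (d2 t) in D2.
      exact (is_derive_dist_sqr _ _ v1 v2 t _ _ D1 D2).
    - intros t Ht.
      specialize (H1 t Ht); specialize (H2 t Ht); specialize (H3 t Ht); specialize (H4 t Ht).
      fold (px t) (py t) in H1, H2, H3, H4.
      specialize (B1 (px t) (py t)); specialize (B2 (px t) (py t)).
      unfold phi, d1, d2.
      set (w1 := e1 (px t) (py t)) in *; set (w2 := e2 (px t) (py t)) in *.
      set (a1 := pdx e1 (px t) (py t)) in *; set (a2 := pdy e1 (px t) (py t)) in *.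
      set (a3 := pdx e2 (px t) (py t)) in *; set (a4 := pdy e2 (px t) (py t)) in *.
      set (q1 := w1 - v1); set (q2 := w2 - v2).
      (* The derivative of [e] at the moving point annihilates its own value [w] there. Hence its
         value on [tau * v] is minus its value on [tau * (w - v)], and the derivative of [phi]
         becomes a quadratic form in [q = w - v], bounded by a multiple of [phi]. *)
      replace (2 * q1 * (a1 * (tau * v1) + a2 * (tau * v2)) + 2 * q2 * (a3 * (tau * v1) + a4 * (tau * v2)))
        with (- 2 * tau * (a1 * q1 * q1 + a2 * (q1 * q2) + a3 * (q1 * q2) + a4 * q2 * q2)).
      2:{ unfold q1, q2. ring_simplify in B1; ring_simplify in B2.
          replace (a1 * w1 + a2 * w2) with 0 in * by lra.
          transitivity (-2 * tau * ((w1 - v1) * ((w1 * a1 + w2 * a2) - (a1 * v1 + a2 * v2))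
             + (w2 - v2) * ((w1 * a3 + w2 * a4) - (a3 * v1 + a4 * v2)))); [ring|].
          replace (w1 * a1 + w2 * a2) with 0 by lra.
          replace (w1 * a3 + w2 * a4) with 0 by lra. ring. }
      set (S := q1 ^ 2 + q2 ^ 2).
      assert (Bd : forall a M q, Rabs a <= M -> Rabs q <= S -> Rabs (a * q) <= M * S).
      { intros; rewrite Rabs_mult; apply Rmult_le_compat; auto using Rabs_pos. }
      assert (Q1 : Rabs (q1 * q1) <= S) by (apply Rabs_le; unfold S; split; nra).
      assert (Q2 : Rabs (q1 * q2) <= S) by (apply Rabs_le; unfold S; split; nra).
      assert (Q3 : Rabs (q2 * q2) <= S) by (apply Rabs_le; unfold S; split; nra).
      pose proof (Bd _ _ _ H1 Q1) as T1. pose proof (Bd _ _ _ H2 Q2) as T2.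
      pose proof (Bd _ _ _ H3 Q2) as T3. pose proof (Bd _ _ _ H4 Q3) as T4.
      set (W := a1 * q1 * q1 + a2 * (q1 * q2) + a3 * (q1 * q2) + a4 * q2 * q2).
      assert (HW : Rabs W <= (M1 + M2 + M3 + M4) * S).
      { replace W with (a1 * (q1 * q1) + (a2 * (q1 * q2) + (a3 * (q1 * q2) + a4 * (q2 * q2))))
          by (unfold W; ring).
        eapply Rle_trans; [apply Rabs_triang|].
        pose proof (Rabs_triang (a2 * (q1 * q2)) (a3 * (q1 * q2) + a4 * (q2 * q2))).
        pose proof (Rabs_triang (a3 * (q1 * q2)) (a4 * (q2 * q2))). lra. }
      eapply Rle_trans; [apply Rle_abs|].
      rewrite Rabs_mult, Rabs_mult, (Rabs_left (-2)) by lra.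
      rewrite !Rmult_assoc. replace (- - 2) with 2 by ring.
      apply Rmult_le_compat_l; [lra|]. apply Rmult_le_compat_l; [apply Rabs_pos|].
      exact HW.
    - unfold phi, px, py.
      replace (x + 0 * (tau * v1)) with x by ring. replace (y + 0 * (tau * v2)) with y by ring.
      unfold v1, v2; ring.
    - unfold phi; apply Rplus_le_le_0_compat; apply pow2_ge_0. }
  unfold phi, px, py in Z; rewrite !Rmult_1_l in Z.
  apply sum_sqr_zero in Z; lra.
Qed.

Lemma burgers_parallel (e1 e2 : point_fun) : smooth e1 -> smooth e2 ->
  (forall x y, e1 x y * pdx e1 x y + e2 x y * pdy e1 x y = 0) ->
  (forall x y, e1 x y * pdx e2 x y + e2 x y * pdy e2 x y = 0) ->
  forall x y x' y', e1 x y * e2 x' y' = e2 x y * e1 x' y'.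
Proof.
  intros S1 S2 B1 B2 x y x' y'.
  apply NNPP; intros N.
  set (d := e1 x y * e2 x' y' - e2 x y * e1 x' y').
  assert (Hd : d <> 0) by (unfold d; lra).
  (* Cramer's rule for the intersection of the two characteristic lines. At the common point [e]
     takes both values, so the two vectors coincide, contradicting [d <> 0]. *)
  set (s := ((x' - x) * e2 x' y' - (y' - y) * e1 x' y') / d).
  set (t := ((x' - x) * e2 x y - (y' - y) * e1 x y) / d).
  destruct (burgers_constant_on_lines e1 e2 S1 S2 B1 B2 x y s) as [U1 U2].
  destruct (burgers_constant_on_lines e1 e2 S1 S2 B1 B2 x' y' t) as [V1 V2].
  assert (X : x + s * e1 x y = x' + t * e1 x' y')
    by (unfold s, t; field_simplify_eq; [unfold d; ring | exact Hd]).
  assert (Y : y + s * e2 x y = y' + t * e2 x' y')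
    by (unfold s, t; field_simplify_eq; [unfold d; ring | exact Hd]).
  rewrite <- X, <- Y in V1, V2.
  apply N; rewrite <- V1, <- V2, U1, U2; ring.
Qed.

(** * Double power series *)

(** Restated at type [R], so that rewriting produces ordinary real sums, visible to [ring] and
    [lra], rather than operations of an abstract structure. *)
Lemma sum_n_R_S (u : nat -> R) n : sum_n u (S n) = sum_n u n + u (S n) :> R.
Proof. exact (sum_Sn u n). Qed.

Lemma sum_n_R_0 (u : nat -> R) : sum_n u 0 = u 0%nat :> R.
Proof. exact (sum_O u). Qed.

Lemma sum_n_R_shift (u : nat -> R) n : sum_n u (S n) = u 0%nat + sum_n (fun i => u (S i)) n.
Proof.
  unfold sum_n; rewrite sum_Sn_m by lia; rewrite <- sum_n_m_S; reflexivity.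
Qed.

Lemma sum_n_R_ext (u v : nat -> R) n : (forall i, u i = v i) -> sum_n u n = sum_n v n :> R.
Proof. exact (sum_n_ext u v n). Qed.

Lemma sum_n_R_rev (u : nat -> R) n : sum_n (fun i => u (n - i)%nat) n = sum_n u n.
Proof.
  induction n as [|n IH]; [now rewrite !sum_n_R_0|].
  rewrite sum_n_R_shift, sum_n_R_S, <- IH, Nat.sub_0_r, Rplus_comm; f_equal.
Qed.

Lemma sum_n_R_le (u v : nat -> R) n :
  (forall i, (i <= n)%nat -> u i <= v i) -> sum_n u n <= sum_n v n.
Proof.
  induction n as [|n IH]; intros H; [rewrite !sum_n_R_0; apply H; lia|].
  rewrite !sum_n_R_S; apply Rplus_le_compat; [apply IH; intros; apply H | apply H]; lia.
Qed.

Lemma sum_n_R_Rabs (u : nat -> R) n : Rabs (sum_n u n) <= sum_n (fun i => Rabs (u i)) n.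
Proof.
  induction n as [|n IH]; [rewrite !sum_n_R_0; lra|].
  rewrite !sum_n_R_S; eapply Rle_trans; [apply Rabs_triang|]; lra.
Qed.

Lemma sum_n_R_scal (k : R) (u : nat -> R) n : sum_n (fun i => k * u i) n = k * sum_n u n.
Proof. apply (sum_n_mult_l (K := R_Ring)). Qed.

Lemma Rabs_pow_le (h s : R) n : Rabs h <= s -> Rabs (h ^ n) <= s ^ n.
Proof. intros H; rewrite <- RPow_abs; apply pow_incr; split; [apply Rabs_pos | exact H]. Qed.

(** The new series is the variable times the derived series, and neither differentiation nor the
    shift changes the radius. *)
Lemma CV_radius_INR_mult (a : nat -> R) :
  CV_radius (fun n => INR n * a n) = CV_radius a.
Proof.
  rewrite <- (CV_radius_derive a), <- (CV_radius_incr_1 (PS_derive a)).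
  apply CV_radius_ext; intros [|n]; [apply Rmult_0_l | reflexivity].
Qed.

Lemma is_derive_of_quadratic_remainder (f : R -> R) x l M d :
  0 < d -> (forall t, Rabs t < d -> Rabs (f (x + t) - f x - t * l) <= M * t ^ 2) ->
  is_derive f x l.
Proof.
  intros Hd H; apply is_derive_Reals; intros eps Heps.
  (* Nothing prevents [M] from being zero or negative; [Rabs M + 1] is a positive bound by which one
     can divide. *)
  assert (HM : 0 < Rabs M + 1) by (pose proof (Rabs_pos M); lra).
  assert (Hdel : 0 < Rmin d (eps / (Rabs M + 1)))
    by (apply Rmin_pos; [exact Hd | now apply Rdiv_lt_0_compat]).
  exists (mkposreal _ Hdel); intros t Ht0 Ht; simpl in Ht.
  assert (Ht1 : Rabs t < d) by (eapply Rlt_le_trans; [exact Ht | apply Rmin_l]).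
  assert (Ht2 : Rabs t < eps / (Rabs M + 1)) by (eapply Rlt_le_trans; [exact Ht | apply Rmin_r]).
  assert (Pt : 0 < Rabs t) by now apply Rabs_pos_lt.
  replace ((f (x + t) - f x) / t - l) with ((f (x + t) - f x - t * l) / t) by (field; auto).
  unfold Rdiv at 1; rewrite Rabs_mult, Rabs_inv.
  apply (Rmult_lt_reg_r (Rabs t)); [exact Pt|].
  rewrite Rmult_assoc, Rinv_l, Rmult_1_r by lra.
  eapply Rle_lt_trans; [now apply H|].
  apply (Rle_lt_trans _ (Rabs M * Rabs t * Rabs t)).
  - rewrite <- (pow2_abs t). pose proof (Rle_abs M). nra.
  - apply Rmult_lt_compat_r; [exact Pt|].
    apply (Rmult_lt_compat_r (Rabs M + 1)) in Ht2; [|exact HM].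
    unfold Rdiv in Ht2; rewrite Rmult_assoc, Rinv_l, Rmult_1_r in Ht2 by lra. nra.
Qed.

(** The second-order Taylor remainder of a power, by induction on the exponent. The factor [s ^ 2]
    stands on the left so that neither an exponent [i - 2] nor a division by [s] occurs. *)
Lemma pow_remainder_bound (h t s : R) i : Rabs h <= s -> Rabs (h + t) <= s ->
  Rabs ((h + t) ^ i - h ^ i - t * (INR i * h ^ pred i)) * s ^ 2 <= INR i ^ 2 * s ^ i * t ^ 2.
Proof.
  intros Hh Ht; assert (Hs : 0 <= s) by (pose proof (Rabs_pos h); lra).
  induction i as [|i IH].
  - simpl; replace (1 - 1 - t * (0 * 1)) with 0 by ring; rewrite Rabs_R0; lra.
  - set (e := (h + t) ^ i - h ^ i - t * (INR i * h ^ pred i)) in *.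
    (* The remainder satisfies the recursion [e_(i+1) = (h + t) e_i + t^2 i h^(i-1)]. The two terms
       are bounded with the coefficients [i^2] and [i], and [(i+1)^2 = i^2 + i + (i+1)] leaves a
       nonnegative surplus. *)
    replace ((h + t) ^ S i - h ^ S i - t * (INR (S i) * h ^ pred (S i)))
      with ((h + t) * e + t ^ 2 * (INR i * h ^ pred i)).
    2:{ unfold e; rewrite S_INR; destruct i as [|i]; simpl; ring. }
    assert (B : Rabs (t ^ 2 * (INR i * h ^ pred i)) * s ^ 2 <= t ^ 2 * (INR i * s ^ S i)).
    { rewrite Rabs_mult, (Rabs_pos_eq (t ^ 2)) by apply pow2_ge_0.
      rewrite Rmult_assoc; apply Rmult_le_compat_l; [apply pow2_ge_0|].
      destruct i as [|i]; [simpl; rewrite !Rmult_0_l, Rabs_R0; lra|].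
      rewrite Rabs_mult, (Rabs_pos_eq (INR (S i))) by apply pos_INR.
      rewrite Rmult_assoc; apply Rmult_le_compat_l; [apply pos_INR|].
      replace (s ^ S (S i)) with (s ^ i * s ^ 2) by (simpl; ring).
      apply Rmult_le_compat_r; [apply pow2_ge_0 | now apply Rabs_pow_le]. }
    assert (A : Rabs ((h + t) * e) * s ^ 2 <= s * (INR i ^ 2 * s ^ i * t ^ 2)).
    { rewrite Rabs_mult, Rmult_assoc; apply Rmult_le_compat; auto using Rabs_pos.
      apply Rmult_le_pos; [apply Rabs_pos | apply pow2_ge_0]. }
    apply (Rle_trans _ ((Rabs ((h + t) * e) + Rabs (t ^ 2 * (INR i * h ^ pred i))) * s ^ 2)).
    + apply Rmult_le_compat_r; [apply pow2_ge_0 | apply Rabs_triang].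
    + apply (Rle_trans _ (s * (INR i ^ 2 * s ^ i * t ^ 2) + t ^ 2 * (INR i * s ^ S i)));
        [rewrite Rmult_plus_distr_r; now apply Rplus_le_compat|].
      assert (P : 0 <= s ^ S i * t ^ 2 * (INR i + 1)).
      { pose proof (pos_INR i).
        apply Rmult_le_pos; [apply Rmult_le_pos; [now apply pow_le | apply pow2_ge_0] | lra]. }
      replace (INR (S i) ^ 2 * s ^ S i * t ^ 2)
        with (s * (INR i ^ 2 * s ^ i * t ^ 2) + t ^ 2 * (INR i * s ^ S i)
              + s ^ S i * t ^ 2 * (INR i + 1)) by (rewrite S_INR; simpl; ring).
      lra.
Qed.

(** * Majorants and termwise differentiation of a double series *)

Section DoubleSeries.

Variables (c : nat -> nat -> R) (rho : R).

(** The majorant: where [Rabs h] and [Rabs k] are at most [s], the part of degree [n] is at most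
    [C n * s ^ n]. Convergence questions for the double series thus reduce to the one-variable power
    series with coefficients [C]. *)
Let C (n : nat) : R := sum_n (fun i => Rabs (c i (n - i)%nat)) n.
Let q (h k : R) (n : nat) : R := sum_n (fun i => c i (n - i)%nat * h ^ i * k ^ (n - i)) n.
Let c' (i j : nat) : R := INR (S i) * c (S i) j.
Let q' (h k : R) (n : nat) : R := sum_n (fun i => c' i (n - i)%nat * h ^ i * k ^ (n - i)) n.

Hypothesis rho_pos : 0 < rho.
Hypothesis C_summable : ex_series (fun n => C n * rho ^ n).

Lemma C_nonneg n : 0 <= C n.
Proof.
  unfold C; apply Rle_trans with (sum_n (fun _ => 0) n).
  - clear; induction n as [|n IH]; [rewrite sum_n_R_0; lra | rewrite sum_n_R_S; lra].
  - apply sum_n_R_le; intros; apply Rabs_pos.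
Qed.

Lemma CV_radius_C s : 0 <= s < rho -> Rbar_lt (Rabs s) (CV_radius C).
Proof.
  intros Hs; rewrite Rabs_pos_eq by lra.
  apply Rbar_lt_le_trans with rho; [simpl; lra|].
  apply Rbar_not_lt_le; intros N.
  apply (CV_disk_outside C rho); [now rewrite Rabs_pos_eq by lra | now apply ex_series_lim_0].
Qed.

Lemma ex_series_C s : 0 <= s < rho -> ex_series (fun n => C n * s ^ n).
Proof. intros Hs; apply ex_pseries_R, CV_radius_inside; now apply CV_radius_C. Qed.

Lemma ex_series_nC s : 0 <= s < rho -> ex_series (fun n => INR n * C n * s ^ n).
Proof.
  intros Hs; apply (ex_pseries_R (fun n => INR n * C n)), CV_radius_inside.
  rewrite CV_radius_INR_mult; now apply CV_radius_C.
Qed.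

Lemma ex_series_n2C s : 0 <= s < rho -> ex_series (fun n => INR n * (INR n * C n) * s ^ n).
Proof.
  intros Hs; apply (ex_pseries_R (fun n => INR n * (INR n * C n))), CV_radius_inside.
  rewrite 2!CV_radius_INR_mult; now apply CV_radius_C.
Qed.

Lemma monomial_bound (x h k s : R) i j : Rabs h <= s -> Rabs k <= s ->
  Rabs (x * h ^ i * k ^ j) <= Rabs x * s ^ (i + j).
Proof.
  intros Hh Hk; rewrite pow_add, <- Rmult_assoc, !Rabs_mult.
  assert (0 <= s) by (pose proof (Rabs_pos h); lra).
  apply Rmult_le_compat; auto using Rabs_pos, Rabs_pow_le.
  - apply Rmult_le_pos; apply Rabs_pos.
  - apply Rmult_le_compat_l; auto using Rabs_pos, Rabs_pow_le.
Qed.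

Lemma homogeneous_abs_bound (h k s : R) n : Rabs h <= s -> Rabs k <= s ->
  sum_n (fun i => Rabs (c i (n - i)%nat * h ^ i * k ^ (n - i))) n <= C n * s ^ n.
Proof.
  intros Hh Hk; unfold C; rewrite Rmult_comm, <- sum_n_R_scal.
  apply sum_n_R_le; intros i Hi.
  rewrite (Rmult_comm (s ^ n)).
  replace (s ^ n) with (s ^ (i + (n - i))) by (f_equal; lia).
  now apply monomial_bound.
Qed.

Lemma ex_series_abs_q (h k : R) : Rabs h < rho -> Rabs k < rho ->
  ex_series (fun n => sum_n (fun i => Rabs (c i (n - i)%nat * h ^ i * k ^ (n - i))) n).
Proof.
  intros Hh Hk; set (s := Rmax (Rabs h) (Rabs k)).
  assert (Hs : 0 <= s < rho).
  { split; [apply Rle_trans with (Rabs h); [apply Rabs_pos | apply Rmax_l]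
           | now apply Rmax_lub_lt]. }
  apply (ex_series_le (V := R_CompleteNormedModule) _ (fun n => C n * s ^ n)).
  - intros n; unfold norm; simpl; unfold abs; simpl.
    rewrite Rabs_pos_eq.
    + apply homogeneous_abs_bound; [apply Rmax_l | apply Rmax_r].
    + eapply Rle_trans; [apply Rabs_pos | apply sum_n_R_Rabs].
  - now apply ex_series_C.
Qed.

Lemma ex_series_q (h k : R) : Rabs h < rho -> Rabs k < rho -> ex_series (q h k).
Proof.
  intros Hh Hk.
  apply (ex_series_le (V := R_CompleteNormedModule) _ _ (fun n => sum_n_R_Rabs _ n)).
  now apply ex_series_abs_q.
Qed.

Lemma derived_coef_bound n :
  sum_n (fun i => Rabs (c' i (n - i)%nat)) n <= INR (S n) * C (S n).
Proof.
  apply Rle_trans with (INR (S n) * sum_n (fun i => Rabs (c (S i) (n - i)%nat)) n).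
  - rewrite <- sum_n_R_scal; apply sum_n_R_le; intros i Hi.
    unfold c'; rewrite Rabs_mult, (Rabs_pos_eq (INR (S i))) by apply pos_INR.
    apply Rmult_le_compat_r; [apply Rabs_pos | apply le_INR; lia].
  - apply Rmult_le_compat_l; [apply pos_INR|].
    unfold C; rewrite sum_n_R_shift; simpl Nat.sub.
    pose proof (Rabs_pos (c 0 (S n))); lra.
Qed.

Lemma derived_summable s : 0 < s < rho ->
  ex_series (fun n => sum_n (fun i => Rabs (c' i (n - i)%nat)) n * s ^ n).
Proof.
  intros Hs.
  apply (ex_series_le (V := R_CompleteNormedModule) _ (fun n => / s * (INR (S n) * C (S n) * s ^ S n))).
  - intros n; unfold norm; simpl norm; unfold abs; simpl abs.
    assert (P : 0 < s ^ n) by (apply pow_lt; lra).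
    rewrite Rabs_pos_eq.
    + replace (/ s * (INR (S n) * C (S n) * s ^ S n)) with (INR (S n) * C (S n) * s ^ n)
        by (simpl pow; field; lra).
      apply Rmult_le_compat_r; [lra | apply derived_coef_bound].
    + apply Rmult_le_pos; [|lra].
      eapply Rle_trans; [apply Rabs_pos | apply sum_n_R_Rabs].
  - apply (ex_series_scal (V := R_NormedModule)).
    apply (ex_series_incr_1 (fun n => INR n * C n * s ^ n)); apply ex_series_nC; lra.
Qed.

(** Differentiation lowers the degree, so degree [S n] of the series is compared with degree [n] of
    the derived one. The square of [INR i] from the remainder of [h ^ i] is bounded by the square of
    the total degree, which accounts for the two factors [INR (S n)]. *)
Lemma homogeneous_remainder (h t k s : R) n :
  Rabs h <= s -> Rabs (h + t) <= s -> Rabs k <= s -> 0 < s ->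
  Rabs (q (h + t) k (S n) - q h k (S n) - t * q' h k n)
    <= INR (S n) * (INR (S n) * C (S n)) * s ^ S n * (t ^ 2 / s ^ 2).
Proof.
  intros Hh Ht Hk Hs.
  set (m := S n).
  (* Adding the term [i = 0], which is null because of the factor [INR 0], lets all three sums run
     over the same indices; the truncated [pred 0] is harmless. *)
  assert (E : t * q' h k n
     = t * sum_n (fun i => c i (m - i)%nat * (INR i * h ^ pred i) * k ^ (m - i)) m).
  { f_equal; unfold m; rewrite sum_n_R_shift; simpl INR at 1.
    rewrite Rmult_0_l, Rmult_0_r, Rmult_0_l, Rplus_0_l.
    unfold q', c'; apply sum_n_R_ext; intros i; simpl Nat.sub; simpl pred; ring. }
  rewrite E; clear E.
  assert (L : forall p,
    sum_n (fun i => c i (m - i)%nat * (h + t) ^ i * k ^ (m - i)) p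
    - sum_n (fun i => c i (m - i)%nat * h ^ i * k ^ (m - i)) p
    - t * sum_n (fun i => c i (m - i)%nat * (INR i * h ^ pred i) * k ^ (m - i)) p
    = sum_n (fun i => c i (m - i)%nat * ((h + t) ^ i - h ^ i - t * (INR i * h ^ pred i))
                      * k ^ (m - i)) p :> R).
  { induction p as [|p IH]; [rewrite !sum_n_R_0; ring | rewrite !sum_n_R_S, <- IH; ring]. }
  unfold q; rewrite L; clear L.
  eapply Rle_trans; [apply sum_n_R_Rabs|].
  replace (INR m * (INR m * C m) * s ^ m * (t ^ 2 / s ^ 2))
    with (INR m ^ 2 * s ^ m * (t ^ 2 / s ^ 2) * C m) by ring.
  unfold C; rewrite <- sum_n_R_scal; apply sum_n_R_le; intros i Hi.
  rewrite !Rabs_mult.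
  assert (P2 : 0 < s ^ 2) by (apply pow_lt; lra).
  pose proof (pow_remainder_bound h t s i Hh Ht) as B.
  assert (Bk : Rabs (k ^ (m - i)) <= s ^ (m - i)) by now apply Rabs_pow_le.
  set (e := Rabs ((h + t) ^ i - h ^ i - t * (INR i * h ^ pred i))) in *.
  assert (B' : e <= INR i ^ 2 * s ^ i * (t ^ 2 / s ^ 2)).
  { apply (Rmult_le_reg_r (s ^ 2)); [exact P2|].
    eapply Rle_trans; [exact B|]. right; field; lra. }
  assert (He : 0 <= e) by apply Rabs_pos.
  assert (Ts : 0 <= t ^ 2 / s ^ 2)
    by (apply Rmult_le_pos; [apply pow2_ge_0 | left; now apply Rinv_0_lt_compat]).
  assert (I2 : INR i ^ 2 <= INR m ^ 2)
    by (apply pow_incr; split; [apply pos_INR | apply le_INR; lia]).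
  replace (s ^ m) with (s ^ i * s ^ (m - i)) by (rewrite <- pow_add; f_equal; lia).
  rewrite Rmult_assoc, Rmult_comm.
  apply Rmult_le_compat_r; [apply Rabs_pos|].
  apply Rle_trans with (INR i ^ 2 * s ^ i * (t ^ 2 / s ^ 2) * s ^ (m - i)).
  - apply Rmult_le_compat; auto using Rabs_pos.
  - replace (INR m ^ 2 * (s ^ i * s ^ (m - i)) * (t ^ 2 / s ^ 2))
      with (INR m ^ 2 * (s ^ i * s ^ (m - i) * (t ^ 2 / s ^ 2))) by ring.
    replace (INR i ^ 2 * s ^ i * (t ^ 2 / s ^ 2) * s ^ (m - i))
      with (INR i ^ 2 * (s ^ i * s ^ (m - i) * (t ^ 2 / s ^ 2))) by ring.
    apply Rmult_le_compat_r; [|exact I2].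
    apply Rmult_le_pos; [apply Rmult_le_pos; apply pow_le; lra | exact Ts].
Qed.

Lemma q_0 (h k : R) : q h k 0%nat = c 0 0.
Proof. unfold q; rewrite sum_n_R_0; simpl; ring. Qed.

(** Discharged in [expands_is_derive] by applying the lemmas above to the derived coefficients in
    place of [c], an instantiation that is available only once the section is closed. *)
Hypothesis q'_summable : forall h k, Rabs h < rho -> Rabs k < rho -> ex_series (q' h k).

Lemma is_derive_double_series (h k : R) : Rabs h < rho -> Rabs k < rho ->
  is_derive (fun h => Series (q h k)) h (Series (q' h k)).
Proof.
  intros Hh Hk.
  (* With [s] halfway between the point and [rho], increments below [(rho - m) / 2] keep [h + t]
     within [s], while the majorants still converge at [s]. *)
  set (m := Rmax (Rabs h) (Rabs k)); set (s := (m + rho) / 2).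
  assert (Hm : m < rho) by now apply Rmax_lub_lt.
  assert (Hh' : Rabs h <= m) by apply Rmax_l. assert (Hk' : Rabs k <= m) by apply Rmax_r.
  assert (Hm0 : 0 <= m) by (pose proof (Rabs_pos h); lra).
  set (b n := INR n * (INR n * C n) * s ^ n).
  assert (Sb : ex_series b) by (apply ex_series_n2C; unfold s; lra).
  assert (Sb1 : ex_series (fun n => b (S n))) by now apply (ex_series_incr_1 b).
  apply (is_derive_of_quadratic_remainder _ _ _ (Series (fun n => b (S n)) / s ^ 2) ((rho - m) / 2));
    [lra|].
  intros t Ht.
  assert (Hht : Rabs (h + t) <= s)
    by (eapply Rle_trans; [apply Rabs_triang|]; unfold s; lra).
  assert (Sq1 : ex_series (q (h + t) k)) by (apply ex_series_q; unfold s in *; lra).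
  assert (Sq0 : ex_series (q h k)) by now apply ex_series_q.
  (* The terms of degree 0 cancel, and the remaining series start at degree 1, matching degree 0 of
     the derived series. *)
  rewrite (Series_incr_1 (q (h + t) k)), (Series_incr_1 (q h k)), !q_0 by assumption.
  apply ex_series_incr_1 in Sq1; apply ex_series_incr_1 in Sq0.
  rewrite <- Series_scal_l.
  replace (c 0%nat 0%nat + Series (fun n => q (h + t) k (S n))
           - (c 0%nat 0%nat + Series (fun n => q h k (S n)))
           - Series (fun n => t * q' h k n))
    with (Series (fun n => q (h + t) k (S n) - q h k (S n) - t * q' h k n)).
  2:{ assert (ex_series (fun n => t * q' h k n))
        by (apply (ex_series_scal (V := R_NormedModule)); auto).
      rewrite !Series_minus; auto; [ring|].
      now apply (ex_series_minus (V := R_NormedModule)). }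
  replace (Series (fun n => b (S n)) / s ^ 2 * t ^ 2)
    with (Series (fun n => b (S n) * (t ^ 2 / s ^ 2))).
  2:{ rewrite Series_scal_r; field; unfold s; lra. }
  assert (Bd : forall n, Rabs (q (h + t) k (S n) - q h k (S n) - t * q' h k n)
     <= b (S n) * (t ^ 2 / s ^ 2))
    by (intros n; apply homogeneous_remainder; unfold s in *; lra).
  assert (Sb2 : ex_series (fun n => b (S n) * (t ^ 2 / s ^ 2)))
    by now apply ex_series_scal_r.
  eapply Rle_trans; [apply Series_Rabs|].
  - eapply (ex_series_le (V := R_CompleteNormedModule)); [|exact Sb2].
    intros n; unfold norm; simpl norm; unfold abs; simpl abs; rewrite Rabs_Rabsolu; apply Bd.
  - apply Series_le; [|exact Sb2].
    intros n; split; [apply Rabs_pos | apply Bd].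
Qed.

(** By homogeneity, shrinking the square from [s] to [m] multiplies the part of degree [n + 1] by at
    most [(m / s) ^ (n + 1)], hence by at most [m / s]. *)
Lemma double_series_center_bound : exists M, forall h k,
  Rabs h <= rho / 2 -> Rabs k <= rho / 2 ->
  Rabs (Series (q h k) - c 0%nat 0%nat) <= M * Rmax (Rabs h) (Rabs k).
Proof.
  set (s := rho / 2).
  assert (Sb : ex_series (fun n => C n * s ^ n)) by (apply ex_series_C; unfold s; lra).
  assert (Sb1 : ex_series (fun n => C (S n) * s ^ S n))
    by now apply (ex_series_incr_1 (fun n => C n * s ^ n)).
  exists (Series (fun n => C (S n) * s ^ S n) / s); intros h k Hh Hk.
  set (m := Rmax (Rabs h) (Rabs k)).
  assert (Hm0 : 0 <= m) by (eapply Rle_trans; [apply Rabs_pos | apply Rmax_l]).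
  assert (Hm : m <= s) by now apply Rmax_lub.
  assert (Hs : 0 < s) by (unfold s; lra).
  assert (Sq : ex_series (q h k)) by (apply ex_series_q; unfold s in *; lra).
  rewrite Series_incr_1, q_0 by exact Sq.
  replace (c 0%nat 0%nat + Series (fun n => q h k (S n)) - c 0%nat 0%nat)
    with (Series (fun n => q h k (S n))) by ring.
  replace (Series (fun n => C (S n) * s ^ S n) / s * m)
    with (Series (fun n => C (S n) * s ^ S n * (m / s))).
  2:{ rewrite Series_scal_r; field; lra. }
  assert (Bd : forall n, Rabs (q h k (S n)) <= C (S n) * s ^ S n * (m / s)).
  { intros n; unfold q; eapply Rle_trans; [apply sum_n_R_Rabs|].
    eapply Rle_trans; [apply (homogeneous_abs_bound h k m); [apply Rmax_l | apply Rmax_r]|].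
    rewrite Rmult_assoc; apply Rmult_le_compat_l; [apply C_nonneg|].
    replace (s ^ S n * (m / s)) with (m * s ^ n) by (simpl; field; lra).
    simpl; apply Rmult_le_compat_l; [exact Hm0 | apply pow_incr; lra]. }
  assert (Sb2 : ex_series (fun n => C (S n) * s ^ S n * (m / s))) by now apply ex_series_scal_r.
  eapply Rle_trans; [apply Series_Rabs|].
  - eapply (ex_series_le (V := R_CompleteNormedModule)); [|exact Sb2].
    intros n; unfold norm; simpl norm; unfold abs; simpl abs; rewrite Rabs_Rabsolu; apply Bd.
  - apply Series_le; [|exact Sb2].
    intros n; split; [apply Rabs_pos | apply Bd].
Qed.

End DoubleSeries.

(** * Real-analytic functions of two variables *)

Definition abs_coef (c : nat -> nat -> R) (n : nat) : R :=
  sum_n (fun i => Rabs (c i (n - i)%nat)) n.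

Definition hom_part (c : nat -> nat -> R) (h k : R) (n : nat) : R :=
  sum_n (fun i => c i (n - i)%nat * h ^ i * k ^ (n - i)) n.

(** A single condition on the coefficients at the radius [rho] governs the whole square, in place of
    convergence at each point; this is the form to which the majorant lemmas apply. *)
Definition expands (f : point_fun) (x0 y0 : R) (c : nat -> nat -> R) (rho : R) : Prop :=
  0 < rho /\ ex_series (fun n => abs_coef c n * rho ^ n) /\
  forall h k, Rabs h < rho -> Rabs k < rho ->
    f (x0 + h) (y0 + k) = Series (hom_part c h k).

Lemma real_analytic_expands (f : point_fun) : real_analytic f ->
  forall x0 y0, exists c rho, expands f x0 y0 c rho.
Proof.
  intros Hf x0 y0; destruct (Hf x0 y0) as [c [r [Hr H]]].
  (* Convergence is given only on the open square of radius [r]; at its interior point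
     [h = k = r / 2] the absolute series is exactly the series of the majorant. *)
  exists c, (r / 2); split; [lra|]; split.
  - destruct (H (r / 2) (r / 2)) as [Ha _]; try (rewrite Rabs_pos_eq; lra).
    eapply ex_series_ext; [|exact Ha].
    intros n; unfold abs_coef; rewrite Rmult_comm, <- sum_n_R_scal.
    apply sum_n_ext_loc; intros i Hi.
    rewrite !Rabs_mult, (Rabs_pos_eq ((r / 2) ^ i)), (Rabs_pos_eq ((r / 2) ^ (n - i)))
      by (apply pow_le; lra).
    replace ((r / 2) ^ n) with ((r / 2) ^ i * (r / 2) ^ (n - i))
      by (rewrite <- pow_add; f_equal; lia).
    change (Rabs (c i (n - i)%nat) * (r / 2) ^ i * (r / 2) ^ (n - i)
      = (r / 2) ^ i * (r / 2) ^ (n - i) * Rabs (c i (n - i)%nat)); ring.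
  - intros h k Hh Hk; symmetry; apply is_series_unique.
    apply H; lra.
Qed.

Lemma expands_real_analytic (f : point_fun) :
  (forall x0 y0, exists c rho, expands f x0 y0 c rho) -> real_analytic f.
Proof.
  intros H x0 y0; destruct (H x0 y0) as [c [rho [Hr [Hs E]]]].
  exists c, rho; split; [exact Hr|]; intros h k Hh Hk; split.
  - now apply (ex_series_abs_q c rho).
  - rewrite E by assumption; apply Series_correct.
    now apply (ex_series_q c rho).
Qed.

Definition dx_coef (c : nat -> nat -> R) (i j : nat) : R := INR (S i) * c (S i) j.

Lemma expands_is_derive (f : point_fun) x0 y0 c rho : expands f x0 y0 c rho ->
  forall h k, Rabs h < rho -> Rabs k < rho ->
  is_derive (fun t => f t (y0 + k)) (x0 + h) (Series (hom_part (dx_coef c) h k)).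
Proof.
  intros [Hr [Hs E]] h k Hh Hk.
  assert (D : is_derive (fun h => Series (hom_part c h k)) h
                (Series (hom_part (dx_coef c) h k))).
  { apply (is_derive_double_series c rho); try assumption.
    clear h k Hh Hk; intros h k Hh Hk.
    set (s := (Rmax (Rabs h) (Rabs k) + rho) / 2).
    assert (Rmax (Rabs h) (Rabs k) < rho) by now apply Rmax_lub_lt.
    pose proof (Rmax_l (Rabs h) (Rabs k)); pose proof (Rmax_r (Rabs h) (Rabs k)).
    pose proof (Rabs_pos h).
    apply (ex_series_q (dx_coef c) s); try (unfold s; lra).
    apply (derived_summable c rho); try assumption; unfold s; lra. }
  assert (D' : is_derive (fun h => Series (hom_part c h k)) (x0 + h - x0)
                 (Series (hom_part (dx_coef c) h k)))
    by (replace (x0 + h - x0) with h by ring; exact D).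
  assert (D2 : is_derive (fun t => Series (hom_part c (t - x0) k)) (x0 + h)
                 (1 * Series (hom_part (dx_coef c) h k))).
  { apply (is_derive_comp (V := R_NormedModule) (fun h => Series (hom_part c h k)) (fun t => t - x0)).
    - exact D'.
    - auto_derive; [exact I | ring]. }
  rewrite Rmult_1_l in D2.
  eapply is_derive_ext_loc; [|exact D2].
  assert (Hd : 0 < rho - Rabs h) by lra.
  exists (mkposreal _ Hd); intros t Ht.
  unfold ball in Ht; simpl in Ht; unfold AbsRing_ball, abs, minus, plus, opp in Ht; simpl in Ht.
  rewrite <- E; [f_equal; ring | | exact Hk].
  replace (t - x0) with (h + (t + - (x0 + h))) by ring.
  eapply Rle_lt_trans; [apply Rabs_triang|]; lra.
Qed.

Lemma expands_pdx (f : point_fun) x0 y0 c rho :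
  expands f x0 y0 c rho -> expands (pdx f) x0 y0 (dx_coef c) (rho / 2).
Proof.
  intros H; pose proof H as [Hr [Hs E]]; split; [lra|]; split.
  - apply (derived_summable c rho); try assumption; lra.
  - intros h k Hh Hk; apply pdx_unique; apply (expands_is_derive f x0 y0 c rho); try assumption; lra.
Qed.

Lemma real_analytic_pdx (f : point_fun) : real_analytic f -> real_analytic (pdx f).
Proof.
  intros Hf; apply expands_real_analytic; intros x0 y0.
  destruct (real_analytic_expands f Hf x0 y0) as [c [rho H]].
  exists (dx_coef c), (rho / 2); now apply expands_pdx.
Qed.

Lemma real_analytic_is_derive_x (f : point_fun) x y : real_analytic f ->
  is_derive (fun t => f t y) x (pdx f x y).
Proof.
  intros Hf; destruct (real_analytic_expands f Hf x y) as [c [rho H]].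
  apply Derive_correct; eexists.
  pose proof (expands_is_derive f x y c rho H 0 0) as D; rewrite !Rplus_0_r in D.
  destruct H as [Hr _]; apply D; rewrite Rabs_R0; exact Hr.
Qed.

(** Each point is the centre of an expansion of its own, so the estimate at the centre is enough. *)
Lemma real_analytic_continuity (f : point_fun) x y : real_analytic f -> continuity_2d_pt f x y.
Proof.
  intros Hf; destruct (real_analytic_expands f Hf x y) as [c [rho [Hr [Hs E]]]].
  destruct (double_series_center_bound c rho Hr Hs) as [M HM].
  change (forall h k, Rabs h <= rho / 2 -> Rabs k <= rho / 2 ->
     Rabs (Series (hom_part c h k) - c 0%nat 0%nat) <= M * Rmax (Rabs h) (Rabs k)) in HM.
  assert (F0 : f x y = c 0%nat 0%nat).
  { rewrite <- (Rplus_0_r x), <- (Rplus_0_r y).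
    rewrite E by (rewrite Rabs_R0; exact Hr).
    specialize (HM 0 0); rewrite Rabs_R0, Rmax_left, Rmult_0_r in HM by lra.
    assert (A : Rabs (Series (hom_part c 0 0) - c 0%nat 0%nat) <= 0) by (apply HM; lra).
    pose proof (Rabs_pos (Series (hom_part c 0 0) - c 0%nat 0%nat)).
    apply Rminus_diag_uniq. apply Rabs_eq_0; lra. }
  intros eps.
  assert (HM1 : 0 < Rabs M + 1) by (pose proof (Rabs_pos M); lra).
  assert (Hd : 0 < Rmin (rho / 2) (eps / (Rabs M + 1))).
  { apply Rmin_pos; [lra|]. apply Rdiv_lt_0_compat; [apply cond_pos | exact HM1]. }
  exists (mkposreal _ Hd); intros u v Hu Hv; simpl in Hu, Hv.
  pose proof (Rmin_l (rho / 2) (eps / (Rabs M + 1))) as L.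
  pose proof (Rmin_r (rho / 2) (eps / (Rabs M + 1))) as L'.
  specialize (HM (u - x) (v - y)).
  rewrite F0.
  replace u with (x + (u - x)) by ring; replace v with (y + (v - y)) by ring.
  rewrite E by lra.
  eapply Rle_lt_trans; [apply HM; lra|].
  assert (B : Rmax (Rabs (u - x)) (Rabs (v - y)) < eps / (Rabs M + 1))
    by (apply Rmax_lub_lt; lra).
  assert (B0 : 0 <= Rmax (Rabs (u - x)) (Rabs (v - y)))
    by (eapply Rle_trans; [apply Rabs_pos | apply Rmax_l]).
  apply (Rmult_lt_compat_r (Rabs M + 1)) in B; [|exact HM1].
  unfold Rdiv in B; rewrite Rmult_assoc, Rinv_l, Rmult_1_r in B by lra.
  pose proof (Rle_abs M); nra.
Qed.

(** Exchanging the variables reverses the order of summation within each degree. It transfers the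
    results on [pdx] to [pdy]. *)
Lemma real_analytic_swap (f : point_fun) : real_analytic f -> real_analytic (fun x y => f y x).
Proof.
  intros Hf x0 y0; destruct (Hf y0 x0) as [c [r [Hr H]]].
  exists (fun i j => c j i), r; split; [exact Hr|]; intros h k Hh Hk.
  destruct (H k h Hk Hh) as [Ha Hs]; split.
  - eapply ex_series_ext; [|exact Ha]; intros n; cbv beta.
    rewrite <- sum_n_R_rev; apply sum_n_ext_loc; intros i Hi.
    replace (n - (n - i))%nat with i by lia.
    f_equal; ring.
  - eapply is_series_ext; [|exact Hs]; intros n; cbv beta.
    rewrite <- sum_n_R_rev; apply sum_n_ext_loc; intros i Hi.
    replace (n - (n - i))%nat with i by lia.
    change (c (n - i)%nat i * k ^ (n - i) * h ^ i = c (n - i)%nat i * h ^ i * k ^ (n - i)); ring.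
Qed.

Lemma real_analytic_pdy (f : point_fun) : real_analytic f -> real_analytic (pdy f).
Proof.
  intros Hf; exact (real_analytic_swap _ (real_analytic_pdx _ (real_analytic_swap f Hf))).
Qed.

Lemma real_analytic_is_derive_y (f : point_fun) x y : real_analytic f ->
  is_derive (fun t => f x t) y (pdy f x y).
Proof.
  intros Hf; exact (real_analytic_is_derive_x _ y x (real_analytic_swap f Hf)).
Qed.

Lemma real_analytic_smooth (f : point_fun) : real_analytic f -> smooth f.
Proof.
  intros Hf n; revert f Hf; induction n as [|n IH]; intros f Hf.
  - intros x y; split; [now apply real_analytic_continuity | exact I].
  - apply (ex_diff_n_S_intro f (pdx f) (pdy f)).
    + intros; now apply real_analytic_continuity.
    + intros; now apply real_analytic_is_derive_x.
    + intros; now apply real_analytic_is_derive_y.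
    + apply IH; now apply real_analytic_pdx.
    + apply IH; now apply real_analytic_pdy.
Qed.

(** * The identity principle and cancellation of an analytic factor *)

Lemma PSeries_zero_left (d : R) : 0 < d -> forall n (a : nat -> R),
  Rbar_lt 0 (CV_radius a) -> (forall s, - d < s < 0 -> ex_pseries a s) ->
  (forall s, - d < s < 0 -> PSeries a s = 0) -> a n = 0.
Proof.
  intros Hd.
  (* Continuity at 0 gives the vanishing of the constant term; the induction then divides the series
     by [s], which is nonzero on the left of 0. *)
  assert (Z0 : forall a : nat -> R, Rbar_lt 0 (CV_radius a) ->
            (forall s, - d < s < 0 -> PSeries a s = 0) -> a 0%nat = 0).
  { intros a Ha Hz; rewrite <- (PSeries_0 a).
    apply NNPP; intros N.
    assert (P : 0 < Rabs (PSeries a 0)) by now apply Rabs_pos_lt.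
    assert (C0 : continuity_pt (PSeries a) 0)
      by (apply PSeries_continuity; now rewrite Rabs_R0).
    destruct (C0 _ P) as [e [He H]].
    set (s := - Rmin (d / 2) (e / 2)).
    assert (Hm : 0 < Rmin (d / 2) (e / 2)) by (apply Rmin_pos; lra).
    pose proof (Rmin_l (d / 2) (e / 2)); pose proof (Rmin_r (d / 2) (e / 2)).
    specialize (H s).
    assert (Hs : R_dist (PSeries a s) (PSeries a 0) < Rabs (PSeries a 0)).
    { apply H; split.
      - split; [exact I | unfold s; lra].
      - simpl; unfold R_dist; rewrite Rabs_left; unfold s; lra. }
    unfold R_dist in Hs; rewrite Hz in Hs by (unfold s; lra).
    replace (0 - PSeries a 0) with (- PSeries a 0) in Hs by ring.
    rewrite Rabs_Ropp in Hs; lra. }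
  induction n as [|n IH]; intros a Ha He Hz; [now apply Z0|].
  assert (E0 : a 0%nat = 0) by now apply Z0.
  apply (IH (PS_decr_1 a)).
  - now rewrite CV_radius_decr_1.
  - intros s Hs; apply ex_pseries_decr_1; [right; exists (/ s) | now apply He].
    unfold mult, one; simpl; field; lra.
  - intros s Hs; specialize (Hz s Hs).
    rewrite PSeries_decr_1, E0, Rplus_0_l in Hz by now apply He.
    apply Rmult_integral in Hz; destruct Hz; [lra | assumption].
Qed.

Definition analytic1 (phi : R -> R) : Prop :=
  forall t0, exists (p : nat -> R) (r : R), 0 < r /\
    forall s, Rabs s < r -> is_pseries p s (phi (t0 + s)).

Lemma analytic1_zero_extends (phi : R -> R) t0 d : analytic1 phi -> 0 < d ->
  (forall s, - d < s < 0 -> phi (t0 + s) = 0) ->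
  exists e, 0 < e /\ forall s, Rabs s < e -> phi (t0 + s) = 0.
Proof.
  intros Ha Hd Hz; destruct (Ha t0) as [p [r [Hr H]]].
  assert (Hm : 0 < Rmin d r) by now apply Rmin_pos.
  pose proof (Rmin_l d r); pose proof (Rmin_r d r).
  assert (P0 : forall n, p n = 0).
  { intros n; apply (PSeries_zero_left (Rmin d r) Hm).
    - apply Rbar_lt_le_trans with (r / 2); [simpl; lra|].
      apply Rbar_not_lt_le; intros N; apply (CV_disk_outside p (r / 2)).
      + now rewrite Rabs_pos_eq by lra.
      + apply ex_series_lim_0. exists (phi (t0 + r / 2)); apply is_pseries_R.
        apply H; rewrite Rabs_pos_eq; lra.
    - intros s Hs; eexists; apply H; rewrite Rabs_left; lra.
    - intros s Hs; rewrite (is_pseries_unique p s (phi (t0 + s)));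
        [apply Hz; lra | apply H; rewrite Rabs_left; lra]. }
  exists r; split; [exact Hr|]; intros s Hs.
  rewrite <- (is_pseries_unique p s (phi (t0 + s))) by now apply H.
  unfold PSeries; rewrite (Series_ext _ (fun n => 0 * s ^ n)) by (intros n; now rewrite P0).
  rewrite Series_scal_l; ring.
Qed.

(** Connectedness of the unit interval through a least upper bound: the zeros accumulate from the
    left at the supremum, and the local expansion there carries them beyond it. *)
Lemma analytic1_zero (phi : R -> R) d : analytic1 phi -> 0 < d <= 1 ->
  (forall t, 0 <= t < d -> phi t = 0) -> phi 1 = 0.
Proof.
  intros Ha Hd Hz.
  set (E := fun t => 0 <= t <= 1 /\ forall s, 0 <= s < t -> phi s = 0).
  destruct (completeness E) as [T [HT1 HT2]].
  - exists 1; intros t [Ht _]; lra.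
  - exists d; split; [lra | exact Hz].
  - assert (dT : d <= T) by (apply HT1; split; [lra | exact Hz]).
    assert (T1 : T <= 1) by (apply HT2; intros t [Ht _]; lra).
    assert (ZT : forall s, 0 <= s < T -> phi s = 0).
    { intros s Hs; apply NNPP; intros N.
      assert (T <= s); [|lra].
      apply HT2; intros t [Ht Hzt]; apply Rnot_lt_le; intros L; apply N, Hzt; lra. }
    (* Since [d <= T], the interval of length [d] to the left of [T] lies among the known zeros. *)
    destruct (analytic1_zero_extends phi T d Ha) as [e [He Hext]]; [lra | |].
    + intros s Hs; apply ZT; lra.
    + destruct (Rle_lt_dec 1 T) as [L|L].
      * replace 1 with (T + 0) by lra; apply Hext; rewrite Rabs_R0; exact He.
      * exfalso; set (m := Rmin (e / 2) (1 - T)).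
        assert (Hm : 0 < m) by (apply Rmin_pos; lra).
        pose proof (Rmin_l (e / 2) (1 - T)) as L1; pose proof (Rmin_r (e / 2) (1 - T)) as L2.
        fold m in L1, L2.
        assert (T + m <= T); [|lra].
        apply HT1; split; [lra|]; intros s Hs.
        destruct (Rlt_le_dec s T); [apply ZT; lra|].
        replace s with (T + (s - T)) by ring; apply Hext; rewrite Rabs_pos_eq; lra.
Qed.

Lemma real_analytic_line (f : point_fun) x y u v : real_analytic f ->
  analytic1 (fun t => f (x + t * u) (y + t * v)).
Proof.
  intros Hf t0; destruct (Hf (x + t0 * u) (y + t0 * v)) as [c [r [Hr H]]].
  exists (fun n => sum_n (fun i => c i (n - i)%nat * u ^ i * v ^ (n - i)) n).
  assert (Hm : 0 < 1 + Rabs u + Rabs v) by (pose proof (Rabs_pos u); pose proof (Rabs_pos v); lra).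
  (* This radius keeps both [s * u] and [s * v] below [r]; the summand 1 covers the case
     [u = v = 0]. *)
  exists (r / (1 + Rabs u + Rabs v)); split; [now apply Rdiv_lt_0_compat|]; intros s Hs.
  assert (Hs' : Rabs s * (1 + Rabs u + Rabs v) < r).
  { apply (Rmult_lt_compat_r (1 + Rabs u + Rabs v)) in Hs; [|exact Hm].
    unfold Rdiv in Hs; rewrite Rmult_assoc, Rinv_l, Rmult_1_r in Hs by lra; exact Hs. }
  pose proof (Rabs_pos u); pose proof (Rabs_pos v); pose proof (Rabs_pos s).
  destruct (H (s * u) (s * v)) as [_ S]; try (rewrite Rabs_mult; nra).
  apply is_pseries_R.
  replace (x + (t0 + s) * u) with (x + t0 * u + s * u) by ring.
  replace (y + (t0 + s) * v) with (y + t0 * v + s * v) by ring.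
  eapply is_series_ext; [|exact S]; intros n; cbv beta.
  rewrite (Rmult_comm _ (s ^ n)), <- sum_n_R_scal; apply sum_n_ext_loc; intros i Hi.
  rewrite !Rpow_mult_distr; replace (s ^ n) with (s ^ i * s ^ (n - i))
    by (rewrite <- pow_add; f_equal; lia).
  change (c i (n - i)%nat * (s ^ i * u ^ i) * (s ^ (n - i) * v ^ (n - i))
    = s ^ i * s ^ (n - i) * (c i (n - i)%nat * u ^ i * v ^ (n - i))); ring.
Qed.

(** If [g] were nonzero at some point, [f] would vanish near that point, hence by the identity
    principle along the segment to [(x1, y1)], where it does not. This is the substitute for
    dividing by a function with zeros. *)
Lemma real_analytic_cancel (f g : point_fun) : real_analytic f ->
  (exists x y, f x y <> 0) -> (forall x y, continuity_2d_pt g x y) ->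
  (forall x y, f x y * g x y = 0) -> forall x y, g x y = 0.
Proof.
  intros Hf [x1 [y1 Hne]] Hg Hfg x y; apply NNPP; intros N.
  destruct (continuity_2d_pt_neq_0 g x y (Hg x y) N) as [d Hd].
  apply Hne.
  set (u := x1 - x); set (v := y1 - y).
  replace x1 with (x + 1 * u) by (unfold u; ring).
  replace y1 with (y + 1 * v) by (unfold v; ring).
  pose proof (Rabs_pos u); pose proof (Rabs_pos v); pose proof (cond_pos d).
  assert (Hm : 0 < 1 + Rabs u + Rabs v) by lra.
  assert (Hq : 0 < d / (1 + Rabs u + Rabs v)) by now apply Rdiv_lt_0_compat.
  apply (analytic1_zero (fun t => f (x + t * u) (y + t * v))
           (Rmin 1 (d / (1 + Rabs u + Rabs v)))).
  - now apply real_analytic_line.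
  - split; [apply Rmin_pos; lra | apply Rmin_l].
  - intros t Ht.
    pose proof (Rmin_r 1 (d / (1 + Rabs u + Rabs v))) as L.
    assert (Ht' : t * (1 + Rabs u + Rabs v) < d).
    { assert (L' : t < d / (1 + Rabs u + Rabs v)) by lra.
      apply (Rmult_lt_compat_r (1 + Rabs u + Rabs v)) in L'; [|exact Hm].
      unfold Rdiv in L'; rewrite Rmult_assoc, Rinv_l, Rmult_1_r in L' by lra; exact L'. }
    assert (G : g (x + t * u) (y + t * v) <> 0).
    { apply Hd.
      - replace (x + t * u - x) with (t * u) by ring.
        rewrite Rabs_mult, (Rabs_pos_eq t) by lra; nra.
      - replace (y + t * v - y) with (t * v) by ring.
        rewrite Rabs_mult, (Rabs_pos_eq t) by lra; nra. }
    destruct (Rmult_integral _ _ (Hfg (x + t * u) (y + t * v))); [assumption | contradiction].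
Qed.

(** * The system satisfied on null covectors *)

Definition cfun := R -> R -> C.
Definition re_fun (f : cfun) : point_fun := fun x y => Re (f x y).
Definition im_fun (f : cfun) : point_fun := fun x y => Im (f x y).
Definition csmooth (f : cfun) : Prop := smooth (re_fun f) /\ smooth (im_fun f).
Definition cperiodic (G : lattice) (f : cfun) : Prop :=
  periodic G (re_fun f) /\ periodic G (im_fun f).
Definition cpdx (f : cfun) : cfun := fun x y => (pdx (re_fun f) x y, pdx (im_fun f) x y).
Definition cpdy (f : cfun) : cfun := fun x y => (pdy (re_fun f) x y, pdy (im_fun f) x y).

(* Twice the Wirtinger derivative with respect to the conjugate of [x + i y]. *)
Definition dbar (f : cfun) : cfun := fun x y => (cpdx f x y + Ci * cpdy f x y)%C.

Lemma C_ext (z w : C) : Re z = Re w -> Im z = Im w -> z = w.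
Proof. apply injective_projections. Qed.

Lemma Cmult_cancel (z w : C) : z <> 0 -> (z * w = 0)%C -> w = 0.
Proof.
  intros Hz H; replace w with (/ z * (z * w))%C by (field; exact Hz).
  rewrite H; ring.
Qed.

Lemma RtoC_mult_components (l u v : R) (z : C) :
  (RtoC l * z)%C = (u, v) -> u = l * Re z /\ v = l * Im z.
Proof.
  intros E; split; [apply (f_equal Re) in E | apply (f_equal Im) in E];
    unfold Re, Im in *; simpl in E; lra.
Qed.

Ltac Cring := apply C_ext; unfold Re, Im; simpl; ring.

Lemma cfun_ext (f g : cfun) : (forall x y, f x y = g x y) -> f = g.
Proof. intros H; extensionality x; extensionality y; apply H. Qed.

Lemma csmooth_const (c : C) : csmooth (fun _ _ => c).
Proof. split; [exact (smooth_const (Re c)) | exact (smooth_const (Im c))]. Qed.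

Lemma csmooth_real (f : point_fun) : smooth f -> csmooth (fun x y => RtoC (f x y)).
Proof. intros Sf; split; [exact Sf | exact (smooth_const 0)]. Qed.

Lemma csmooth_plus (f g : cfun) : csmooth f -> csmooth g -> csmooth (fun x y => f x y + g x y)%C.
Proof.
  intros [F1 F2] [G1 G2]; split;
    [exact (smooth_plus _ _ F1 G1) | exact (smooth_plus _ _ F2 G2)].
Qed.

Lemma csmooth_opp (f : cfun) : csmooth f -> csmooth (fun x y => - f x y)%C.
Proof. intros [F1 F2]; split; [exact (smooth_opp _ F1) | exact (smooth_opp _ F2)]. Qed.

Lemma csmooth_minus (f g : cfun) : csmooth f -> csmooth g -> csmooth (fun x y => f x y - g x y)%C.
Proof. intros Hf Hg; exact (csmooth_plus _ _ Hf (csmooth_opp _ Hg)). Qed.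

Lemma csmooth_mult (f g : cfun) : csmooth f -> csmooth g -> csmooth (fun x y => f x y * g x y)%C.
Proof.
  intros [F1 F2] [G1 G2]; split.
  - exact (smooth_minus _ _ (smooth_mult _ _ F1 G1) (smooth_mult _ _ F2 G2)).
  - exact (smooth_plus _ _ (smooth_mult _ _ F1 G2) (smooth_mult _ _ F2 G1)).
Qed.

Ltac csmooth_tac :=
  repeat first
    [ assumption | apply csmooth_const | apply csmooth_minus | apply csmooth_plus
    | apply csmooth_opp | apply csmooth_mult | apply csmooth_real ].

Lemma cpdx_const (c : C) x y : cpdx (fun _ _ => c) x y = 0.
Proof. apply C_ext; unfold Re, Im; simpl; unfold re_fun, im_fun; now rewrite pdx_const. Qed.

Lemma cpdy_const (c : C) x y : cpdy (fun _ _ => c) x y = 0.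
Proof. apply C_ext; unfold Re, Im; simpl; unfold re_fun, im_fun; now rewrite pdy_const. Qed.

Lemma cpdx_real (f : point_fun) x y : cpdx (fun x y => RtoC (f x y)) x y = RtoC (pdx f x y).
Proof.
  apply C_ext; unfold Re, Im; simpl; [reflexivity|].
  unfold im_fun; simpl; now rewrite pdx_const.
Qed.

Lemma cpdy_real (f : point_fun) x y : cpdy (fun x y => RtoC (f x y)) x y = RtoC (pdy f x y).
Proof.
  apply C_ext; unfold Re, Im; simpl; [reflexivity|].
  unfold im_fun; simpl; now rewrite pdy_const.
Qed.

Lemma cpdx_minus (f g : cfun) x y : csmooth f -> csmooth g ->
  cpdx (fun x y => f x y - g x y)%C x y = (cpdx f x y - cpdx g x y)%C.
Proof.
  intros [F1 F2] [G1 G2].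
  pose proof (pdx_minus _ _ F1 G1) as E1; pose proof (pdx_minus _ _ F2 G2) as E2.
  apply (f_equal (fun u => u x y)) in E1; apply (f_equal (fun u => u x y)) in E2.
  apply C_ext; [exact E1 | exact E2].
Qed.

Lemma cpdy_minus (f g : cfun) x y : csmooth f -> csmooth g ->
  cpdy (fun x y => f x y - g x y)%C x y = (cpdy f x y - cpdy g x y)%C.
Proof.
  intros [F1 F2] [G1 G2].
  pose proof (pdy_minus _ _ F1 G1) as E1; pose proof (pdy_minus _ _ F2 G2) as E2.
  apply (f_equal (fun u => u x y)) in E1; apply (f_equal (fun u => u x y)) in E2.
  apply C_ext; [exact E1 | exact E2].
Qed.

Lemma cpdx_plus (f g : cfun) x y : csmooth f -> csmooth g ->
  cpdx (fun x y => f x y + g x y)%C x y = (cpdx f x y + cpdx g x y)%C.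
Proof.
  intros [F1 F2] [G1 G2].
  pose proof (pdx_plus _ _ F1 G1) as E1; pose proof (pdx_plus _ _ F2 G2) as E2.
  apply (f_equal (fun u => u x y)) in E1; apply (f_equal (fun u => u x y)) in E2.
  apply C_ext; [exact E1 | exact E2].
Qed.

Lemma cpdy_plus (f g : cfun) x y : csmooth f -> csmooth g ->
  cpdy (fun x y => f x y + g x y)%C x y = (cpdy f x y + cpdy g x y)%C.
Proof.
  intros [F1 F2] [G1 G2].
  pose proof (pdy_plus _ _ F1 G1) as E1; pose proof (pdy_plus _ _ F2 G2) as E2.
  apply (f_equal (fun u => u x y)) in E1; apply (f_equal (fun u => u x y)) in E2.
  apply C_ext; [exact E1 | exact E2].
Qed.

Lemma cpdx_mult (f g : cfun) x y : csmooth f -> csmooth g ->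
  cpdx (fun x y => f x y * g x y)%C x y = (cpdx f x y * g x y + f x y * cpdx g x y)%C.
Proof.
  intros [F1 F2] [G1 G2].
  pose proof (pdx_minus _ _ (smooth_mult _ _ F1 G1) (smooth_mult _ _ F2 G2)) as E1.
  pose proof (pdx_plus _ _ (smooth_mult _ _ F1 G2) (smooth_mult _ _ F2 G1)) as E2.
  rewrite !pdx_mult in E1, E2 by assumption.
  apply (f_equal (fun u => u x y)) in E1; apply (f_equal (fun u => u x y)) in E2.
  apply C_ext; [etransitivity; [exact E1|] | etransitivity; [exact E2|]];
    unfold cpdx, re_fun, im_fun, Re, Im; simpl; ring.
Qed.

Lemma cpdy_mult (f g : cfun) x y : csmooth f -> csmooth g ->
  cpdy (fun x y => f x y * g x y)%C x y = (cpdy f x y * g x y + f x y * cpdy g x y)%C.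
Proof.
  intros [F1 F2] [G1 G2].
  pose proof (pdy_minus _ _ (smooth_mult _ _ F1 G1) (smooth_mult _ _ F2 G2)) as E1.
  pose proof (pdy_plus _ _ (smooth_mult _ _ F1 G2) (smooth_mult _ _ F2 G1)) as E2.
  rewrite !pdy_mult in E1, E2 by assumption.
  apply (f_equal (fun u => u x y)) in E1; apply (f_equal (fun u => u x y)) in E2.
  apply C_ext; [etransitivity; [exact E1|] | etransitivity; [exact E2|]];
    unfold cpdy, re_fun, im_fun, Re, Im; simpl; ring.
Qed.

Lemma dbar_const (c : C) x y : dbar (fun _ _ => c) x y = 0.
Proof. unfold dbar; rewrite cpdx_const, cpdy_const; ring. Qed.

Lemma dbar_minus (f g : cfun) x y : csmooth f -> csmooth g ->
  dbar (fun x y => f x y - g x y)%C x y = (dbar f x y - dbar g x y)%C.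
Proof. intros Sf Sg; unfold dbar; rewrite cpdx_minus, cpdy_minus by assumption; ring. Qed.

Lemma dbar_plus (f g : cfun) x y : csmooth f -> csmooth g ->
  dbar (fun x y => f x y + g x y)%C x y = (dbar f x y + dbar g x y)%C.
Proof. intros Sf Sg; unfold dbar; rewrite cpdx_plus, cpdy_plus by assumption; ring. Qed.

Lemma dbar_mult (f g : cfun) x y : csmooth f -> csmooth g ->
  dbar (fun x y => f x y * g x y)%C x y = (dbar f x y * g x y + f x y * dbar g x y)%C.
Proof. intros Sf Sg; unfold dbar; rewrite cpdx_mult, cpdy_mult by assumption; ring. Qed.

Lemma cgradient_zero_const (f : cfun) : csmooth f ->
  (forall x y, cpdx f x y = 0) -> (forall x y, cpdy f x y = 0) ->
  exists k, forall x y, f x y = k.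
Proof.
  intros [F1 F2] Hx Hy; exists (f 0 0); intros x y.
  apply C_ext.
  - apply (gradient_zero_const (re_fun f) F1); intros u v.
    + exact (f_equal Re (Hx u v)).
    + exact (f_equal Re (Hy u v)).
  - apply (gradient_zero_const (im_fun f) F2); intros u v.
    + exact (f_equal Im (Hx u v)).
    + exact (f_equal Im (Hy u v)).
Qed.

(** The real and imaginary parts satisfy the Cauchy-Riemann system; periodicity takes the place of
    boundedness. *)
Lemma liouville (G : lattice) (f : cfun) : csmooth f -> cperiodic G f ->
  (forall x y, dbar f x y = 0) -> exists k, forall x y, f x y = k.
Proof.
  intros Sf [P1 P2] H; pose proof Sf as [F1 F2].
  assert (R1 : forall x y, pdx (re_fun f) x y = pdy (im_fun f) x y).
  { intros x y; pose proof (f_equal Re (H x y)) as E; unfold dbar, Re in E; simpl in E; lra. }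
  assert (R2 : forall x y, pdy (re_fun f) x y = - pdx (im_fun f) x y).
  { intros x y; pose proof (f_equal Im (H x y)) as E; unfold dbar, Im in E; simpl in E; lra. }
  pose proof (periodic_cauchy_riemann_pdx G _ _ F1 F2 P1 P2 R1 R2) as Z.
  apply cgradient_zero_const; [exact Sf | |]; intros x y; destruct (Z x y) as [Zx Zy];
    apply C_ext; unfold cpdx, cpdy, Re, Im; simpl;
    rewrite <- ?R1, ?Zx, ?Zy; try reflexivity; specialize (R2 x y); lra.
Qed.

Lemma cperiodic_intro (G : lattice) (f : cfun) :
  (forall a b, in_lattice G a b -> forall x y, f (x + a) (y + b) = f x y) -> cperiodic G f.
Proof.
  intros H; split; intros a b Hab x y; unfold re_fun, im_fun; now rewrite (H a b).
Qed.

Lemma cperiodic_elim (G : lattice) (f : cfun) : cperiodic G f ->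
  forall a b, in_lattice G a b -> forall x y, f (x + a) (y + b) = f x y.
Proof.
  intros [H1 H2] a b Hab x y; apply C_ext; [now apply (H1 a b) | now apply (H2 a b)].
Qed.

(** A potential of a nonzero field satisfies no nontrivial quadratic equation with constant
    coefficients. It serves to show that complex constants met later are real: their imaginary parts
    become coefficients of such an equation. *)
Lemma smooth_quadratic_relation (g Om : point_fun) (V1 V2 A B K : R) :
  smooth g -> (exists x y, Om x y <> 0) -> (V1 <> 0 \/ V2 <> 0) ->
  (forall x y, pdx g x y = Om x y * V2) -> (forall x y, pdy g x y = - Om x y * V1) ->
  (forall x y, A * (g x y * g x y) + B * g x y + K = 0) -> A = 0 /\ B = 0.
Proof.
  intros Sg [x0 [y0 HO]] HV Gx Gy H.
  assert (Sk : forall k, smooth (fun _ _ => k)) by apply smooth_const.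
  set (s := fun x y => 2 * A * g x y + B).
  assert (Ss : smooth s) by (unfold s; smooth_tac).
  assert (sx : forall x y, pdx s x y = 2 * A * pdx g x y).
  { intros; unfold s; rewrite pdx_plus, pdx_mult, !pdx_const by smooth_tac; ring. }
  assert (sy : forall x y, pdy s x y = 2 * A * pdy g x y).
  { intros; unfold s; rewrite pdy_plus, pdy_mult, !pdy_const by smooth_tac; ring. }
  assert (E0 : (fun x y => A * (g x y * g x y) + B * g x y + K) = fun _ _ => 0)
    by (apply point_fun_ext; exact H).
  (* The gradient of the relation is [s] times the gradient of [g], that is, [s * Om] times a fixed
     nonzero vector. *)
  assert (Z : forall x y, s x y * Om x y = 0).
  { intros x y.
    pose proof (f_equal (fun u => pdx u x y) E0) as Ex; cbv beta in Ex.
    pose proof (f_equal (fun u => pdy u x y) E0) as Ey; cbv beta in Ey.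
    rewrite !pdx_plus, !pdx_mult, !pdx_const in Ex by smooth_tac.
    rewrite !pdy_plus, !pdy_mult, !pdy_const in Ey by smooth_tac.
    rewrite Gx in Ex; rewrite Gy in Ey; unfold s.
    destruct HV as [HV|HV]; apply (Rmult_eq_reg_r _ _ _) with (2 := HV); lra. }
  (* [Om] may have zeros, so [s = 0] does not follow pointwise. But the gradient of [s * s] contains
     the factor [s * Om], so the square is constant, and it is zero where [Om] is not. *)
  assert (s2 : forall x y, s x y * s x y = s x0 y0 * s x0 y0).
  { intros x y; apply (gradient_zero_const (fun x y => s x y * s x y)); [smooth_tac | |];
      clear x y; intros x y; [rewrite pdx_mult, sx, Gx by smooth_tac
                             | rewrite pdy_mult, sy, Gy by smooth_tac].
    - transitivity (4 * A * V2 * (s x y * Om x y)); [ring | rewrite Z; ring].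
    - transitivity (- 4 * A * V1 * (s x y * Om x y)); [ring | rewrite Z; ring]. }
  assert (s0 : s x0 y0 = 0)
    by (destruct (Rmult_integral _ _ (Z x0 y0)); [assumption | contradiction]).
  assert (sz : forall x y, s x y = 0)
    by (intros x y; apply Rsqr_0_uniq; unfold Rsqr; rewrite s2, s0; ring).
  assert (Es : s = fun _ _ => 0) by (apply point_fun_ext; exact sz).
  assert (A0 : A = 0).
  { pose proof (sx x0 y0) as Ex; pose proof (sy x0 y0) as Ey.
    rewrite Es, pdx_const, Gx in Ex; rewrite Es, pdy_const, Gy in Ey.
    destruct HV as [HV|HV].
    - apply (Rmult_eq_reg_r (Om x0 y0 * V1)); [lra | now apply Rmult_integral_contrapositive].
    - apply (Rmult_eq_reg_r (Om x0 y0 * V2)); [lra | now apply Rmult_integral_contrapositive]. }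
  split; [exact A0|].
  specialize (sz 0 0); unfold s in sz; rewrite A0 in sz; lra.
Qed.

(** * Translation invariants and normal form of the null polynomial *)

Section NullSystem.

Variables (G : lattice) (a c e : cfun) (f Om : point_fun).
Hypotheses (Sa : csmooth a) (Sc : csmooth c) (Se : csmooth e) (Sf : smooth f) (SO : smooth Om).
Hypotheses (Pa : cperiodic G a) (Pc : cperiodic G c) (Pe : cperiodic G e) (Pf : periodic G f).
Hypothesis Om_nonzero : exists x y, Om x y <> 0.
Hypothesis dbar_a : forall x y, dbar a x y = 0.
Hypothesis dbar_c : forall x y, dbar c x y = (RtoC (- 3 * Om x y) * Ci * a x y)%C.
Hypothesis dbar_e : forall x y, dbar e x y = (RtoC (- 2 * Om x y) * Ci * c x y)%C.
Hypothesis pdx_f : forall x y, pdx f x y = Om x y * Im (e x y).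
Hypothesis pdy_f : forall x y, pdy f x y = - Om x y * Re (e x y).

Let fC : cfun := fun x y => RtoC (f x y).

Lemma csmooth_fC : csmooth fC.
Proof. now apply csmooth_real. Qed.

Lemma dbar_f x y : dbar fC x y = (RtoC (- Om x y) * Ci * e x y)%C.
Proof.
  unfold dbar, fC; rewrite cpdx_real, cpdy_real, pdx_f, pdy_f; Cring.
Qed.

Ltac dbar_expand :=
  repeat first [rewrite dbar_minus by csmooth_tac | rewrite dbar_plus by csmooth_tac
    | rewrite dbar_mult by csmooth_tac | rewrite dbar_const].

Lemma a_constant : exists a0, forall x y, a x y = a0.
Proof. exact (liouville G a Sa Pa dbar_a). Qed.

(* The coefficients of the depressed cubic polynomial associated to
   [a t^3 + c t^2 + e t + f] are holomorphic, hence constant. *)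
Lemma gradient_relations x y :
  (e x y * cpdx e x y = RtoC (2 * pdx f x y) * c x y)%C /\
  (e x y * cpdy e x y = RtoC (2 * pdy f x y) * c x y)%C /\
  (e x y * cpdx c x y = RtoC (3 * pdx f x y) * a x y)%C /\
  (e x y * cpdy c x y = RtoC (3 * pdy f x y) * a x y)%C.
Proof.
  pose proof csmooth_fC as SfC.
  destruct a_constant as [a0 Ha0].
  destruct (classic (a0 = 0)) as [Z|NZ].
  - assert (Hc0 : forall x y, dbar c x y = 0)
      by (intros; rewrite dbar_c, Ha0, Z; ring).
    destruct (liouville G c Sc Pc Hc0) as [c0 Ec].
    assert (Ec' : c = fun _ _ => c0) by (apply cfun_ext; exact Ec).
    (* For [a = 0] the polynomial is at most quadratic with constant leading coefficient, and its
       translation invariant is the discriminant. *)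
    set (u := fun x y => (e x y * e x y - RtoC 4 * c0 * fC x y)%C).
    assert (Su : csmooth u) by (unfold u; csmooth_tac).
    destruct (liouville G u) as [k Eu].
    + exact Su.
    + apply cperiodic_intro; intros p q Hpq x' y'; unfold u, fC.
      now rewrite (cperiodic_elim G e Pe p q Hpq), (Pf p q Hpq).
    + intros x' y'; unfold u; dbar_expand.
      rewrite dbar_e, dbar_f, Ec; Cring.
    + assert (Eu' : u = fun _ _ => k) by (apply cfun_ext; exact Eu).
      pose proof (cpdx_const k x y) as Kx; pose proof (cpdy_const k x y) as Ky.
      rewrite <- Eu' in Kx, Ky; unfold u in Kx, Ky.
      rewrite cpdx_minus, !cpdx_mult, !cpdx_const in Kx by csmooth_tac.
      rewrite cpdy_minus, !cpdy_mult, !cpdy_const in Ky by csmooth_tac.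
      unfold fC in Kx, Ky; rewrite cpdx_real in Kx; rewrite cpdy_real in Ky.
      rewrite Ha0, Z, Ec.
      assert (Kx' : (RtoC 2 * (e x y * cpdx e x y - RtoC (2 * pdx f x y) * c0) = 0)%C)
        by (rewrite <- Kx; Cring).
      assert (Ky' : (RtoC 2 * (e x y * cpdy e x y - RtoC (2 * pdy f x y) * c0) = 0)%C)
        by (rewrite <- Ky; Cring).
      assert (N2 : RtoC 2 <> 0) by (intros E; apply (f_equal Re) in E; simpl in E; lra).
      apply Cmult_cancel in Kx'; [|exact N2]. apply Cmult_cancel in Ky'; [|exact N2].
      rewrite Ec', cpdx_const, cpdy_const.
      repeat split; try ring.
      * apply Ceq_minus; exact Kx'.
      * apply Ceq_minus; exact Ky'.
  - set (u := fun x y => (c x y * c x y - RtoC 3 * a0 * e x y)%C).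
    set (v := fun x y => (RtoC 2 * (c x y * c x y * c x y) - RtoC 9 * a0 * (c x y * e x y)
                          + RtoC 27 * a0 * a0 * fC x y)%C).
    assert (Su : csmooth u) by (unfold u; csmooth_tac).
    assert (Sv : csmooth v) by (unfold v; csmooth_tac).
    destruct (liouville G u) as [k Eu].
    { exact Su. }
    { apply cperiodic_intro; intros p q Hpq x' y'; unfold u.
      now rewrite (cperiodic_elim G e Pe p q Hpq), (cperiodic_elim G c Pc p q Hpq). }
    { intros x' y'; unfold u; dbar_expand; rewrite dbar_e, dbar_c, Ha0; Cring. }
    destruct (liouville G v) as [l Ev].
    { exact Sv. }
    { apply cperiodic_intro; intros p q Hpq x' y'; unfold v, fC.
      now rewrite (cperiodic_elim G e Pe p q Hpq), (cperiodic_elim G c Pc p q Hpq), (Pf p q Hpq). }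
    { intros x' y'; unfold v; dbar_expand; rewrite dbar_e, dbar_c, dbar_f, Ha0; Cring. }
    assert (Eu' : u = fun _ _ => k) by (apply cfun_ext; exact Eu).
    assert (Ev' : v = fun _ _ => l) by (apply cfun_ext; exact Ev).
    assert (N3 : RtoC 3 <> 0) by (intros E; apply (f_equal Re) in E; simpl in E; lra).
    (* Here [e'], [c'], [f'] stand for the derivatives of [e], [c], [f] in either variable, and the
       premises say that those of [u] and [v] vanish. Eliminating [e'], then using the result in the
       first premise, gives both relations after division by [a0]. *)
    assert (K : forall e' c' f' : C,
      (c' * c x y + c x y * c' - RtoC 3 * a0 * e' = 0)%C ->
      (RtoC 2 * ((c' * c x y + c x y * c') * c x y + c x y * c x y * c')
       - RtoC 9 * a0 * (c' * e x y + c x y * e') + RtoC 27 * a0 * a0 * f' = 0)%C ->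
      (e x y * e' = RtoC 2 * f' * c x y)%C /\ (e x y * c' = RtoC 3 * f' * a0)%C).
    { intros e' c' f' H1 H2.
      assert (T : (e x y * c' = RtoC 3 * f' * a0)%C).
      { apply Ceq_minus; apply (Cmult_cancel (RtoC 3 * (RtoC 3 * a0))%C);
          [repeat apply Cmult_neq_0; assumption|].
        transitivity (- (RtoC 2 * ((c' * c x y + c x y * c') * c x y + c x y * c x y * c')
           - RtoC 9 * a0 * (c' * e x y + c x y * e') + RtoC 27 * a0 * a0 * f')
           + RtoC 3 * c x y * (c' * c x y + c x y * c' - RtoC 3 * a0 * e'))%C; [Cring|].
        rewrite H1, H2; ring. }
      split; [|exact T].
      apply Ceq_minus; apply (Cmult_cancel (RtoC 3 * a0)%C); [now apply Cmult_neq_0|].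
      transitivity (RtoC 2 * c x y * (e x y * c' - RtoC 3 * f' * a0)
        - e x y * (c' * c x y + c x y * c' - RtoC 3 * a0 * e'))%C; [Cring|].
      rewrite H1, T; ring. }
    assert (Kx : (e x y * cpdx e x y = RtoC 2 * RtoC (pdx f x y) * c x y)%C /\
                 (e x y * cpdx c x y = RtoC 3 * RtoC (pdx f x y) * a0)%C).
    { apply K.
      - rewrite <- (cpdx_const k x y), <- Eu'; unfold u.
        rewrite cpdx_minus, !cpdx_mult, !cpdx_const by csmooth_tac; ring.
      - rewrite <- (cpdx_const l x y), <- Ev'; unfold v.
        rewrite cpdx_plus, cpdx_minus, !cpdx_mult, !cpdx_const by csmooth_tac.
        unfold fC; rewrite cpdx_real; ring. }
    assert (Ky : (e x y * cpdy e x y = RtoC 2 * RtoC (pdy f x y) * c x y)%C /\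
                 (e x y * cpdy c x y = RtoC 3 * RtoC (pdy f x y) * a0)%C).
    { apply K.
      - rewrite <- (cpdy_const k x y), <- Eu'; unfold u.
        rewrite cpdy_minus, !cpdy_mult, !cpdy_const by csmooth_tac; ring.
      - rewrite <- (cpdy_const l x y), <- Ev'; unfold v.
        rewrite cpdy_plus, cpdy_minus, !cpdy_mult, !cpdy_const by csmooth_tac.
        unfold fC; rewrite cpdy_real; ring. }
    rewrite Ha0, !RtoC_mult; tauto.
Qed.

(** Where [e] is nonzero, multiplying by [e] turns its derivative along itself into [2 c] times the
    derivative of [f] along [e]. The latter is zero, since the gradient of [f] is [Om] times [e]
    turned by a right angle. *)
Lemma e_burgers x y : (RtoC (Re (e x y)) * cpdx e x y + RtoC (Im (e x y)) * cpdy e x y = 0)%C.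
Proof.
  destruct (classic (e x y = 0)) as [Z|NZ].
  - rewrite Z; Cring.
  - apply (Cmult_cancel (e x y)); [exact NZ|].
    destruct (gradient_relations x y) as [Rx [Ry _]].
    transitivity (RtoC (Re (e x y)) * (e x y * cpdx e x y)
      + RtoC (Im (e x y)) * (e x y * cpdy e x y))%C; [ring|].
    rewrite Rx, Ry, pdx_f, pdy_f.
    transitivity (RtoC (2 * Re (e x y) * (Om x y * Im (e x y))
      + 2 * Im (e x y) * (- Om x y * Re (e x y))) * c x y)%C; [Cring|].
    replace (2 * Re (e x y) * (Om x y * Im (e x y))
      + 2 * Im (e x y) * (- Om x y * Re (e x y))) with 0 by ring. ring.
Qed.

Lemma e_parallel x y x' y' : Re (e x y) * Im (e x' y') = Im (e x y) * Re (e x' y').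
Proof.
  destruct Se as [S1 S2].
  apply (burgers_parallel (re_fun e) (im_fun e) S1 S2); intros u v.
  - pose proof (f_equal Re (e_burgers u v)) as E; unfold Re in E; simpl in E.
    unfold re_fun, im_fun, Re, Im in *; lra.
  - pose proof (f_equal Im (e_burgers u v)) as E; unfold Im in E; simpl in E.
    unfold re_fun, im_fun, Re, Im in *; lra.
Qed.

(** From [e = 0] one first gets only [Om c = 0]. That makes [c^2] holomorphic, because its [dbar]
    contains the factor [Om c]; so [c^2] is constant, and it vanishes where [Om] does not. Then
    [Om a = 0] with [a] constant gives [a = 0]. *)
Lemma null_system_trivial : (forall x y, e x y = 0) ->
  (forall x y, a x y = 0) /\ (forall x y, c x y = 0) /\ exists m, forall x y, f x y = m.
Proof.
  intros Z; destruct Om_nonzero as [x0 [y0 HO]].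
  assert (HO' : forall k, k <> 0 -> (RtoC (k * Om x0 y0) * Ci)%C <> 0).
  { intros k Hk E; apply (f_equal Im) in E; unfold Im in E; simpl in E.
    apply (Rmult_integral_contrapositive_currified k (Om x0 y0)); auto; lra. }
  assert (Ez : e = fun _ _ => RtoC 0) by (apply cfun_ext; exact Z).
  assert (Zc : forall x y, (RtoC (- 2 * Om x y) * Ci * c x y = 0)%C)
    by (intros; rewrite <- dbar_e, Ez; apply dbar_const).
  set (u := fun x y => (c x y * c x y)%C).
  destruct (liouville G u) as [k Eu].
  { unfold u; csmooth_tac. }
  { apply cperiodic_intro; intros p q Hpq x' y'; unfold u.
    now rewrite (cperiodic_elim G c Pc p q Hpq). }
  { intros x y; unfold u; dbar_expand; rewrite dbar_c.
    transitivity (RtoC 3 * a x y * (RtoC (- 2 * Om x y) * Ci * c x y))%C; [Cring|].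
    rewrite Zc; ring. }
  assert (c0 : c x0 y0 = 0) by (eapply Cmult_cancel; [|apply Zc]; apply HO'; lra).
  assert (Ec : forall x y, c x y = 0).
  { intros x y; apply NNPP; intros N.
    apply N; apply (Cmult_cancel (c x y)); [exact N|].
    change (u x y = 0); rewrite Eu, <- (Eu x0 y0); unfold u; rewrite c0; ring. }
  assert (Ec' : c = fun _ _ => RtoC 0) by (apply cfun_ext; exact Ec).
  assert (Za : forall x y, (RtoC (- 3 * Om x y) * Ci * a x y = 0)%C)
    by (intros; rewrite <- dbar_c, Ec'; apply dbar_const).
  destruct a_constant as [a0 Ha0].
  repeat split.
  - intros x y; rewrite Ha0, <- (Ha0 x0 y0).
    eapply Cmult_cancel; [|apply Za]; apply HO'; lra.
  - exact Ec.
  - exists (f 0 0); intros x y; apply gradient_zero_const; [exact Sf | |]; intros.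
    + rewrite pdx_f, Z; simpl; ring.
    + rewrite pdy_f, Z; simpl; ring.
Qed.


(** The equation for [dbar w] says that [w] moves like a translation parameter of the null
    polynomial, as [c / (3 a)] or [e / (2 c)] does. Together with the invariance along [V] it
    determines both partial derivatives of [w], and those of [V w] turn out real. The imaginary part
    [h] is therefore constant and the real part is the sought potential. *)
Lemma potential_of_w (w : cfun) (V1 V2 : R) : csmooth w -> cperiodic G w ->
  (V1 <> 0 \/ V2 <> 0) ->
  (forall x y, dbar w x y = (RtoC (- Om x y) * Ci)%C) ->
  (forall x y, (RtoC V1 * cpdx w x y + RtoC V2 * cpdy w x y = 0)%C) ->
  exists (g : point_fun) (h : R), smooth g /\ periodic G g /\
    (forall x y, pdx g x y = Om x y * V2) /\ (forall x y, pdy g x y = - Om x y * V1) /\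
    (forall x y, ((V1, V2) * w x y)%C = (g x y, h)).
Proof.
  intros Sw Pw HV Dw DV.
  set (t := fun x y => ((V1, V2) * w x y)%C).
  assert (St : csmooth t) by (unfold t; csmooth_tac).
  assert (W : forall x y, cpdx t x y = RtoC (Om x y * V2) /\ cpdy t x y = RtoC (- Om x y * V1)).
  { intros x y; specialize (Dw x y); specialize (DV x y).
    unfold t; rewrite cpdx_mult, cpdy_mult, cpdx_const, cpdy_const by csmooth_tac.
    unfold dbar in Dw; set (p := cpdx w x y) in *; set (q := cpdy w x y) in *.
    assert (Ep : p = (RtoC (- Om x y) * Ci - Ci * q)%C) by (rewrite <- Dw; ring).
    rewrite Ep in DV |- *; clear Ep Dw p.
    assert (Vq : ((V1, V2) * q = RtoC (- Om x y * V1))%C).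
    { apply Ceq_minus.
      transitivity (Ci * (RtoC V1 * (RtoC (- Om x y) * Ci - Ci * q) + RtoC V2 * q))%C;
        [Cring | rewrite DV; ring]. }
    split.
    - transitivity ((V1, V2) * RtoC (- Om x y) * Ci - Ci * ((V1, V2) * q))%C; [ring|].
      rewrite Vq; Cring.
    - rewrite <- Vq; ring. }
  exists (re_fun t), (im_fun t 0 0).
  split; [exact (proj1 St)|].
  split; [apply (cperiodic_intro G t); intros p q Hpq x y; unfold t;
          now rewrite (cperiodic_elim G w Pw p q Hpq)|].
  split; [intros x y; exact (f_equal Re (proj1 (W x y)))|].
  split; [intros x y; exact (f_equal Re (proj2 (W x y)))|].
  intros x y; apply C_ext; [reflexivity|].
  apply (gradient_zero_const (im_fun t) (proj2 St)); intros u v.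
  - exact (f_equal Im (proj1 (W u v))).
  - exact (f_equal Im (proj2 (W u v))).
Qed.

(* [a t^3 + c t^2 + e t + f = Q (V t + g)] with [Q s = al s^3 + be s^2 + ka s + m]. *)
Definition null_form (V : C) (g : point_fun) (al be ka m : R) : Prop :=
  forall x y,
    a x y = (RtoC al * V * V * V)%C /\
    c x y = (RtoC (3 * al * g x y + be) * V * V)%C /\
    e x y = (RtoC (3 * al * g x y ^ 2 + 2 * be * g x y + ka) * V)%C /\
    f x y = al * g x y ^ 3 + be * g x y ^ 2 + ka * g x y + m.

(** The gradient of [f] is determined by [e], so the formula for [e] fixes [f] up to the constant
    [m]. *)
Lemma null_form_intro (V1 V2 : R) (g : point_fun) (al be ka : R) : smooth g ->
  (forall x y, pdx g x y = Om x y * V2) -> (forall x y, pdy g x y = - Om x y * V1) ->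
  (forall x y, a x y = (RtoC al * (V1, V2) * (V1, V2) * (V1, V2))%C) ->
  (forall x y, c x y = (RtoC (3 * al * g x y + be) * (V1, V2) * (V1, V2))%C) ->
  (forall x y, e x y = (RtoC (3 * al * g x y ^ 2 + 2 * be * g x y + ka) * (V1, V2))%C) ->
  exists m, null_form (V1, V2) g al be ka m.
Proof.
  intros Sg Gx Gy Ha Hc He.
  assert (Sk : forall k, smooth (fun _ _ => k)) by apply smooth_const.
  set (u := fun x y => f x y - (al * (g x y * (g x y * g x y)) + be * (g x y * g x y) + ka * g x y)).
  exists (u 0 0); intros x y; repeat split; [apply Ha | apply Hc | apply He |].
  assert (E : u x y = u 0 0).
  { apply gradient_zero_const; [unfold u; smooth_tac | |]; clear x y; intros x y; unfold u.
    - rewrite !pdx_minus, !pdx_plus, !pdx_mult, !pdx_const by smooth_tac.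
      rewrite pdx_f, Gx, He; unfold Im; simpl; ring.
    - rewrite !pdy_minus, !pdy_plus, !pdy_mult, !pdy_const by smooth_tac.
      rewrite pdy_f, Gy, He; unfold Re; simpl; ring. }
  rewrite <- E; unfold u; ring.
Qed.

(** The polynomial in the last clause is the factor of proportionality of [e] to [V]. That clause
    exports its cancellation, which is needed once more when the metric is shown to be invariant
    along [V]. *)
Lemma null_normal_form :
  real_analytic (re_fun e) -> real_analytic (im_fun e) -> (exists x y, e x y <> 0) ->
  exists (V1 V2 : R) (g : point_fun) (al be ka m : R),
    (V1 <> 0 \/ V2 <> 0) /\ smooth g /\ periodic G g /\
    (forall x y, pdx g x y = Om x y * V2) /\ (forall x y, pdy g x y = - Om x y * V1) /\
    null_form (V1, V2) g al be ka m /\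
    (forall h : point_fun, (forall x y, continuity_2d_pt h x y) ->
       (forall x y, (3 * al * g x y ^ 2 + 2 * be * g x y + ka) * h x y = 0) ->
       forall x y, h x y = 0).
Proof.
  intros A1 A2 [xs [ys Hs]].
  set (V1 := Re (e xs ys)); set (V2 := Im (e xs ys)).
  assert (HV : V1 <> 0 \/ V2 <> 0).
  { destruct (Req_dec V1 0) as [E1|]; [|auto]. destruct (Req_dec V2 0) as [E2|]; [|auto].
    exfalso; apply Hs, C_ext; assumption. }
  set (N := V1 * V1 + V2 * V2).
  assert (HN : N <> 0) by (unfold N; destruct HV; nra).
  assert (V0 : (V1, V2) <> RtoC 0)
    by (intros E; injection E; intros; destruct HV; contradiction).
  (* The factor in [e = lam V], written as an orthogonal projection on [V] so that it is smooth
     without any choice of component. *)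
  set (lam := fun x y => / N * (V1 * re_fun e x y + V2 * im_fun e x y)).
  destruct Se as [Se1 Se2].
  assert (Slam : smooth lam) by (unfold lam; smooth_tac).
  assert (L1 : forall x y, re_fun e x y = lam x y * V1).
  { intros x y; pose proof (e_parallel x y xs ys) as P; fold V1 V2 in P.
    unfold lam, re_fun, im_fun.
    apply (Rmult_eq_reg_l N); [|exact HN].
    transitivity ((V1 * Re (e x y) + V2 * Im (e x y)) * V1); [|field; exact HN].
    apply Rminus_diag_uniq.
    transitivity (V2 * (Re (e x y) * V2 - Im (e x y) * V1)); [unfold N; ring | rewrite P; ring]. }
  assert (L2 : forall x y, im_fun e x y = lam x y * V2).
  { intros x y; pose proof (e_parallel x y xs ys) as P; fold V1 V2 in P.
    unfold lam, re_fun, im_fun.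
    apply (Rmult_eq_reg_l N); [|exact HN].
    transitivity ((V1 * Re (e x y) + V2 * Im (e x y)) * V2); [|field; exact HN].
    apply Rminus_diag_uniq.
    transitivity (V1 * (Im (e x y) * V1 - Re (e x y) * V2)); [unfold N; ring | rewrite P; ring]. }
  assert (He : forall x y, e x y = (RtoC (lam x y) * (V1, V2))%C).
  { intros x y; apply C_ext.
    - pose proof (L1 x y) as L; unfold re_fun in L; rewrite L; unfold Re; simpl; ring.
    - pose proof (L2 x y) as L; unfold im_fun in L; rewrite L; unfold Im; simpl; ring. }
  assert (Canc : forall h : point_fun, (forall x y, continuity_2d_pt h x y) ->
     (forall x y, lam x y * h x y = 0) -> forall x y, h x y = 0).
  { intros h Hc Hh; destruct HV as [HV|HV].
    - apply (real_analytic_cancel (re_fun e) h A1); [now exists xs, ys | exact Hc|].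
      intros x y; rewrite L1; transitivity (V1 * (lam x y * h x y)); [ring | rewrite Hh; ring].
    - apply (real_analytic_cancel (im_fun e) h A2); [now exists xs, ys | exact Hc|].
      intros x y; rewrite L2; transitivity (V2 * (lam x y * h x y)); [ring | rewrite Hh; ring]. }
  assert (DVf : forall x y, V1 * pdx f x y + V2 * pdy f x y = 0).
  { intros x y; rewrite pdx_f, pdy_f, He; unfold Re, Im; simpl; ring. }
  assert (CancC : forall h : cfun, csmooth h ->
     (forall x y, (e x y * h x y = 0)%C) -> forall x y, h x y = 0).
  { intros h [Sh1 Sh2] Hh.
    assert (Z : forall x y, (RtoC (lam x y) * h x y = 0)%C).
    { intros x y; apply (Cmult_cancel (V1, V2)); [exact V0|].
      rewrite <- (Hh x y), He; ring. }
    intros x y; apply C_ext.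
    - apply (Canc (re_fun h)); [intros; now apply smooth_continuity|].
      intros u v; pose proof (f_equal Re (Z u v)) as E; unfold Re in E; simpl in E.
      unfold re_fun, Re; lra.
    - apply (Canc (im_fun h)); [intros; now apply smooth_continuity|].
      intros u v; pose proof (f_equal Im (Z u v)) as E; unfold Im in E; simpl in E.
      unfold im_fun, Im; lra. }
  assert (Se' : csmooth e) by (split; assumption).
  assert (Spdx : forall h, csmooth h -> csmooth (cpdx h))
    by (intros h [S1 S2]; split; [exact (smooth_pdx _ S1) | exact (smooth_pdx _ S2)]).
  assert (Spdy : forall h, csmooth h -> csmooth (cpdy h))
    by (intros h [S1 S2]; split; [exact (smooth_pdy _ S1) | exact (smooth_pdy _ S2)]).
  (* The relations hold only after multiplication by [e]; the analytic cancellation removes this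
     factor. *)
  assert (DVe : forall x y, (RtoC V1 * cpdx e x y + RtoC V2 * cpdy e x y = 0)%C).
  { apply CancC.
    - apply csmooth_plus; apply csmooth_mult; auto using csmooth_const.
    - intros x y; destruct (gradient_relations x y) as [Rx [Ry _]].
      transitivity (RtoC V1 * (e x y * cpdx e x y) + RtoC V2 * (e x y * cpdy e x y))%C; [ring|].
      rewrite Rx, Ry.
      transitivity (RtoC (2 * (V1 * pdx f x y + V2 * pdy f x y)) * c x y)%C; [Cring|].
      rewrite DVf; Cring. }
  assert (DVc : forall x y, (RtoC V1 * cpdx c x y + RtoC V2 * cpdy c x y = 0)%C).
  { apply CancC.
    - apply csmooth_plus; apply csmooth_mult; auto using csmooth_const.
    - intros x y; destruct (gradient_relations x y) as [_ [_ [Rx Ry]]].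
      transitivity (RtoC V1 * (e x y * cpdx c x y) + RtoC V2 * (e x y * cpdy c x y))%C; [ring|].
      rewrite Rx, Ry.
      transitivity (RtoC (3 * (V1 * pdx f x y + V2 * pdy f x y)) * a x y)%C; [Cring|].
      rewrite DVf; Cring. }
  assert (Fin : forall g al be ka, smooth g -> periodic G g ->
    (forall x y, pdx g x y = Om x y * V2) -> (forall x y, pdy g x y = - Om x y * V1) ->
    (forall x y, a x y = (RtoC al * (V1, V2) * (V1, V2) * (V1, V2))%C) ->
    (forall x y, c x y = (RtoC (3 * al * g x y + be) * (V1, V2) * (V1, V2))%C) ->
    (forall x y, lam x y = 3 * al * g x y ^ 2 + 2 * be * g x y + ka) ->
    exists m,
      (V1 <> 0 \/ V2 <> 0) /\ smooth g /\ periodic G g /\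
      (forall x y, pdx g x y = Om x y * V2) /\ (forall x y, pdy g x y = - Om x y * V1) /\
      null_form (V1, V2) g al be ka m /\
      (forall h : point_fun, (forall x y, continuity_2d_pt h x y) ->
         (forall x y, (3 * al * g x y ^ 2 + 2 * be * g x y + ka) * h x y = 0) ->
         forall x y, h x y = 0)).
  { intros g al be ka Sg Pg Gx Gy Ea Ec El.
    destruct (null_form_intro V1 V2 g al be ka Sg Gx Gy Ea Ec) as [m Hm].
    { intros x y; rewrite He, El; reflexivity. }
    exists m; split; [exact HV|]; split; [exact Sg|]; split; [exact Pg|].
    split; [exact Gx|]; split; [exact Gy|]; split; [exact Hm|].
    intros h Ch Hh; apply Canc; [exact Ch|]; intros x y; rewrite El; apply Hh. }
  destruct a_constant as [a0 Ha0].
  destruct (classic (a0 = 0)) as [Z|NZ].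
  - assert (Hc0 : forall x y, dbar c x y = 0)
      by (intros; rewrite dbar_c, Ha0, Z; ring).
    destruct (liouville G c Sc Pc Hc0) as [c0 Ec].
    destruct (classic (c0 = 0)) as [Zc|NZc].
    + assert (He0 : forall x y, dbar e x y = 0)
        by (intros; rewrite dbar_e, Ec, Zc; ring).
      destruct (liouville G e Se' Pe He0) as [e0 Ee].
      assert (El : forall x y, lam x y = 1).
      { intros x y; unfold lam, re_fun, im_fun; rewrite Ee, <- (Ee xs ys); fold V1 V2.
        fold N; field; exact HN. }
      (* With [a = c = 0] the vector [e] is the constant [V], so [f] itself is the potential and [Q]
         has slope 1. *)
      destruct (Fin f 0 0 1) as [m Hm]; try assumption.
      * intros x y; rewrite pdx_f, Ee, <- (Ee xs ys); reflexivity.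
      * intros x y; rewrite pdy_f, Ee, <- (Ee xs ys); reflexivity.
      * intros x y; rewrite Ha0, Z; ring.
      * intros x y; rewrite Ec, Zc; Cring.
      * intros x y; rewrite El; ring.
      * exists V1, V2, f, 0, 0, 1, m; exact Hm.
    + assert (N2 : RtoC 2 <> 0) by (intros E; apply (f_equal Re) in E; simpl in E; lra).
      set (k := (/ (RtoC 2 * c0))%C).
      assert (Hk : (k * (RtoC 2 * c0) = 1)%C)
        by (unfold k; rewrite Cmult_comm; apply Cinv_r; now apply Cmult_neq_0).
      destruct (potential_of_w (fun x y => k * e x y)%C V1 V2)
        as [g [h0 [Sg [Pg [Gx [Gy Hg]]]]]].
      * csmooth_tac.
      * apply cperiodic_intro; intros p q Hpq x y; now rewrite (cperiodic_elim G e Pe p q Hpq).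
      * exact HV.
      * intros x y; rewrite dbar_mult, dbar_const, dbar_e, Ec by csmooth_tac.
        transitivity (RtoC (- Om x y) * Ci * (k * (RtoC 2 * c0)))%C; [Cring | rewrite Hk; ring].
      * intros x y; rewrite cpdx_mult, cpdy_mult, cpdx_const, cpdy_const by csmooth_tac.
        transitivity (k * (RtoC V1 * cpdx e x y + RtoC V2 * cpdy e x y))%C; [ring|].
        rewrite DVe; ring.
      (* Now [lam * rho = g + i h0] with constant [rho] and [h0]. Eliminating [lam] between real and
         imaginary parts gives a linear relation for [g], which forces [rho] to be real; [rho = 0]
         would make [g] vanish. *)
      * set (rho := ((V1, V2) * k * (V1, V2))%C).
        assert (Hrho : forall x y, (RtoC (lam x y) * rho)%C = (g x y, h0)).
        { intros x y; rewrite <- Hg, He; unfold rho; ring. }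
        assert (Hrc : (rho * (RtoC 2 * c0) = (V1, V2) * (V1, V2))%C).
        { unfold rho; transitivity ((k * (RtoC 2 * c0)) * (V1, V2) * (V1, V2))%C;
            [ring | rewrite Hk; ring]. }
        clearbody rho.
        assert (G1 : forall x y, g x y = lam x y * Re rho)
          by (intros x y; exact (proj1 (RtoC_mult_components _ _ _ _ (Hrho x y)))).
        assert (G2 : forall x y, h0 = lam x y * Im rho)
          by (intros x y; exact (proj2 (RtoC_mult_components _ _ _ _ (Hrho x y)))).
        destruct (smooth_quadratic_relation g Om V1 V2 0 (Im rho) (- h0 * Re rho))
          as [_ Irho]; try assumption.
        { intros x y; rewrite (G1 x y), (G2 x y); ring. }
        assert (Rrho : Re rho <> 0).
        { intros R0; destruct (smooth_quadratic_relation g Om V1 V2 0 1 0) as [_ F]; try assumption.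
          - intros x y; rewrite G1, R0; ring.
          - lra. }
        assert (Hrr : rho = RtoC (Re rho)) by (apply C_ext; [reflexivity | exact Irho]).
        set (r := Re rho) in *.
        destruct (Fin g 0 (/ (2 * r)) 0) as [m Hm]; try assumption.
        { intros x y; rewrite Ha0, Z; ring. }
        { intros x y; rewrite Ec.
          rewrite Rmult_0_r, Rmult_0_l, Rplus_0_l.
          transitivity (RtoC (/ (2 * r)) * (rho * (RtoC 2 * c0)))%C; [|rewrite Hrc; ring].
          rewrite Hrr.
          transitivity (RtoC (/ (2 * r) * (r * 2)) * c0)%C.
          - replace (/ (2 * r) * (r * 2)) with 1 by (field; exact Rrho). ring.
          - rewrite !RtoC_mult; ring. }
        { intros x y; rewrite G1; field; exact Rrho. }
        exists V1, V2, g, 0, (/ (2 * r)), 0, m; exact Hm.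
  - assert (N3 : RtoC 3 <> 0) by (intros E; apply (f_equal Re) in E; simpl in E; lra).
    set (k := (/ (RtoC 3 * a0))%C).
    assert (Hk : (k * (RtoC 3 * a0) = 1)%C)
        by (unfold k; rewrite Cmult_comm; apply Cinv_r; now apply Cmult_neq_0).
    destruct (potential_of_w (fun x y => k * c x y)%C V1 V2)
      as [g [h0 [Sg [Pg [Gx [Gy Hg]]]]]].
    + csmooth_tac.
    + apply cperiodic_intro; intros p q Hpq x y; now rewrite (cperiodic_elim G c Pc p q Hpq).
    + exact HV.
    + intros x y; rewrite dbar_mult, dbar_const, dbar_c, Ha0 by csmooth_tac.
      transitivity (RtoC (- Om x y) * Ci * (k * (RtoC 3 * a0)))%C; [Cring | rewrite Hk; ring].
    + intros x y; rewrite cpdx_mult, cpdy_mult, cpdx_const, cpdy_const by csmooth_tac.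
      transitivity (k * (RtoC V1 * cpdx c x y + RtoC V2 * cpdy c x y))%C; [ring|].
      rewrite DVc; ring.
    + set (u := fun x y => (c x y * c x y - RtoC 3 * a0 * e x y)%C).
      destruct (liouville G u) as [q Eu].
      { unfold u; csmooth_tac. }
      { apply cperiodic_intro; intros r s Hrs x' y'; unfold u.
        now rewrite (cperiodic_elim G e Pe r s Hrs), (cperiodic_elim G c Pc r s Hrs). }
      { intros x' y'; unfold u; dbar_expand; rewrite dbar_e, dbar_c, Ha0; Cring. }
      set (iV := (/ (V1, V2))%C).
      assert (HiV : (iV * (V1, V2) = 1)%C) by (unfold iV; field; exact V0).
      (* [alp] is the leading coefficient of [Q], still complex, and [kap] will be its linear
         coefficient. Centring the cubic by [c / (3 a)] removes the quadratic one. *)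
      set (alp := (a0 * iV * iV * iV)%C).
      set (kap := (- (k * q * iV))%C).
      assert (Hc : forall x y, c x y = (RtoC 3 * alp * (V1, V2) * (V1, V2) * (g x y, h0))%C).
      { intros x y; rewrite <- Hg; unfold alp.
        transitivity (c x y * (k * (RtoC 3 * a0)) * (iV * (V1, V2)) * (iV * (V1, V2))
                      * (iV * (V1, V2)))%C; [rewrite Hk, HiV; ring | ring]. }
      assert (Hlam : forall x y,
        RtoC (lam x y) = (RtoC 3 * alp * (g x y, h0) * (g x y, h0) + kap)%C).
      { intros x y.
        assert (Ee : (e x y = k * (c x y * c x y - q))%C).
        { rewrite <- (Eu x y); unfold u.
          transitivity (k * (RtoC 3 * a0) * e x y)%C; [rewrite Hk; ring | ring]. }
        transitivity (RtoC (lam x y) * (iV * (V1, V2)))%C; [rewrite HiV; ring|].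
        transitivity (iV * e x y)%C; [rewrite He; ring|].
        rewrite Ee; unfold kap; rewrite <- Hg; unfold alp.
        transitivity (k * (RtoC 3 * a0) * k * c x y * c x y * iV
           * (iV * (V1, V2)) * (iV * (V1, V2)) - k * q * iV)%C;
          [rewrite Hk, HiV|ring].
        ring. }
      (* Since [lam] is real, the imaginary part of its expression is a quadratic relation for [g].
         It yields the reality of [alp], and then [h0 = 0] because [alp] is nonzero. *)
      destruct (smooth_quadratic_relation g Om V1 V2 (3 * Im alp) (6 * (Re alp * h0))
                  (Im kap - 3 * Im alp * h0 ^ 2)) as [Ialp Ah0]; try assumption.
      { intros x y; pose proof (f_equal Im (Hlam x y)) as E.
        clearbody alp kap; unfold Re, Im in *; simpl in E; lra. }
      assert (Ralp : Re alp <> 0).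
      { intros R0; apply NZ.
        assert (alp0 : alp = 0) by (apply C_ext; [exact R0 | change (Im (RtoC 0)) with 0; lra]).
        transitivity (alp * (V1, V2) * (V1, V2) * (V1, V2))%C; [|rewrite alp0; ring].
        transitivity (a0 * (iV * (V1, V2)) * (iV * (V1, V2)) * (iV * (V1, V2)))%C;
          [rewrite HiV; ring | unfold alp; ring]. }
      assert (H0 : h0 = 0).
      { apply (Rmult_eq_reg_l (Re alp)); [lra | exact Ralp]. }
      assert (Er : alp = RtoC (Re alp))
        by (apply C_ext; [reflexivity | change (Im (RtoC (Re alp))) with 0; lra]).
      destruct (Fin g (Re alp) 0 (Re kap)) as [m Hm]; try assumption.
      { intros x y; rewrite Ha0, <- Er; unfold alp.
        transitivity (a0 * (iV * (V1, V2)) * (iV * (V1, V2)) * (iV * (V1, V2)))%C;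
          [rewrite HiV; ring | ring]. }
      { intros x y; rewrite Hc, Er, H0; Cring. }
      { intros x y; pose proof (f_equal Re (Hlam x y)) as E; rewrite H0, Er in E.
        clearbody alp kap; unfold Re in E |- *; simpl in E; simpl; lra. }
      exists V1, V2, g, (Re alp), 0, (Re kap), m; exact Hm.
Qed.

End NullSystem.

(** * The magnetic bracket *)

(** A relation rather than a function, so that the sum and product rules fill in the values of the
    derivatives by unification. *)
Definition grad4 (F : phase_fun) (x y p1 p2 u v w z : R) : Prop :=
  is_derive (fun t => F t y p1 p2) x u /\ is_derive (fun t => F x t p1 p2) y v /\
  is_derive (fun t => F x y t p2) p1 w /\ is_derive (fun t => F x y p1 t) p2 z.

Lemma grad4_unique (F : phase_fun) x y p1 p2 u v w z : grad4 F x y p1 p2 u v w z ->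
  d_x F x y p1 p2 = u /\ d_y F x y p1 p2 = v /\ d_p1 F x y p1 p2 = w /\ d_p2 F x y p1 p2 = z.
Proof.
  intros [H1 [H2 [H3 H4]]].
  exact (conj (is_derive_unique _ _ _ H1) (conj (is_derive_unique _ _ _ H2)
    (conj (is_derive_unique _ _ _ H3) (is_derive_unique _ _ _ H4)))).
Qed.

Lemma grad4_plus (F K : phase_fun) x y p1 p2 u v w z u' v' w' z' :
  grad4 F x y p1 p2 u v w z -> grad4 K x y p1 p2 u' v' w' z' ->
  grad4 (fun x y p1 p2 => F x y p1 p2 + K x y p1 p2) x y p1 p2 (u + u') (v + v') (w + w') (z + z').
Proof.
  intros [H1 [H2 [H3 H4]]] [K1 [K2 [K3 K4]]].
  split; [|split; [|split]]; now apply (is_derive_plus (V := R_NormedModule)).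
Qed.

Lemma grad4_mult (F K : phase_fun) x y p1 p2 u v w z u' v' w' z' :
  grad4 F x y p1 p2 u v w z -> grad4 K x y p1 p2 u' v' w' z' ->
  grad4 (fun x y p1 p2 => F x y p1 p2 * K x y p1 p2) x y p1 p2
    (u * K x y p1 p2 + F x y p1 p2 * u') (v * K x y p1 p2 + F x y p1 p2 * v')
    (w * K x y p1 p2 + F x y p1 p2 * w') (z * K x y p1 p2 + F x y p1 p2 * z').
Proof.
  intros [H1 [H2 [H3 H4]]] [K1 [K2 [K3 K4]]].
  split; [|split; [|split]].
  - apply (is_derive_mult (K := R_AbsRing) (fun t => F t y p1 p2) (fun t => K t y p1 p2));
      [assumption | assumption | exact Rmult_comm].
  - apply (is_derive_mult (K := R_AbsRing) (fun t => F x t p1 p2) (fun t => K x t p1 p2));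
      [assumption | assumption | exact Rmult_comm].
  - apply (is_derive_mult (K := R_AbsRing) (fun t => F x y t p2) (fun t => K x y t p2));
      [assumption | assumption | exact Rmult_comm].
  - apply (is_derive_mult (K := R_AbsRing) (fun t => F x y p1 t) (fun t => K x y p1 t));
      [assumption | assumption | exact Rmult_comm].
Qed.

Lemma grad4_coef (f : point_fun) x y p1 p2 : smooth f ->
  grad4 (fun x y _ _ => f x y) x y p1 p2 (pdx f x y) (pdy f x y) 0 0.
Proof.
  intros Sf; split; [|split; [|split]].
  - now apply smooth_is_derive_x.
  - now apply smooth_is_derive_y.
  - apply (is_derive_const (V := R_NormedModule)).
  - apply (is_derive_const (V := R_NormedModule)).
Qed.

Lemma grad4_const (k : R) x y p1 p2 : grad4 (fun _ _ _ _ => k) x y p1 p2 0 0 0 0.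
Proof. split; [|split; [|split]]; apply (is_derive_const (V := R_NormedModule)). Qed.

Lemma grad4_p1 x y p1 p2 : grad4 (fun _ _ p1 _ => p1) x y p1 p2 0 0 1 0.
Proof.
  split; [|split; [|split]]; try apply (is_derive_const (V := R_NormedModule)).
  apply (is_derive_id (K := R_AbsRing)).
Qed.

Lemma grad4_p2 x y p1 p2 : grad4 (fun _ _ _ p2 => p2) x y p1 p2 0 0 0 1.
Proof.
  split; [|split; [|split]]; try apply (is_derive_const (V := R_NormedModule)).
  apply (is_derive_id (K := R_AbsRing)).
Qed.

Ltac grad4_tac :=
  lazymatch goal with
  | |- grad4 (fun x y p q => @?F x y p q + @?K x y p q) _ _ _ _ _ _ _ _ =>
      eapply (grad4_plus F K); grad4_tac
  | |- grad4 (fun x y p q => @?F x y p q * @?K x y p q) _ _ _ _ _ _ _ _ =>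
      eapply (grad4_mult F K); grad4_tac
  | |- grad4 (fun _ _ p _ => p) _ _ _ _ _ _ _ _ => apply grad4_p1
  | |- grad4 (fun _ _ _ q => q) _ _ _ _ _ _ _ _ => apply grad4_p2
  | |- grad4 (fun x y _ _ => ?f x y) _ _ _ _ _ _ _ _ => apply (grad4_coef f); assumption
  end.

Section Bracket.

Variables (Lam Om : point_fun).
Hypotheses (Lam_smooth : smooth Lam) (Lam_pos : forall x y, 0 < Lam x y).

Let H := hamiltonian Lam.

(** [Lam] times the magnetic bracket with the Hamiltonian of a function with partial derivatives
    [u], [v], [w], [z] in [x], [y], [p1], [p2]. The scaling keeps it polynomial in the momenta when
    these derivatives are. *)
Definition scaled_bracket (x y p1 p2 u v w z : R) : R :=
  u * p1 + v * p2
  + (p1 ^ 2 + p2 ^ 2) * (pdx Lam x y / (2 * Lam x y) * w + pdy Lam x y / (2 * Lam x y) * z)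
  + Om x y * (w * p2 - z * p1).

Lemma is_derive_inv_scal (l : R -> R) (x dl k : R) : is_derive l x dl -> 0 < l x ->
  is_derive (fun t => k / (2 * l t)) x (- (k * dl / (2 * l x ^ 2))).
Proof.
  intros Hd Hp.
  auto_derive.
  - split; [eexists; exact Hd | split; [lra | exact I]].
  - assert (E : Derive (fun t : R => l t) x = dl) by (apply is_derive_unique; exact Hd).
    rewrite E; field; lra.
Qed.

Lemma grad4_hamiltonian x y p1 p2 :
  grad4 H x y p1 p2 (- ((p1 ^ 2 + p2 ^ 2) * pdx Lam x y / (2 * Lam x y ^ 2)))
    (- ((p1 ^ 2 + p2 ^ 2) * pdy Lam x y / (2 * Lam x y ^ 2))) (p1 / Lam x y) (p2 / Lam x y).
Proof.
  pose proof (Lam_pos x y) as P.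
  split; [|split; [|split]]; unfold H, hamiltonian.
  - apply (is_derive_inv_scal (fun t => Lam t y)); [now apply smooth_is_derive_x | exact P].
  - apply (is_derive_inv_scal (fun t => Lam x t)); [now apply smooth_is_derive_y | exact P].
  - auto_derive; [lra | field; lra].
  - auto_derive; [lra | field; lra].
Qed.

Lemma mg_bracket_grad4 (F : phase_fun) x y p1 p2 u v w z : grad4 F x y p1 p2 u v w z ->
  Lam x y * mg_bracket Om F H x y p1 p2 = scaled_bracket x y p1 p2 u v w z.
Proof.
  intros HF; pose proof (grad4_hamiltonian x y p1 p2) as HH.
  apply grad4_unique in HF; destruct HF as [F1 [F2 [F3 F4]]].
  apply grad4_unique in HH; destruct HH as [H1 [H2 [H3 H4]]].
  unfold mg_bracket, scaled_bracket; rewrite F1, F2, F3, F4, H1, H2, H3, H4.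
  field; pose proof (Lam_pos x y); lra.
Qed.

Lemma scaled_bracket_hamiltonian x y p1 p2 :
  scaled_bracket x y p1 p2 (- ((p1 ^ 2 + p2 ^ 2) * pdx Lam x y / (2 * Lam x y ^ 2)))
    (- ((p1 ^ 2 + p2 ^ 2) * pdy Lam x y / (2 * Lam x y ^ 2))) (p1 / Lam x y) (p2 / Lam x y) = 0.
Proof. unfold scaled_bracket; field; pose proof (Lam_pos x y); lra. Qed.

Definition linear_fun (B1 B2 D : point_fun) : phase_fun :=
  fun x y p1 p2 => B1 x y * p1 + B2 x y * p2 + D x y.

Lemma grad4_linear_fun (B1 B2 D : point_fun) x y p1 p2 :
  smooth B1 -> smooth B2 -> smooth D ->
  grad4 (linear_fun B1 B2 D) x y p1 p2
    (pdx B1 x y * p1 + pdx B2 x y * p2 + pdx D x y)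
    (pdy B1 x y * p1 + pdy B2 x y * p2 + pdy D x y) (B1 x y) (B2 x y).
Proof.
  intros S1 S2 SD.
  assert (T : exists u v w z, grad4 (linear_fun B1 B2 D) x y p1 p2 u v w z /\
     u = pdx B1 x y * p1 + pdx B2 x y * p2 + pdx D x y /\
     v = pdy B1 x y * p1 + pdy B2 x y * p2 + pdy D x y /\ w = B1 x y /\ z = B2 x y).
  { do 4 eexists; split; [unfold linear_fun; grad4_tac|].
    cbv beta; repeat split; ring. }
  destruct T as [u [v [w [z [T [-> [-> [-> ->]]]]]]]]; exact T.
Qed.

(** Zero momenta are excluded because the linear function will arise from a division by the
    Hamiltonian. The scaled bracket consists of a quadratic and a linear form in the momenta, with 3
    + 2 coefficients, and five covectors determine them. *)
Lemma linear_integral_system (B1 B2 D : point_fun) :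
  smooth B1 -> smooth B2 -> smooth D ->
  (forall x y p1 p2, p1 ^ 2 + p2 ^ 2 <> 0 -> mg_bracket Om (linear_fun B1 B2 D) H x y p1 p2 = 0) ->
  forall x y,
    pdx B1 x y = pdy B2 x y /\ pdy B1 x y = - pdx B2 x y /\
    pdx D x y = Om x y * B2 x y /\ pdy D x y = - Om x y * B1 x y /\
    2 * Lam x y * pdx B1 x y + (pdx Lam x y * B1 x y + pdy Lam x y * B2 x y) = 0.
Proof.
  intros S1 S2 SD Hb x y.
  assert (E : forall p1 p2, p1 ^ 2 + p2 ^ 2 <> 0 ->
    scaled_bracket x y p1 p2 (pdx B1 x y * p1 + pdx B2 x y * p2 + pdx D x y)
    (pdy B1 x y * p1 + pdy B2 x y * p2 + pdy D x y) (B1 x y) (B2 x y) = 0).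
  { intros p1 p2 Hp; rewrite <- (mg_bracket_grad4 (linear_fun B1 B2 D)) by now apply grad4_linear_fun.
    rewrite Hb by exact Hp; ring. }
  pose proof (Lam_pos x y) as P.
  set (s := pdx Lam x y / (2 * Lam x y) * B1 x y + pdy Lam x y / (2 * Lam x y) * B2 x y).
  assert (Hs : 2 * Lam x y * s = pdx Lam x y * B1 x y + pdy Lam x y * B2 x y)
    by (unfold s; field; lra).
  rewrite <- Hs.
  pose proof (E 1 0 ltac:(lra)) as T1; pose proof (E (-1) 0 ltac:(lra)) as T2.
  pose proof (E 0 1 ltac:(lra)) as T3; pose proof (E 0 (-1) ltac:(lra)) as T4.
  pose proof (E 1 1 ltac:(lra)) as T5.
  unfold scaled_bracket in *; fold s in T1, T2, T3, T4, T5; clearbody s.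
  assert (X : pdx B1 x y + s = 0) by lra.
  repeat split; try lra.
  transitivity (2 * Lam x y * (pdx B1 x y + s)); [ring | rewrite X; ring].
Qed.

Lemma linear_first_integral (V1 V2 : R) (g : point_fun) : smooth g ->
  (forall x y, V1 * pdx Lam x y + V2 * pdy Lam x y = 0) ->
  (forall x y, pdx g x y = Om x y * V2) -> (forall x y, pdy g x y = - Om x y * V1) ->
  forall x y p1 p2,
    scaled_bracket x y p1 p2 (pdx g x y) (pdy g x y) V1 V2 = 0.
Proof.
  intros Sg HL Gx Gy x y p1 p2; unfold scaled_bracket.
  pose proof (Lam_pos x y) as P.
  rewrite Gx, Gy.
  transitivity ((p1 ^ 2 + p2 ^ 2) / (2 * Lam x y) * (V1 * pdx Lam x y + V2 * pdy Lam x y));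
    [field; lra | rewrite HL; ring].
Qed.

(** Opposite covectors separate even from odd degrees, and in each direction the two radii separate
    the two degrees of equal parity. *)
Lemma polynomial_zero_on_circles (P : R -> R -> R)
  (g40 g41 g42 g43 g44 g30 g31 g32 g33 g20 g21 g22 g10 g11 r1 r2 : R) :
  (forall p1 p2, P p1 p2 =
    g40 * p1 ^ 4 + g41 * p1 ^ 3 * p2 + g42 * p1 ^ 2 * p2 ^ 2 + g43 * p1 * p2 ^ 3 + g44 * p2 ^ 4
    + (g30 * p1 ^ 3 + g31 * p1 ^ 2 * p2 + g32 * p1 * p2 ^ 2 + g33 * p2 ^ 3)
    + (g20 * p1 ^ 2 + g21 * p1 * p2 + g22 * p2 ^ 2) + (g10 * p1 + g11 * p2)) ->
  0 < r1 -> 0 < r2 -> r1 <> r2 ->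
  (forall r p1 p2, r = r1 \/ r = r2 -> p1 ^ 2 + p2 ^ 2 = r ^ 2 -> P p1 p2 = 0) ->
  (g40 = 0 /\ g41 = 0 /\ g42 = 0 /\ g43 = 0 /\ g44 = 0) /\
  (g30 = 0 /\ g31 = 0 /\ g32 = 0 /\ g33 = 0) /\
  (g20 = 0 /\ g21 = 0 /\ g22 = 0) /\ g10 = 0 /\ g11 = 0.
Proof.
  intros HP R1 R2 R12 Hz'.
  assert (Hz : forall r p1 p2, r = r1 \/ r = r2 -> p1 ^ 2 + p2 ^ 2 = r ^ 2 ->
    g40 * p1 ^ 4 + g41 * p1 ^ 3 * p2 + g42 * p1 ^ 2 * p2 ^ 2 + g43 * p1 * p2 ^ 3 + g44 * p2 ^ 4
    + (g30 * p1 ^ 3 + g31 * p1 ^ 2 * p2 + g32 * p1 * p2 ^ 2 + g33 * p2 ^ 3)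
    + (g20 * p1 ^ 2 + g21 * p1 * p2 + g22 * p2 ^ 2) + (g10 * p1 + g11 * p2) = 0)
    by (intros r p1 p2 Hr Hc; rewrite <- HP; now apply (Hz' r)).
  assert (Two : forall A B, (forall r, r = r1 \/ r = r2 -> r ^ 2 * A + B = 0) -> A = 0 /\ B = 0).
  { intros A B T; pose proof (T r1 (or_introl eq_refl)) as T1.
    pose proof (T r2 (or_intror eq_refl)) as T2.
    assert (A0 : A = 0).
    { apply (Rmult_eq_reg_l ((r1 - r2) * (r1 + r2))).
      - rewrite Rmult_0_r. transitivity ((r1 ^ 2 * A + B) - (r2 ^ 2 * A + B)); [ring | lra].
      - apply Rmult_integral_contrapositive; split; lra. }
    split; [exact A0|]; rewrite A0 in T1; lra. }
  assert (Dir : forall n1 n2, n1 ^ 2 + n2 ^ 2 = 1 ->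
    (g40 * n1 ^ 4 + g41 * n1 ^ 3 * n2 + g42 * n1 ^ 2 * n2 ^ 2 + g43 * n1 * n2 ^ 3 + g44 * n2 ^ 4 = 0
     /\ g20 * n1 ^ 2 + g21 * n1 * n2 + g22 * n2 ^ 2 = 0) /\
    (g30 * n1 ^ 3 + g31 * n1 ^ 2 * n2 + g32 * n1 * n2 ^ 2 + g33 * n2 ^ 3 = 0
     /\ g10 * n1 + g11 * n2 = 0)).
  { intros n1 n2 Hn; split; apply Two; intros r Hr;
      assert (r0 : r <> 0) by (destruct Hr; lra);
      assert (Cp : (r * n1) ^ 2 + (r * n2) ^ 2 = r ^ 2)
        by (transitivity (r ^ 2 * (n1 ^ 2 + n2 ^ 2)); [ring | rewrite Hn; ring]);
      assert (Cm : (- r * n1) ^ 2 + (- r * n2) ^ 2 = r ^ 2)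
        by (transitivity (r ^ 2 * (n1 ^ 2 + n2 ^ 2)); [ring | rewrite Hn; ring]);
      pose proof (Hz r _ _ Hr Cp) as Zp; pose proof (Hz r _ _ Hr Cm) as Zm.
    - apply (Rmult_eq_reg_l (2 * r ^ 2)); [|apply Rmult_integral_contrapositive; split;
        [lra | now apply pow_nonzero]].
      rewrite Rmult_0_r. etransitivity; [|exact (eq_trans (f_equal2 Rplus Zp Zm) (Rplus_0_r 0))].
      ring.
    - apply (Rmult_eq_reg_l (2 * r)); [|lra].
      rewrite Rmult_0_r. etransitivity; [|exact (eq_trans (f_equal2 Rminus Zp Zm) (Rminus_0_r 0))].
      ring. }
  (* Five pairwise non-proportional unit vectors determine a binary quartic form; the triple 3, 4, 5
     keeps their coordinates rational. *)
  destruct (Dir 1 0 ltac:(lra)) as [[A1 B1] [C1 D1]].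
  destruct (Dir 0 1 ltac:(lra)) as [[A2 B2] [C2 D2]].
  destruct (Dir (3 / 5) (4 / 5) ltac:(lra)) as [[A3 B3] [C3 D3]].
  destruct (Dir (3 / 5) (- 4 / 5) ltac:(lra)) as [[A4 B4] [C4 D4]].
  destruct (Dir (4 / 5) (3 / 5) ltac:(lra)) as [[A5 B5] [C5 D5]].
  clear Dir Two Hz.
  repeat split; lra.
Qed.

(** * The bracket of a cubic momentum polynomial *)

Variable A : nat -> nat -> point_fun.
Hypothesis A_smooth : forall s k, (k <= s)%nat -> (s <= 3)%nat -> smooth (A s k).

(** Monomials are written as nested products because [grad4_tac] works with sums and products
    only. *)
Definition cubic_fun : phase_fun := fun x y p1 p2 =>
  A 0%nat 0%nat x y
  + (A 1%nat 0%nat x y * p1 + A 1%nat 1%nat x y * p2)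
  + (A 2%nat 0%nat x y * (p1 * p1) + A 2%nat 1%nat x y * (p1 * p2) + A 2%nat 2%nat x y * (p2 * p2))
  + (A 3%nat 0%nat x y * (p1 * (p1 * p1)) + A 3%nat 1%nat x y * (p1 * (p1 * p2))
     + A 3%nat 2%nat x y * (p1 * (p2 * p2)) + A 3%nat 3%nat x y * (p2 * (p2 * p2))).

(** The listed combinations are those that the substitution [p1 = 1], [p2 = i] selects: the
    auxiliary [q0], ..., [s], which carry the derivatives of [Lam], cancel in them. The final
    equation is a trace of the quadratic part that retains [Lam]. *)
Lemma cubic_bracket_system (E1 E2 : R) : 0 < E1 -> 0 < E2 -> E1 <> E2 ->
  first_integral_on_level Lam Om E1 cubic_fun -> first_integral_on_level Lam Om E2 cubic_fun ->
  first_integral Lam Om cubic_fun /\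
  forall x y,
    let A30 := A 3%nat 0%nat in let A31 := A 3%nat 1%nat in
    let A32 := A 3%nat 2%nat in let A33 := A 3%nat 3%nat in
    let A20 := A 2%nat 0%nat in let A21 := A 2%nat 1%nat in let A22 := A 2%nat 2%nat in
    let A10 := A 1%nat 0%nat in let A11 := A 1%nat 1%nat in let A00 := A 0%nat 0%nat in
    (pdx A30 x y - pdx A32 x y - (pdy A31 x y - pdy A33 x y) = 0 /\
     pdy A30 x y - pdy A32 x y + (pdx A31 x y - pdx A33 x y) = 0) /\
    (pdx A20 x y - pdx A22 x y - pdy A21 x y = 3 * Om x y * (A31 x y - A33 x y) /\
     pdy A20 x y - pdy A22 x y + pdx A21 x y = - 3 * Om x y * (A30 x y - A32 x y)) /\
    (pdx A10 x y - pdy A11 x y = 2 * Om x y * A21 x y /\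
     pdy A10 x y + pdx A11 x y = - 2 * Om x y * (A20 x y - A22 x y)) /\
    pdx A00 x y = Om x y * A11 x y /\ pdy A00 x y = - Om x y * A10 x y /\
    Lam x y * (pdx A10 x y + pdy A11 x y) + (pdx Lam x y * A10 x y + pdy Lam x y * A11 x y) = 0.
Proof.
  intros P1 P2 E12 I1 I2.
  assert (S00 : smooth (A 0%nat 0%nat)) by (apply A_smooth; lia).
  assert (S10 : smooth (A 1%nat 0%nat)) by (apply A_smooth; lia).
  assert (S11 : smooth (A 1%nat 1%nat)) by (apply A_smooth; lia).
  assert (S20 : smooth (A 2%nat 0%nat)) by (apply A_smooth; lia).
  assert (S21 : smooth (A 2%nat 1%nat)) by (apply A_smooth; lia).
  assert (S22 : smooth (A 2%nat 2%nat)) by (apply A_smooth; lia).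
  assert (S30 : smooth (A 3%nat 0%nat)) by (apply A_smooth; lia).
  assert (S31 : smooth (A 3%nat 1%nat)) by (apply A_smooth; lia).
  assert (S32 : smooth (A 3%nat 2%nat)) by (apply A_smooth; lia).
  assert (S33 : smooth (A 3%nat 3%nat)) by (apply A_smooth; lia).
  set (A30 := A 3%nat 0%nat) in *; set (A31 := A 3%nat 1%nat) in *;
  set (A32 := A 3%nat 2%nat) in *; set (A33 := A 3%nat 3%nat) in *;
  set (A20 := A 2%nat 0%nat) in *; set (A21 := A 2%nat 1%nat) in *;
  set (A22 := A 2%nat 2%nat) in *; set (A10 := A 1%nat 0%nat) in *;
  set (A11 := A 1%nat 1%nat) in *; set (A00 := A 0%nat 0%nat) in *.
  assert (Gen : forall x y, exists q0 q1 q2 r0 r1 s,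
    2 * Lam x y * s = pdx Lam x y * A10 x y + pdy Lam x y * A11 x y /\
    forall p1 p2, Lam x y * mg_bracket Om cubic_fun H x y p1 p2 =
      (pdx A30 x y + q0) * p1 ^ 4
      + (pdx A31 x y + pdy A30 x y + q1) * p1 ^ 3 * p2
      + (pdx A32 x y + pdy A31 x y + q2 + q0) * p1 ^ 2 * p2 ^ 2
      + (pdx A33 x y + pdy A32 x y + q1) * p1 * p2 ^ 3
      + (pdy A33 x y + q2) * p2 ^ 4
      + ((pdx A20 x y + r0 - Om x y * A31 x y) * p1 ^ 3
         + (pdx A21 x y + pdy A20 x y + r1 + Om x y * (3 * A30 x y - 2 * A32 x y)) * p1 ^ 2 * p2
         + (pdx A22 x y + pdy A21 x y + r0 + Om x y * (2 * A31 x y - 3 * A33 x y)) * p1 * p2 ^ 2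
         + (pdy A22 x y + r1 + Om x y * A32 x y) * p2 ^ 3)
      + ((pdx A10 x y + s - Om x y * A21 x y) * p1 ^ 2
         + (pdx A11 x y + pdy A10 x y + 2 * Om x y * (A20 x y - A22 x y)) * p1 * p2
         + (pdy A11 x y + s + Om x y * A21 x y) * p2 ^ 2)
      + ((pdx A00 x y - Om x y * A11 x y) * p1 + (pdy A00 x y + Om x y * A10 x y) * p2)).
  { intros x y; set (l1 := pdx Lam x y / (2 * Lam x y)); set (l2 := pdy Lam x y / (2 * Lam x y)).
    exists (3 * l1 * A30 x y + l2 * A31 x y), (2 * l1 * A31 x y + 2 * l2 * A32 x y),
      (l1 * A32 x y + 3 * l2 * A33 x y), (2 * l1 * A20 x y + l2 * A21 x y),
      (l1 * A21 x y + 2 * l2 * A22 x y), (l1 * A10 x y + l2 * A11 x y).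
    split; [unfold l1, l2; field; pose proof (Lam_pos x y); lra|].
    intros p1 p2.
    assert (T : exists u v w z, grad4 cubic_fun x y p1 p2 u v w z /\
      scaled_bracket x y p1 p2 u v w z = scaled_bracket x y p1 p2
       (pdx A00 x y + (pdx A10 x y * p1 + pdx A11 x y * p2)
        + (pdx A20 x y * p1 ^ 2 + pdx A21 x y * p1 * p2 + pdx A22 x y * p2 ^ 2)
        + (pdx A30 x y * p1 ^ 3 + pdx A31 x y * p1 ^ 2 * p2 + pdx A32 x y * p1 * p2 ^ 2
           + pdx A33 x y * p2 ^ 3))
       (pdy A00 x y + (pdy A10 x y * p1 + pdy A11 x y * p2)
        + (pdy A20 x y * p1 ^ 2 + pdy A21 x y * p1 * p2 + pdy A22 x y * p2 ^ 2)
        + (pdy A30 x y * p1 ^ 3 + pdy A31 x y * p1 ^ 2 * p2 + pdy A32 x y * p1 * p2 ^ 2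
           + pdy A33 x y * p2 ^ 3))
       (A10 x y + (2 * A20 x y * p1 + A21 x y * p2)
        + (3 * A30 x y * p1 ^ 2 + 2 * A31 x y * p1 * p2 + A32 x y * p2 ^ 2))
       (A11 x y + (A21 x y * p1 + 2 * A22 x y * p2)
        + (A31 x y * p1 ^ 2 + 2 * A32 x y * p1 * p2 + 3 * A33 x y * p2 ^ 2))).
    { do 4 eexists; split; [unfold cubic_fun; fold A00 A10 A11 A20 A21 A22 A30 A31 A32 A33; grad4_tac|].
      cbv beta; f_equal; ring. }
    destruct T as [u [v [w [z [T E]]]]].
    rewrite (mg_bracket_grad4 _ _ _ _ _ _ _ _ _ T), E.
    unfold scaled_bracket; fold l1 l2; ring. }
  assert (Zero : forall x y, exists q0 q1 q2 r0 r1 s,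
    2 * Lam x y * s = pdx Lam x y * A10 x y + pdy Lam x y * A11 x y /\
    (forall p1 p2, mg_bracket Om cubic_fun H x y p1 p2 = 0) /\
    (pdx A30 x y + q0 = 0 /\ pdx A31 x y + pdy A30 x y + q1 = 0 /\
     pdx A32 x y + pdy A31 x y + q2 + q0 = 0 /\ pdx A33 x y + pdy A32 x y + q1 = 0 /\
     pdy A33 x y + q2 = 0) /\
    (pdx A20 x y + r0 - Om x y * A31 x y = 0 /\
     pdx A21 x y + pdy A20 x y + r1 + Om x y * (3 * A30 x y - 2 * A32 x y) = 0 /\
     pdx A22 x y + pdy A21 x y + r0 + Om x y * (2 * A31 x y - 3 * A33 x y) = 0 /\
     pdy A22 x y + r1 + Om x y * A32 x y = 0) /\
    (pdx A10 x y + s - Om x y * A21 x y = 0 /\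
     pdx A11 x y + pdy A10 x y + 2 * Om x y * (A20 x y - A22 x y) = 0 /\
     pdy A11 x y + s + Om x y * A21 x y = 0) /\
    pdx A00 x y - Om x y * A11 x y = 0 /\ pdy A00 x y + Om x y * A10 x y = 0).
  { intros x y; destruct (Gen x y) as [q0 [q1 [q2 [r0 [r1 [s [Hs Hp]]]]]]].
    exists q0, q1, q2, r0, r1, s; split; [exact Hs|].
    pose proof (Lam_pos x y) as PL.
    (* Over a fixed point of the torus the energy level is a circle of radius
       [sqrt (2 * Lam x y * E)], and different energies give different radii. *)
    assert (Lev : forall E p1 p2, 0 < E -> p1 ^ 2 + p2 ^ 2 = sqrt (2 * Lam x y * E) ^ 2 ->
              hamiltonian Lam x y p1 p2 = E).
    { intros E p1 p2 HE Hc; unfold hamiltonian; rewrite Hc, pow2_sqrt; [field; lra|].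
      left; repeat apply Rmult_lt_0_compat; lra. }
    assert (Pos : forall E, 0 < E -> 0 < 2 * Lam x y * E)
      by (intros; repeat apply Rmult_lt_0_compat; lra).
    assert (W := polynomial_zero_on_circles _ _ _ _ _ _ _ _ _ _ _ _ _ _ _
      (sqrt (2 * Lam x y * E1)) (sqrt (2 * Lam x y * E2)) Hp
      (sqrt_lt_R0 _ (Pos E1 P1)) (sqrt_lt_R0 _ (Pos E2 P2))).
    refine (_ (W _ _)); clear W.
    - intros W.
      destruct W as [W4 [W3 [W2 W1]]]; split; [|tauto].
      intros p1 p2; apply (Rmult_eq_reg_l (Lam x y)); [|lra].
      rewrite Hp; destruct W4 as [-> [-> [-> [-> ->]]]], W3 as [-> [-> [-> ->]]],
        W2 as [-> [-> ->]], W1 as [-> ->]; ring.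
    - intros Es; apply sqrt_inj in Es; try (left; now apply Pos).
      apply E12, (Rmult_eq_reg_l (2 * Lam x y)); lra.
    - intros r p1 p2 [-> | ->] Hc.
      + assert (Ib : mg_bracket Om cubic_fun H x y p1 p2 = 0)
          by (apply I1; now apply Lev).
        rewrite Ib; ring.
      + assert (Ib : mg_bracket Om cubic_fun H x y p1 p2 = 0)
          by (apply I2; now apply Lev).
        rewrite Ib; ring. }
  split.
  - intros x y p1 p2; destruct (Zero x y) as [q0 [q1 [q2 [r0 [r1 [s [_ [Hb _]]]]]]]]; apply Hb.
  - intros x y; destruct (Zero x y) as [q0 [q1 [q2 [r0 [r1 [s [Hs [_ [W4 [W3 [W2 W1]]]]]]]]]]].
    repeat split; try lra.
    assert (X : pdx A10 x y + s - Om x y * A21 x y = 0) by tauto.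
    assert (Y : pdy A11 x y + s + Om x y * A21 x y = 0) by tauto.
    rewrite <- Hs; transitivity (Lam x y * ((pdx A10 x y + s - Om x y * A21 x y)
      + (pdy A11 x y + s + Om x y * A21 x y))); [ring | rewrite X, Y; ring].
Qed.

End Bracket.

(** * Integrals linear in the momenta *)

(** Each point slides along [V] to the line through the origin orthogonal to [V], where
    [V2 x - V1 y] is a coordinate up to scaling. *)
Lemma depends_only_on_of_directional (f : point_fun) (V1 V2 : R) : smooth f ->
  (V1 <> 0 \/ V2 <> 0) -> (forall x y, V1 * pdx f x y + V2 * pdy f x y = 0) ->
  depends_only_on V2 (- V1) f.
Proof.
  intros Sf HV H; set (N := V1 * V1 + V2 * V2).
  assert (HN : N <> 0) by (unfold N; destruct HV; nra).
  exists (fun s => f (s * V2 / N) (- s * V1 / N)); intros x y.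
  rewrite <- (directional_zero_const f V1 V2 Sf H ((V2 * x + - V1 * y) * V2 / N)
    (- (V2 * x + - V1 * y) * V1 / N) ((x * V1 + y * V2) / N)).
  f_equal; unfold N in *; field; exact HN.
Qed.

(** The integrability condition of the potential, that is, the equality of its mixed derivatives. *)
Lemma potential_direction (g Om : point_fun) (V1 V2 : R) : smooth g -> smooth Om ->
  (forall x y, pdx g x y = Om x y * V2) -> (forall x y, pdy g x y = - Om x y * V1) ->
  forall x y, V1 * pdx Om x y + V2 * pdy Om x y = 0.
Proof.
  intros Sg SO Gx Gy x y.
  assert (Sk : forall k, smooth (fun _ _ => k)) by apply smooth_const.
  pose proof (pdx_pdy_comm g x y Sg) as E.
  assert (Ex : pdx g = fun x y => Om x y * V2) by (apply point_fun_ext; exact Gx).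
  assert (Ey : pdy g = fun x y => - (Om x y * V1))
    by (apply point_fun_ext; intros; rewrite Gy; ring).
  rewrite Ex, Ey, pdx_opp, pdx_mult, pdy_mult, pdx_const, pdy_const in E by smooth_tac.
  lra.
Qed.

Lemma dbar_pair (u v : point_fun) x y :
  dbar (fun x y => (u x y, v x y)) x y
  = (pdx u x y - pdy v x y, pdx v x y + pdy u x y).
Proof.
  apply C_ext.
  - change (pdx u x y + (0 * pdy u x y - 1 * pdy v x y) = pdx u x y - pdy v x y); ring.
  - change (pdx v x y + (0 * pdy v x y + 1 * pdy u x y) = pdx v x y + pdy u x y); ring.
Qed.

Lemma constant_of_cauchy_riemann (G : lattice) (B1 B2 : point_fun) :
  smooth B1 -> smooth B2 -> periodic G B1 -> periodic G B2 ->
  (forall x y, pdx B1 x y = pdy B2 x y) -> (forall x y, pdy B1 x y = - pdx B2 x y) ->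
  exists b1 b2, (forall x y, B1 x y = b1) /\ (forall x y, B2 x y = b2).
Proof.
  intros S1 S2 P1 P2 E1 E2.
  destruct (liouville G (fun x y => (B1 x y, B2 x y))) as [k Hk].
  - split; assumption.
  - split; assumption.
  - intros x y; rewrite dbar_pair, E1, E2; apply C_ext; simpl; ring.
  - exists (Re k), (Im k); split; intros x y; rewrite <- (Hk x y); reflexivity.
Qed.

(** With the complex quotient [k = b / V], the function [k g - D] is holomorphic and so constant.
    Its imaginary part is [Im k] times the nonconstant [g], hence [k] is real. *)
Lemma linear_integrals_proportional (G : lattice) (Om g D : point_fun) (V1 V2 b1 b2 : R) :
  (V1 <> 0 \/ V2 <> 0) -> (exists x y, Om x y <> 0) ->
  smooth g -> periodic G g -> smooth D -> periodic G D ->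
  (forall x y, pdx g x y = Om x y * V2) -> (forall x y, pdy g x y = - Om x y * V1) ->
  (forall x y, pdx D x y = Om x y * b2) -> (forall x y, pdy D x y = - Om x y * b1) ->
  exists mu nu, b1 = mu * V1 /\ b2 = mu * V2 /\ forall x y, D x y = mu * g x y + nu.
Proof.
  intros HV HO Sg Pg SD PD Gx Gy Dx Dy.
  assert (V0 : (V1, V2) <> RtoC 0)
    by (intros E; injection E; intros; destruct HV; contradiction).
  set (k := ((b1, b2) * / (V1, V2))%C).
  assert (Hk : (k * (V1, V2) = (b1, b2))%C) by (unfold k; field; exact V0).
  clearbody k.
  assert (SgC : csmooth (fun x y => RtoC (g x y))) by now apply csmooth_real.
  assert (SDC : csmooth (fun x y => RtoC (D x y))) by now apply csmooth_real.
  destruct (liouville G (fun x y => k * RtoC (g x y) - RtoC (D x y))%C) as [l Hl].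
  - csmooth_tac.
  - apply cperiodic_intro; intros a b Hab x y; now rewrite (Pg a b Hab), (PD a b Hab).
  - intros x y; rewrite dbar_minus, dbar_mult, dbar_const by csmooth_tac.
    unfold dbar; rewrite !cpdx_real, !cpdy_real, Gx, Gy, Dx, Dy.
    transitivity (RtoC (- Om x y) * Ci * (k * (V1, V2) - (b1, b2)))%C; [Cring|].
    rewrite Hk; ring.
  - assert (L : forall x y, Re l = Re k * g x y - D x y /\ Im l = Im k * g x y).
    { intros x y; rewrite <- (Hl x y); unfold Re, Im; simpl; split; ring. }
    destruct (smooth_quadratic_relation g Om V1 V2 0 (Im k) (- Im l)) as [_ Ik]; try assumption.
    { intros x y; rewrite (proj2 (L x y)); ring. }
    exists (Re k), (- Re l).
    pose proof (f_equal Re Hk) as H1; pose proof (f_equal Im Hk) as H2.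
    unfold Re, Im in *; simpl in H1, H2; rewrite Ik in H1, H2.
    split; [lra|]; split; [lra|].
    intros x y; rewrite (proj1 (L x y)); ring.
Qed.

(** * Division by the Hamiltonian and the shape of the integral *)

Section Conclusion.

Variables (G : lattice) (Lam Om : point_fun).
Hypotheses (Lam_smooth : smooth Lam) (Lam_periodic : periodic G Lam)
  (Lam_pos : forall x y, 0 < Lam x y) (Om_smooth : smooth Om) (Om_nonzero : exists x y, Om x y <> 0).

(** The common end of both cases, whether the linear integral comes from the null polynomial or from
    the quotient by the Hamiltonian. *)
Lemma linear_integral_conclusion (F : phase_fun) (V1 V2 : R) (g : point_fun) (Phi : R -> R -> R) :
  (V1 <> 0 \/ V2 <> 0) -> smooth g -> periodic G g ->
  (forall x y, V1 * pdx Lam x y + V2 * pdy Lam x y = 0) ->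
  (forall x y, pdx g x y = Om x y * V2) -> (forall x y, pdy g x y = - Om x y * V1) ->
  (forall x y p1 p2, F x y p1 p2 = Phi (V1 * p1 + V2 * p2 + g x y) (hamiltonian Lam x y p1 p2)) ->
  (exists alpha beta : R, (alpha <> 0 \/ beta <> 0) /\
     depends_only_on alpha beta Om /\ depends_only_on alpha beta Lam) /\
  (exists F1 : phase_fun,
     polynomial_in_momenta G smooth 1 F1 /\
     first_integral Lam Om F1 /\
     exists Phi : R -> R -> R, forall x y p1 p2 : R,
       F x y p1 p2 = Phi (F1 x y p1 p2) (hamiltonian Lam x y p1 p2)).
Proof.
  intros HV Sg Pg HL Gx Gy HF; split.
  - exists V2, (- V1); split; [destruct HV; lra|]; split;
      apply depends_only_on_of_directional; try assumption.
    now apply (potential_direction g).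
  - exists (linear_fun (fun _ _ => V1) (fun _ _ => V2) g); split; [|split].
    + exists (fun s k => match s, k with
        | 0%nat, _ => g | _, 0%nat => fun _ _ => V1 | _, _ => fun _ _ => V2 end).
      split; [|split].
      * intros [|s] [|k] _ _; split; try assumption; try apply smooth_const;
          intros a b _ x y; reflexivity.
      * destruct HV as [HV|HV];
          [exists 0%nat, 0, 0 | exists 1%nat, 0, 0]; (split; [lia | exact HV]).
      * intros x y p1 p2; rewrite sum_n_R_S, !sum_n_R_0, sum_n_R_S, sum_n_R_0.
        unfold linear_fun; simpl; ring.
    + intros x y p1 p2; apply (Rmult_eq_reg_l (Lam x y)); [|pose proof (Lam_pos x y); lra].
      rewrite (mg_bracket_grad4 Lam Om Lam_smooth Lam_pos _ _ _ _ _ _ _ _ _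
        (grad4_linear_fun _ _ _ x y p1 p2 (smooth_const V1) (smooth_const V2) Sg)).
      rewrite !pdx_const, !pdy_const, !Rmult_0_l, !Rplus_0_l, Rmult_0_r.
      now apply (linear_first_integral Lam Om Lam_pos V1 V2 g).
    + exists Phi; exact HF.
Qed.

Variable A : nat -> nat -> point_fun.
Hypothesis A_smooth : forall s k, (k <= s)%nat -> (s <= 3)%nat -> smooth (A s k).
Hypothesis A_periodic : forall s k, (k <= s)%nat -> (s <= 3)%nat -> periodic G (A s k).

(* The coefficients of the momentum polynomial on the null covectors [(t, i t)]. *)
Definition null3 : cfun := fun x y =>
  (A 3%nat 0%nat x y - A 3%nat 2%nat x y, A 3%nat 1%nat x y - A 3%nat 3%nat x y).
Definition null2 : cfun := fun x y =>
  (A 2%nat 0%nat x y - A 2%nat 2%nat x y, A 2%nat 1%nat x y).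
Definition null1 : cfun := fun x y => (A 1%nat 0%nat x y, A 1%nat 1%nat x y).
Definition null0 : point_fun := A 0%nat 0%nat.

(** A real polynomial vanishing on null covectors is divisible by [p1^2 + p2^2]. By the Leibniz rule
    the quotient is again an integral, and the equations of degree 2 make its linear coefficients
    Cauchy-Riemann, hence constant. The explicit values of [b1] and [b2] are kept in order to detect
    a vanishing cubic part. *)
Lemma null_remainder (V1 V2 : R) (g : point_fun) (al be ka m : R) :
  smooth g -> periodic G g ->
  null_form null3 null2 null1 null0 (V1, V2) g al be ka m ->
  (forall x y p1 p2, scaled_bracket Lam Om x y p1 p2 (pdx g x y) (pdy g x y) V1 V2 = 0) ->
  first_integral Lam Om (cubic_fun A) ->
  exists (b1 b2 : R) (D : point_fun),
    smooth D /\ periodic G D /\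
    (forall x y, pdx D x y = Om x y * b2) /\ (forall x y, pdy D x y = - Om x y * b1) /\
    (forall x y, b1 * pdx Lam x y + b2 * pdy Lam x y = 0) /\
    (forall x y, b1 = 2 * Lam x y * (A 3%nat 2%nat x y - 3 * al * V1 * V2 ^ 2)) /\
    (forall x y, b2 = 2 * Lam x y * (A 3%nat 1%nat x y - 3 * al * V1 ^ 2 * V2)) /\
    (forall x y p1 p2, let k := V1 * p1 + V2 * p2 + g x y in
       cubic_fun A x y p1 p2 = al * k ^ 3 + be * k ^ 2 + ka * k + m
         + hamiltonian Lam x y p1 p2 * (b1 * p1 + b2 * p2 + D x y)).
Proof.
  intros Sg Pg Hnf HK HFI.
  assert (Sk : forall k, smooth (fun _ _ => k)) by apply smooth_const.
  assert (S32 : smooth (A 3%nat 2%nat)) by (apply A_smooth; lia).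
  assert (S31 : smooth (A 3%nat 1%nat)) by (apply A_smooth; lia).
  assert (S22 : smooth (A 2%nat 2%nat)) by (apply A_smooth; lia).
  assert (P32 : periodic G (A 3%nat 2%nat)) by (apply A_periodic; lia).
  assert (P31 : periodic G (A 3%nat 1%nat)) by (apply A_periodic; lia).
  assert (P22 : periodic G (A 2%nat 2%nat)) by (apply A_periodic; lia).
  (* The quotient is read off from the coefficients of [p1 p2^2], [p1^2 p2] and [p2^2]; the factor
     [2 Lam] turns [p1^2 + p2^2] into the Hamiltonian. *)
  set (B1 := fun x y => 2 * Lam x y * (A 3%nat 2%nat x y - 3 * al * V1 * V2 ^ 2)).
  set (B2 := fun x y => 2 * Lam x y * (A 3%nat 1%nat x y - 3 * al * V1 ^ 2 * V2)).
  set (D := fun x y => 2 * Lam x y * (A 2%nat 2%nat x y - (3 * al * g x y + be) * V2 ^ 2)).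
  assert (SB1 : smooth B1) by (unfold B1; smooth_tac).
  assert (SB2 : smooth B2) by (unfold B2; smooth_tac).
  assert (SD : smooth D) by (unfold D; smooth_tac).
  assert (PB1 : periodic G B1)
    by (intros a b Hab x y; unfold B1; now rewrite (Lam_periodic a b Hab), (P32 a b Hab)).
  assert (PB2 : periodic G B2)
    by (intros a b Hab x y; unfold B2; now rewrite (Lam_periodic a b Hab), (P31 a b Hab)).
  assert (PD : periodic G D)
    by (intros a b Hab x y; unfold D;
        now rewrite (Lam_periodic a b Hab), (P22 a b Hab), (Pg a b Hab)).
  set (K := linear_fun (fun _ _ => V1) (fun _ _ => V2) g).
  set (L := linear_fun B1 B2 D).
  set (H := hamiltonian Lam).
  assert (Dec : forall x y p1 p2, cubic_fun A x y p1 p2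
    = al * (K x y p1 p2 * (K x y p1 p2 * K x y p1 p2)) + be * (K x y p1 p2 * K x y p1 p2)
      + ka * K x y p1 p2 + m + H x y p1 p2 * L x y p1 p2).
  { intros x y p1 p2; destruct (Hnf x y) as [E3 [E2 [E1 E0]]].
    pose proof (f_equal Re E3) as R3; pose proof (f_equal Im E3) as I3.
    pose proof (f_equal Re E2) as R2; pose proof (f_equal Im E2) as I2.
    pose proof (f_equal Re E1) as R1; pose proof (f_equal Im E1) as I1.
    unfold null3, null2, null1, null0, Re, Im in *; simpl in R3, I3, R2, I2, R1, I1.
    pose proof (Lam_pos x y) as PL.
    assert (HL : H x y p1 p2 * L x y p1 p2 = (p1 ^ 2 + p2 ^ 2) *
      ((A 3%nat 2%nat x y - 3 * al * V1 * V2 ^ 2) * p1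
       + (A 3%nat 1%nat x y - 3 * al * V1 ^ 2 * V2) * p2
       + (A 2%nat 2%nat x y - (3 * al * g x y + be) * V2 ^ 2)))
      by (unfold H, hamiltonian, L, linear_fun, B1, B2, D; field; lra).
    rewrite HL; unfold cubic_fun, K, linear_fun.
    rewrite E0, R1, I1, I2.
    replace (A 3%nat 0%nat x y) with (A 3%nat 2%nat x y + (A 3%nat 0%nat x y - A 3%nat 2%nat x y)) by ring.
    replace (A 3%nat 3%nat x y) with (A 3%nat 1%nat x y - (A 3%nat 1%nat x y - A 3%nat 3%nat x y)) by ring.
    replace (A 2%nat 0%nat x y) with (A 2%nat 2%nat x y + (A 2%nat 0%nat x y - A 2%nat 2%nat x y)) by ring.
    rewrite R3, I3, R2; ring. }
  assert (Lint : forall x y p1 p2, p1 ^ 2 + p2 ^ 2 <> 0 -> mg_bracket Om L H x y p1 p2 = 0).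
  { intros x y p1 p2 Hp.
    pose proof (grad4_hamiltonian Lam Lam_smooth Lam_pos x y p1 p2) as GH.
    pose proof (grad4_linear_fun _ _ _ x y p1 p2 SB1 SB2 SD) as GL.
    pose proof (grad4_linear_fun _ _ _ x y p1 p2 (Sk V1) (Sk V2) Sg) as GK.
    fold L in GL; fold K in GK; fold H in GH.
    rewrite !pdx_const, !pdy_const, !Rmult_0_l, !Rplus_0_l in GK.
    pose proof (Lam_pos x y) as PL.
    apply (Rmult_eq_reg_l (Lam x y)); [|lra]; rewrite Rmult_0_r.
    etransitivity; [exact (mg_bracket_grad4 Lam Om Lam_smooth Lam_pos _ _ _ _ _ _ _ _ _ GL)|].
    set (uL := pdx B1 x y * p1 + pdx B2 x y * p2 + pdx D x y) in *.
    set (vL := pdy B1 x y * p1 + pdy B2 x y * p2 + pdy D x y) in *.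
    (* The Leibniz rule applied to [Q K + H L]: the brackets of [K] and of [H] with [H] vanish, so
       [H] times the bracket of [L] is what remains. *)
    assert (GF : exists u v w z, grad4 (cubic_fun A) x y p1 p2 u v w z /\
      scaled_bracket Lam Om x y p1 p2 u v w z =
      (3 * al * K x y p1 p2 ^ 2 + 2 * be * K x y p1 p2 + ka)
        * scaled_bracket Lam Om x y p1 p2 (pdx g x y) (pdy g x y) V1 V2
      + H x y p1 p2 * scaled_bracket Lam Om x y p1 p2 uL vL (B1 x y) (B2 x y)
      + L x y p1 p2 * scaled_bracket Lam Om x y p1 p2
          (- ((p1 ^ 2 + p2 ^ 2) * pdx Lam x y / (2 * Lam x y ^ 2)))
          (- ((p1 ^ 2 + p2 ^ 2) * pdy Lam x y / (2 * Lam x y ^ 2)))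
          (p1 / Lam x y) (p2 / Lam x y)).
    { replace (cubic_fun A) with (fun x y p1 p2 =>
        al * (K x y p1 p2 * (K x y p1 p2 * K x y p1 p2)) + be * (K x y p1 p2 * K x y p1 p2)
        + ka * K x y p1 p2 + m + H x y p1 p2 * L x y p1 p2)
        by (do 4 (apply functional_extensionality; intros ?); symmetry; apply Dec).
      do 4 eexists; split.
      - repeat lazymatch goal with
        | |- grad4 (fun x y p q => @?F x y p q + @?K x y p q) _ _ _ _ _ _ _ _ =>
            eapply (grad4_plus F K)
        | |- grad4 (fun x y p q => ?K x y p q) _ _ _ _ _ _ _ _ => eassumption
        | |- grad4 (fun x y p q => @?F x y p q * @?K x y p q) _ _ _ _ _ _ _ _ =>
            eapply (grad4_mult F K)
        | |- grad4 (fun _ _ _ _ => _) _ _ _ _ _ _ _ _ => apply grad4_const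
        | |- grad4 _ _ _ _ _ _ _ _ _ => eassumption
        end.
      - cbv beta; unfold scaled_bracket; ring. }
    destruct GF as [u [v [w [z [GF EF]]]]].
    pose proof (mg_bracket_grad4 Lam Om Lam_smooth Lam_pos _ _ _ _ _ _ _ _ _ GF) as MF.
    rewrite HFI, EF, HK, (scaled_bracket_hamiltonian Lam Om Lam_pos) in MF.
    assert (Hne : H x y p1 p2 <> 0).
    { unfold H, hamiltonian; intros E; apply Hp.
      apply (Rmult_eq_reg_r (/ (2 * Lam x y))); [unfold Rdiv in E; lra|].
      apply Rinv_neq_0_compat; lra. }
    apply (Rmult_eq_reg_l (H x y p1 p2)); [lra | exact Hne]. }
  pose proof (linear_integral_system Lam Om Lam_smooth Lam_pos B1 B2 D SB1 SB2 SD Lint) as Sys.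
  destruct (constant_of_cauchy_riemann G B1 B2) as [b1 [b2 [Hb1 Hb2]]]; try assumption;
    try (intros x y; apply (Sys x y)).
  exists b1, b2, D; split; [exact SD|]; split; [exact PD|].
  split; [intros x y; rewrite <- (Hb2 x y); apply (Sys x y)|].
  split; [intros x y; rewrite <- (Hb1 x y); apply (Sys x y)|].
  split.
  { intros x y; destruct (Sys x y) as [_ [_ [_ [_ E]]]].
    assert (EB : B1 = fun _ _ => b1) by (apply point_fun_ext; exact Hb1).
    rewrite Hb1, Hb2, EB, pdx_const in E; lra. }
  split; [intros x y; now rewrite <- (Hb1 x y)|].
  split; [intros x y; now rewrite <- (Hb2 x y)|].
  intros x y p1 p2 k; rewrite Dec; unfold K, L, linear_fun, H; rewrite Hb1, Hb2; fold k; ring.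
Qed.

End Conclusion.

Theorem theorem1 (G : lattice) (Lam Om : point_fun)
  (Lam_smooth : smooth Lam) (Lam_periodic : periodic G Lam)
  (Lam_pos : forall x y : R, 0 < Lam x y)
  (Om_smooth : smooth Om) (Om_periodic : periodic G Om)
  (Om_nonzero : exists x y : R, Om x y <> 0)
  (E1 E2 : R) (E1_pos : 0 < E1) (E2_pos : 0 < E2) (E1_neq_E2 : E1 <> E2)
  (F : phase_fun)
  (F_cubic : polynomial_in_momenta G real_analytic 3 F)
  (F_integral1 : first_integral_on_level Lam Om E1 F)
  (F_integral2 : first_integral_on_level Lam Om E2 F)
  (F_additional1 : ~ constant_on_level Lam E1 F)
  (F_additional2 : ~ constant_on_level Lam E2 F) :
  (exists alpha beta : R, (alpha <> 0 \/ beta <> 0) /\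
     depends_only_on alpha beta Om /\ depends_only_on alpha beta Lam) /\
  (exists F1 : phase_fun,
     polynomial_in_momenta G smooth 1 F1 /\
     first_integral Lam Om F1 /\
     exists Phi : R -> R -> R, forall x y p1 p2 : R,
       F x y p1 p2 = Phi (F1 x y p1 p2) (hamiltonian Lam x y p1 p2)).
Proof.
  destruct F_cubic as [A [HA [Hne HF]]].
  assert (EF : F = cubic_fun A).
  { do 4 (apply functional_extensionality; intros ?); rewrite HF.
    rewrite !sum_n_R_S, !sum_n_R_0.
    unfold cubic_fun; simpl; ring. }
  subst F; clear HF F_additional1 F_additional2.
  assert (A_smooth : forall s k, (k <= s)%nat -> (s <= 3)%nat -> smooth (A s k))
    by (intros s k H1 H2; apply real_analytic_smooth; now apply HA).
  assert (A_periodic : forall s k, (k <= s)%nat -> (s <= 3)%nat -> periodic G (A s k))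
    by (intros s k H1 H2; now apply HA).
  destruct (cubic_bracket_system Lam Om Lam_smooth Lam_pos A A_smooth E1 E2 E1_pos E2_pos E1_neq_E2
    F_integral1 F_integral2) as [HFI Sys]; cbv zeta in Sys.
  assert (S3 : csmooth (null3 A))
    by (split; apply smooth_minus; apply A_smooth; lia).
  assert (S2 : csmooth (null2 A))
    by (split; [apply smooth_minus; apply A_smooth; lia | apply A_smooth; lia]).
  assert (S1 : csmooth (null1 A)) by (split; apply A_smooth; lia).
  assert (S0 : smooth (null0 A)) by (apply A_smooth; lia).
  assert (Per : forall s k a b, (k <= s)%nat -> (s <= 3)%nat -> in_lattice G a b ->
            forall x y, A s k (x + a) (y + b) = A s k x y)
    by (intros s k a b H1 H2 Hab; exact (A_periodic s k H1 H2 a b Hab)).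
  assert (Q3 : cperiodic G (null3 A))
    by (apply cperiodic_intro; intros a b Hab x y; unfold null3;
        rewrite !(Per _ _ a b) by (lia || assumption); reflexivity).
  assert (Q2 : cperiodic G (null2 A))
    by (apply cperiodic_intro; intros a b Hab x y; unfold null2;
        rewrite !(Per _ _ a b) by (lia || assumption); reflexivity).
  assert (Q1 : cperiodic G (null1 A))
    by (apply cperiodic_intro; intros a b Hab x y; unfold null1;
        rewrite !(Per _ _ a b) by (lia || assumption); reflexivity).
  assert (Q0 : periodic G (null0 A)) by (apply A_periodic; lia).
  assert (D3 : forall x y, dbar (null3 A) x y = 0).
  { intros x y; destruct (Sys x y) as [[X Y] _]; unfold null3.
    rewrite (dbar_pair (fun x y => A 3%nat 0%nat x y - A 3%nat 2%nat x y)
      (fun x y => A 3%nat 1%nat x y - A 3%nat 3%nat x y)).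
    rewrite !pdx_minus, !pdy_minus by (apply A_smooth; lia).
    apply C_ext; unfold Re, Im; simpl; lra. }
  assert (D2 : forall x y, dbar (null2 A) x y = (RtoC (- 3 * Om x y) * Ci * null3 A x y)%C).
  { intros x y; destruct (Sys x y) as [_ [[X Y] _]]; unfold null2, null3.
    rewrite (dbar_pair (fun x y => A 2%nat 0%nat x y - A 2%nat 2%nat x y) (A 2%nat 1%nat)).
    rewrite !pdx_minus, !pdy_minus by (apply A_smooth; lia).
    apply C_ext; unfold Re, Im; simpl; lra. }
  assert (D1 : forall x y, dbar (null1 A) x y = (RtoC (- 2 * Om x y) * Ci * null2 A x y)%C).
  { intros x y; destruct (Sys x y) as [_ [_ [[X Y] _]]]; unfold null1, null2.
    rewrite (dbar_pair (A 1%nat 0%nat) (A 1%nat 1%nat)).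
    apply C_ext; unfold Re, Im; simpl; lra. }
  assert (D0x : forall x y, pdx (null0 A) x y = Om x y * Im (null1 A x y))
    by (intros x y; apply (Sys x y)).
  assert (D0y : forall x y, pdy (null0 A) x y = - Om x y * Re (null1 A x y))
    by (intros x y; apply (Sys x y)).
  destruct (classic (forall x y, null1 A x y = 0)) as [Z|NZ].
  - destruct (null_system_trivial G (null3 A) (null2 A) (null1 A) (null0 A) Om) as [Z3 [Z2 [m Hm]]];
      try assumption.
    (* When the null polynomial is the constant [m], the normal form holds with [V = 0], [g = 0] and
       [Q = m], and the quotient by the Hamiltonian is the linear integral. *)
    destruct (null_remainder G Lam Om Lam_smooth Lam_periodic Lam_pos A A_smooth A_periodic
      0 0 (fun _ _ => 0) 0 0 0 m) as [b1 [b2 [D [SD [PD [Dx [Dy [HL [Hb1 [Hb2 HF]]]]]]]]]].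
    + apply smooth_const.
    + intros a b _ x y; reflexivity.
    + intros x y; rewrite Z3, Z2, Z, Hm; repeat split; Cring || ring.
    + intros x y p1 p2; unfold scaled_bracket; rewrite pdx_const, pdy_const; ring.
    + exact HFI.
    + apply (linear_integral_conclusion G Lam Om Lam_smooth Lam_pos Om_smooth
        (cubic_fun A) b1 b2 D (fun s h => m + h * s)); try assumption.
      (* If both constants vanished, so would the coefficients of [p1 p2^2] and [p1^2 p2], and with
         [null3 = 0] the whole cubic part, contrary to the degree. *)
      * destruct (Req_dec b1 0) as [B1|B1]; [|now left].
        destruct (Req_dec b2 0) as [B2|B2]; [|now right]. exfalso.
        assert (A32 : forall x y, A 3%nat 2%nat x y = 0).
        { intros x y; pose proof (Lam_pos x y); specialize (Hb1 x y); rewrite B1 in Hb1.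
          apply (Rmult_eq_reg_l (2 * Lam x y)); lra. }
        assert (A31 : forall x y, A 3%nat 1%nat x y = 0).
        { intros x y; pose proof (Lam_pos x y); specialize (Hb2 x y); rewrite B2 in Hb2.
          apply (Rmult_eq_reg_l (2 * Lam x y)); lra. }
        destruct Hne as [k [x [y [Hk Hne]]]]; apply Hne.
        pose proof (f_equal Re (Z3 x y)) as R3; pose proof (f_equal Im (Z3 x y)) as I3.
        unfold null3, Re, Im in R3, I3; simpl in R3, I3.
        specialize (A32 x y); specialize (A31 x y).
        destruct k as [|[|[|[|k]]]]; [lra | lra | lra | lra | lia].
      * intros x y p1 p2; rewrite HF; ring.
  - assert (NZ' : exists x y, null1 A x y <> 0).
    { apply NNPP; intros N; apply NZ; intros x y; apply NNPP; intros N'; apply N; now exists x, y. }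
    destruct (null_normal_form G (null3 A) (null2 A) (null1 A) (null0 A) Om)
      as [V1 [V2 [g [al [be [ka [m [HV [Sg [Pg [Gx [Gy [Hnf Hcancel]]]]]]]]]]]]];
      try assumption.
    { apply (HA 1%nat 0%nat); lia. }
    { apply (HA 1%nat 1%nat); lia. }
    assert (Sk : forall k, smooth (fun _ _ => k)) by apply smooth_const.
    set (lam := fun x y => 3 * al * (g x y * g x y) + 2 * be * g x y + ka).
    assert (HL : forall x y, V1 * pdx Lam x y + V2 * pdy Lam x y = 0).
    (* The trace equation for [lam V] reads [Lam] times [V . grad lam] plus [lam] times
       [V . grad Lam]. The first term is zero because [lam] is a function of [g], and the factor
       [lam] cancels. *)
    { apply (Hcancel (fun x y => V1 * pdx Lam x y + V2 * pdy Lam x y)).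
      - intros x y; apply smooth_continuity; smooth_tac.
      - assert (L1 : A 1%nat 0%nat = fun x y => lam x y * V1).
        { apply point_fun_ext; intros x y; destruct (Hnf x y) as [_ [_ [E _]]].
          apply (f_equal Re) in E; unfold null1, Re in E; simpl in E.
          rewrite E; unfold lam; ring. }
        assert (L2 : A 1%nat 1%nat = fun x y => lam x y * V2).
        { apply point_fun_ext; intros x y; destruct (Hnf x y) as [_ [_ [E _]]].
          apply (f_equal Im) in E; unfold null1, Im in E; simpl in E.
          rewrite E; unfold lam; ring. }
        intros x y; destruct (Sys x y) as [_ [_ [_ [_ [_ E]]]]].
        rewrite L1, L2 in E; unfold lam in E.
        rewrite !pdx_mult, !pdx_plus, !pdx_mult, !pdx_const in E by smooth_tac.
        rewrite !pdy_mult, !pdy_plus, !pdy_mult, !pdy_const in E by smooth_tac.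
        rewrite Gx, Gy in E.
        rewrite <- E; ring. }
    destruct (null_remainder G Lam Om Lam_smooth Lam_periodic Lam_pos A A_smooth A_periodic
      V1 V2 g al be ka m Sg Pg Hnf) as [b1 [b2 [D [SD [PD [Dx [Dy [_ [_ [_ HF]]]]]]]]]].
    + now apply linear_first_integral.
    + exact HFI.
    (* The quotient is a linear integral of the same flow, so it is affine in the one already
       found. *)
    + destruct (linear_integrals_proportional G Om g D V1 V2 b1 b2)
        as [mu [nu [-> [-> HD]]]]; try assumption.
      apply (linear_integral_conclusion G Lam Om Lam_smooth Lam_pos Om_smooth
        (cubic_fun A) V1 V2 g
        (fun s h => al * s ^ 3 + be * s ^ 2 + ka * s + m + h * (mu * s + nu))); try assumption.
      intros x y p1 p2; rewrite HF, HD; ring.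
Qed.
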